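(* Let $K$ be a number field of degree $3$ over $\mathbb{Q}$ and let $E$ be an elliptic curve over $K$ such that $E(K)$ contains a subgroup isomorphic to $C_2\times C_{14}$. Then $K$ is a normal (Galois) extension of $\mathbb{Q}$, and $E$ is a base change of an elliptic curve over $\mathbb{Q}$, i.e. there exists an elliptic curve $E_0$ over $\mathbb{Q}$ with $E_0\times_{\mathbb{Q}}K\cong E$ over $K$. *)

(* Defs.v *)
From HB Require Import structures.
From mathcomp Require Import all_boot all_order all_algebra all_field.
Set Implicit Arguments. Unset Strict Implicit. Unset Printing Implicit Defensive.
Import Order.TTheory GRing.Theory Num.Theory.
Local Open Scope ring_scope.

(* Weierstrass coefficients: y^2 + a1 x y + a3 y = x^3 + a2 x^2 + a4 x + a6 *)
Record wcoef (F : fieldType) := WCoef { a1 : F; a2 : F; a3 : F; a4 : F; a6 : F }.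

Section Weierstrass.
Variable F : fieldType.
Implicit Types (E : wcoef F).

Definition wdisc E : F :=
  let b2 := a1 E ^+ 2 + 4%:R * a2 E in
  let b4 := 2%:R * a4 E + a1 E * a3 E in
  let b6 := a3 E ^+ 2 + 4%:R * a6 E in
  let b8 := a1 E ^+ 2 * a6 E + 4%:R * a2 E * a6 E - a1 E * a3 E * a4 E
            + a2 E * a3 E ^+ 2 - a4 E ^+ 2 in
  - b2 ^+ 2 * b8 - 8%:R * b4 ^+ 3 - 27%:R * b6 ^+ 2 + 9%:R * b2 * b4 * b6.

Definition elliptic E : bool := wdisc E != 0.

(* points of E(F): None is the point at infinity O *)
Definition on_curve E (P : option (F * F)) : bool :=
  match P with
  | None => true
  | Some (x, y) =>
      y ^+ 2 + a1 E * x * y + a3 E * y ==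
      x ^+ 3 + a2 E * x ^+ 2 + a4 E * x + a6 E
  end.

(* chord-and-tangent group law (Silverman, Alg. III.2.3) *)
Definition wadd E (P Q : option (F * F)) : option (F * F) :=
  match P, Q with
  | None, _ => Q
  | _, None => P
  | Some (x1, y1), Some (x2, y2) =>
    if (x1 == x2) && (y1 + y2 + a1 E * x2 + a3 E == 0) then None else
    let '(lam, nu) :=
      if x1 == x2 then
        ((3%:R * x1 ^+ 2 + 2%:R * a2 E * x1 + a4 E - a1 E * y1)
           / (2%:R * y1 + a1 E * x1 + a3 E),
         (- x1 ^+ 3 + a4 E * x1 + 2%:R * a6 E - a3 E * y1)
           / (2%:R * y1 + a1 E * x1 + a3 E))
      else ((y2 - y1) / (x2 - x1), (y1 * x2 - y2 * x1) / (x2 - x1)) in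
    let x3 := lam ^+ 2 + a1 E * lam - a2 E - x1 - x2 in
    Some (x3, - (lam + a1 E) * x3 - nu - a3 E)
  end.

Definition wmul E (n : nat) (P : option (F * F)) : option (F * F) :=
  iter n (wadd E P) None.

(* E(F) contains a subgroup isomorphic to C_2 x C_14: there is an injective
   homomorphism Z/2 x Z/14 -> E(F), i.e. points P, Q (the images of the
   generators) with 2P = O, 14Q = O and iP + jQ = O only for i = j = 0
   (0 <= i < 2, 0 <= j < 14). *)
Definition has_C2xC14 E : Prop :=
  exists P Q : option (F * F),
    [/\ on_curve E P, on_curve E Q, wmul E 2 P = None, wmul E 14 Q = None &
        forall i j : nat, (i < 2)%N -> (j < 14)%N ->
          wadd E (wmul E i P) (wmul E j Q) = None -> i = 0%N /\ j = 0%N].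

(* isomorphism of Weierstrass curves over F (Silverman III.1 / III.3.1(b)):
   E' is obtained from E by x = u^2 x' + r, y = u^3 y' + u^2 s x' + t *)
Definition wiso E E' : Prop :=
  exists u r s t : F, u != 0 /\
   [/\ u * a1 E' = a1 E + 2%:R * s,
    u ^+ 2 * a2 E' = a2 E - s * a1 E + 3%:R * r - s ^+ 2,
    u ^+ 3 * a3 E' = a3 E + r * a1 E + 2%:R * t,
    u ^+ 4 * a4 E' = a4 E - s * a3 E + 2%:R * r * a2 E - (t + r * s) * a1 E
                     + 3%:R * r ^+ 2 - 2%:R * s * t &
    u ^+ 6 * a6 E' = a6 E + r * a4 E + r ^+ 2 * a2 E + r ^+ 3 - t * a3 E
                     - t ^+ 2 - r * t * a1 E].

End Weierstrass.

Definition wmap (F F' : fieldType) (f : F -> F') (E : wcoef F) : wcoef F' :=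
  WCoef (f (a1 E)) (f (a2 E)) (f (a3 E)) (f (a4 E)) (f (a6 E)).

Definition normal_over_Q (K : fieldExtType rat) : Prop :=
  forall x : K, exists rs : seq K,
    minPoly 1%VS x = \prod_(z <- rs) ('X - z%:P).

(* Main.v *)
Require Import Defs.
From HB Require Import structures.
From mathcomp Require Import all_boot all_order all_algebra all_field.
From mathcomp Require Import realalg ring lra zify.
Set Implicit Arguments. Unset Strict Implicit. Unset Printing Implicit Defensive.
Import Order.TTheory GRing.Theory Num.Theory.
Local Open Scope ring_scope.

(**
  A point of order 7 puts E in Tate form [tate d] (the universal curve over
  X_1(7)), with d in K.  Full 2-torsion makes the discriminant a square, which
  gives y in K with y^2 = hyp d, a curve H of genus 2; it also splits the cyclic
  cubic cut out by the 2-division polynomial, which after a twist reads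
  (u^3 + u^2 - 2u - 1) d(d-1) = +-y u(u+1) with u in K.

  As K is cubic and H has no rational point with y <> 0, d generates K and
  y = g(d) with g rational of degree at most 2.  Then hyp - g^2 = m r, where m
  is the minimal polynomial of d and r is a rational quadratic, so the roots of
  r give quadratic points of H.  Over the cubic field Q(w) = Q(zeta_7)^+ the
  curve H maps to an elliptic curve whose only rational points are 2-torsion
  (2-descent over Z[w], a Euclidean ring); this leaves five possibilities for r.
  Four of them are excluded by taking norms from K(om) to Q(om), om a cube root
  of unity, in (u - om)^3 d(d-1) = u(u+1)(y - (1 + 3 om) d(d-1)): 1 + 3 om would
  be a rational multiple of a cube.

  In the remaining case r = T(T-1), so y = z d(d-1) with z rational, d is a root
  of T^3 - 8T^2 + 5T + 1 - z^2 T(T-1), whose roots d, 1/(1-d), 1 - 1/d all lie in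
  K, and c4 and c6 of [tate d] are, up to scaling, rational functions of z^2.
*)

(** * Cubic extensions by coordinates *)

(** What leaves only five quadratics: the images of two conjugate points on the elliptic curve span
    a line defined over Q(w), so its third point is Q(w)-rational, hence 2-torsion. Each of the
    three candidates gives one equation over Q(w), that is three conics over Q in the sum S and the
    product M of the roots of r. The norm test rests on hyp - (1 + 3 om)^2 X^2 = X (T + om)^3, with
    X = T (T - 1): the norm of g - (1 + 3 om) X over the roots of m, times that over the roots of r,
    is a rational number times a cube, so the test depends on r alone. As r fixes g modulo r only up
    to sign, the equation for u is needed for y and for -y. The descent works because the 2-torsion
    is rational over Q(w), the differences of the three roots are units, and every totally positive
    unit of Z[w] is a square. Associativity of the chord-and-tangent law is never proved in general:
    the multiples of one point placed at the origin suffice. *)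

(* R[X] / (X^3 - c2 X^2 - c1 X - c0) in the basis 1, X, X^2 *)
Definition cub (R : comNzRingType) (c0 c1 c2 : R) : Type := (R * R * R)%type.

Section CubicRing.
Variables (R : comNzRingType) (c0 c1 c2 : R).
Local Notation T := (cub c0 c1 c2).
HB.instance Definition _ := GRing.Zmodule.copy T (R * R * R)%type.

Definition cubX (a : T) : T :=
  let: (a0, a1, a2) := a in (c0 * a2, a0 + c1 * a2, a1 + c2 * a2).
Definition cub_mul (a b : T) : T :=
  let: (b0, b1, b2) := b in
  let: (p0, p1, p2) := a in let: (q0, q1, q2) := cubX a in
  let: (r0, r1, r2) := cubX (cubX a) in
  (p0 * b0 + q0 * b1 + r0 * b2, p1 * b0 + q1 * b1 + r1 * b2,
   p2 * b0 + q2 * b1 + r2 * b2).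
Definition cub_one : T := (1, 0, 0).

Fact cub_mulA : associative cub_mul.
Proof. by move=> [[x0 x1] x2] [[y0 y1] y2] [[z0 z1] z2]; congr (_, _, _); ring. Qed.
Fact cub_mulC : commutative cub_mul.
Proof. by move=> [[x0 x1] x2] [[y0 y1] y2]; congr (_, _, _); ring. Qed.
Fact cub_mul1 : left_id cub_one cub_mul.
Proof. by move=> [[x0 x1] x2]; congr (_, _, _); rewrite /=; ring. Qed.
Fact cub_mulD : left_distributive cub_mul +%R.
Proof. by move=> [[x0 x1] x2] [[y0 y1] y2] [[z0 z1] z2]; congr (_, _, _); rewrite /=; ring. Qed.
Fact cub_1neq0 : cub_one != 0.
Proof. by apply/eqP => -[] /eqP; rewrite oner_eq0. Qed.
HB.instance Definition _ := GRing.Zmodule_isComNzRing.Build T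
  cub_mulA cub_mulC cub_mul1 cub_mulD cub_1neq0.

(** Determinant of multiplication by [a]: the rows are a, X a and X^2 a. *)
Definition cub_norm (a : T) : R :=
  let: (p0, p1, p2) := a in let: (q0, q1, q2) := cubX a in
  let: (r0, r1, r2) := cubX (cubX a) in
  p0 * (q1 * r2 - q2 * r1) - p1 * (q0 * r2 - q2 * r0) + p2 * (q0 * r1 - q1 * r0).
(** Cofactors of the first column of that matrix: the combination of a, X a, X^2 a that is equal to
    the norm. *)
Definition cub_adj (a : T) : T :=
  let: (p0, p1, p2) := a in let: (q0, q1, q2) := cubX a in
  let: (r0, r1, r2) := cubX (cubX a) in
  (q1 * r2 - q2 * r1, p2 * r1 - p1 * r2, p1 * q2 - p2 * q1).
Definition cubC (x : R) : T := (x, 0, 0).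

Lemma cub_normM a b : cub_norm (a * b) = cub_norm a * cub_norm b.
Proof.
by case: a => [[x0 x1] x2]; case: b => [[y0 y1] y2]; rewrite /cub_norm /=; ring.
Qed.
Lemma cub_norm1 : cub_norm 1 = 1.
Proof. by rewrite /cub_norm /=; ring. Qed.
Lemma cub_adjP a : a * cub_adj a = cubC (cub_norm a).
Proof.
by case: a => [[x0 x1] x2]; congr (_, _, _); rewrite /=; ring.
Qed.
End CubicRing.
(* the ring of integers Z[w] of Q(zeta_7)^+, w = zeta_7 + zeta_7^-1 *)
Definition O := cub (1 : int) 2 (-1).
HB.instance Definition _ := GRing.ComNzRing.on O.

Section Eval.
Variables (R : comNzRingType) (z : R).
Hypothesis hz : z ^+ 3 = 1 + 2 * z - z ^+ 2.
Definition ev (a : O) : R :=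
  let: (a0, a1, a2) := a in a0%:~R + a1%:~R * z + a2%:~R * z ^+ 2.
Lemma evD a b : ev (a + b) = ev a + ev b.
Proof. by case: a b => [[a0 a1] a2] [[b0 b1] b2]; rewrite /ev /=; ring. Qed.
Lemma evM a b : ev (a * b) = ev a * ev b.
Proof. by case: a b => [[a0 a1] a2] [[b0 b1] b2]; rewrite /ev /=; ring: hz. Qed.
End Eval.

Arguments cub_norm : simpl never.
Arguments cub_adj : simpl never.
Arguments ev : simpl never.

Definition wO : O := (0, 1, 0).
Definition ofZ (n : int) : O := (n, 0, 0).

(** The trace of a^2, a positive definite form; it measures size in the rounding and in the
    reduction of units. *)
Definition trsq (a : O) : int :=
  let: (a0, a1, a2) := a in
  3 * a0 ^+ 2 - 2 * a0 * a1 + 10 * a0 * a2 + 5 * a1 ^+ 2 - 8 * a1 * a2 + 13 * a2 ^+ 2.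

Arguments trsq : simpl never.

(** * Real embeddings of Z[w] and the Euclidean algorithm *)

Local Notation N := (@cub_norm int 1 2 (-1)).
(** The root 2 cos(2 pi / 7) = 1.2469..., enclosed for the numerical estimates below. *)
Lemma realw_ex : exists z : realalg,
  (z ^+ 3 == 1 + 2 * z - z ^+ 2) && (31 / 25 <= z <= 5 / 4).
Proof.
pose p : {poly realalg} := 'X^3 + 'X^2 - 2%:P * 'X - 1.
have e x : p.[x] = x ^+ 3 + x ^+ 2 - 2 * x - 1 by rewrite /p !hornerE.
have h1 : (31 / 25 : realalg) <= 5 / 4 by lra.
have h2 : p.[31 / 25] <= 0 <= p.[5 / 4].
  by rewrite !e; apply/andP; split; lra.
have [z Hz /rootP] := poly_ivt h1 h2.
by rewrite e => Hr; exists z; rewrite Hz andbT; apply/eqP; lra.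
Qed.

Definition rw : realalg := sval (sigW realw_ex).
Lemma rwE : rw ^+ 3 = 1 + 2 * rw - rw ^+ 2.
Proof. by rewrite /rw; case: sigW => z /= /andP[/eqP]. Qed.
Lemma rw_bnd : 31 / 25 <= rw <= 5 / 4.
Proof. by rewrite /rw; case: sigW => z /= /andP[]. Qed.

(** The Galois group is generated by w -> w^2 - 2, which sends rw to w2 and w2 to w3. *)
Definition w2 := rw ^+ 2 - 2.
Definition w3 := 1 - rw - rw ^+ 2.
Lemma w2E : w2 ^+ 3 = 1 + 2 * w2 - w2 ^+ 2.
Proof. by rewrite /w2; ring: rwE. Qed.
Lemma w3E : w3 ^+ 3 = 1 + 2 * w3 - w3 ^+ 2.
Proof. by rewrite /w3; ring: rwE. Qed.

Definition ev1 := ev rw. Definition ev2 := ev w2. Definition ev3 := ev w3.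

Lemma ev_norm a : (N a)%:~R = ev1 a * ev2 a * ev3 a.
Proof.
case: a => [[a0 a1] a2].
rewrite /ev1 /ev2 /ev3 /ev /cub_norm /cubX /w2 /w3 /=; ring: rwE.
Qed.
Lemma ev_trsq a : (trsq a)%:~R = ev1 a ^+ 2 + ev2 a ^+ 2 + ev3 a ^+ 2.
Proof.
case: a => [[a0 a1] a2].
rewrite /ev1 /ev2 /ev3 /ev /trsq /w2 /w3 /=; ring: rwE.
Qed.

Lemma ev1M a b : ev1 (a * b) = ev1 a * ev1 b. Proof. exact: evM rwE _ _. Qed.
Lemma ev2M a b : ev2 (a * b) = ev2 a * ev2 b. Proof. exact: evM w2E _ _. Qed.
Lemma ev3M a b : ev3 (a * b) = ev3 a * ev3 b. Proof. exact: evM w3E _ _. Qed.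

Lemma amgm3 (F : realFieldType) (x y z : F) : 0 <= x -> 0 <= y -> 0 <= z ->
  27 * (x * y * z) <= (x + y + z) ^+ 3.
Proof.
move=> hx hy hz.
have : 0 <= (x + y + z) * ((x - y) ^+ 2 + (y - z) ^+ 2 + (x - z) ^+ 2).
  by rewrite mulr_ge0 ?addr_ge0 // sqr_ge0.
have : 0 <= x * (y - z) ^+ 2 by rewrite mulr_ge0 // sqr_ge0.
have : 0 <= y * (x - z) ^+ 2 by rewrite mulr_ge0 // sqr_ge0.
have : 0 <= z * (x - y) ^+ 2 by rewrite mulr_ge0 // sqr_ge0.
nra.
Qed.

(** The arithmetic-geometric mean inequality for the squares of the three conjugates. *)
Lemma norm_trsq a : 27 * N a ^+ 2 <= trsq a ^+ 3.
Proof.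
rewrite -(ler_int realalg) intrM !rmorphXn /= ev_norm ev_trsq.
by have := amgm3 (sqr_ge0 (ev1 a)) (sqr_ge0 (ev2 a)) (sqr_ge0 (ev3 a)); lra.
Qed.

(** Modulo n the three numbers lie on a circle of length n and leave a gap of at least n/3, so
    shifts by multiples of n bring them into an interval of length 2n/3 ([P2]). A common shift then
    brings their sum within 3n/2 of 0 ([P1]). *)
Lemma round_lem (n : int) (x y z : int) : 0 < n -> exists i j k : int,
  let x' := x - n * i in let y' := y - n * j in let z' := z - n * k in
  x' ^+ 2 + y' ^+ 2 + z' ^+ 2 +
  2 * ((x' - y') ^+ 2 + (y' - z') ^+ 2 + (x' - z') ^+ 2) < 3 * n ^+ 2.
Proof.
move=> n0.
pose P x y z := exists i j k : int,
  let x' := x - n * i in let y' := y - n * j in let z' := z - n * k in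
  x' ^+ 2 + y' ^+ 2 + z' ^+ 2 +
  2 * ((x' - y') ^+ 2 + (y' - z') ^+ 2 + (x' - z') ^+ 2) < 3 * n ^+ 2.
have Psw12 a b c : P a b c -> P b a c.
  by move=> [i [j [k H]]]; exists j, i, k; move: H => /=; nra.
have Psw23 a b c : P a b c -> P a c b.
  by move=> [i [j [k H]]]; exists i, k, j; move: H => /=; nra.
have Psh a b c i j k : P (a - n * i) (b - n * j) (c - n * k) -> P a b c.
  move=> [i' [j' [k' H]]]; exists (i + i'), (j + j'), (k + k'); move: H => /=.
  by rewrite !mulrDr !opprD !addrA.
have P1 a b c : a <= b <= c -> 3 * (c - a) <= 2 * n -> P a b c.
  move=> /andP[ab bc] ca.
  pose s := a + b + c.
  have [k Hk] : exists k : int, - (3 * n) <= 2 * (s - 3 * n * k) <= 3 * n.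
    exists ((2 * s + 3 * n) %/ (6 * n))%Z.
    have := divz_eq (2 * s + 3 * n) (6 * n).
    have := modz_ge0 (2 * s + 3 * n) (_ : 6 * n != 0).
    have := ltz_mod (2 * s + 3 * n) (_ : 6 * n != 0).
    set q := (_ %/ _)%Z; set r := (_ %% _)%Z.
    move=> /(_ ltac:(lia)) h1 /(_ ltac:(lia)) h2 h3; nia.
  exists k, k, k => /=.
  have hs : 4 * (s - 3 * n * k) ^+ 2 <= 9 * n ^+ 2 by nra.
  set p := b - a; set q := c - b.
  have hp : 0 <= p by rewrite /p; lia.
  have hq : 0 <= q by rewrite /q; lia.
  have hpq : 3 * (p + q) <= 2 * n by rewrite /p /q; lia.
  have h1 : 9 * (p + q) ^+ 2 <= 4 * n ^+ 2 by nra.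
  have h2 : p ^+ 2 + q ^+ 2 <= (p + q) ^+ 2 by nra.
  have n2 : 0 < n ^+ 2 by nra.
  have -> : a - n * k - (b - n * k) = - p by rewrite /p; lia.
  have -> : b - n * k - (c - n * k) = - q by rewrite /q; lia.
  have -> : a - n * k - (c - n * k) = - (p + q) by rewrite /p /q; lia.
  have h3 : 3 * ((a - n * k) ^+ 2 + (b - n * k) ^+ 2 + (c - n * k) ^+ 2) =
      (s - 3 * n * k) ^+ 2 + (p ^+ 2 + q ^+ 2 + (p + q) ^+ 2).
    by rewrite /s /p /q; ring.
  nra.
have P2 a b c : 0 <= a -> a <= b -> b <= c -> c < n -> P a b c.
  move=> a0 ab bc cn.
  have [h|h] := lerP (3 * (c - a)) (2 * n); first by apply: P1 => //; lia.
  have [h'|h'] := lerP n (3 * (b - a)).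
    apply: (Psh _ _ _ (- 1) 0 0); apply: (Psw12); apply: (Psw23); apply: P1; lia.
  apply: (Psh _ _ _ (- 1) (- 1) 0); apply: (Psw23); apply: (Psw12); apply: P1; lia.
apply: (Psh _ _ _ (x %/ n)%Z (y %/ n)%Z (z %/ n)%Z).
have e t : t - n * (t %/ n)%Z = (t %% n)%Z by rewrite /modz mulrC.
rewrite !e.
have n1 : n != 0 by lia.
have hx := modz_ge0 x n1; have hx' := ltz_pmod x n0.
have hy := modz_ge0 y n1; have hy' := ltz_pmod y n0.
have hz := modz_ge0 z n1; have hz' := ltz_pmod z n0.
move: (x %% n)%Z (y %% n)%Z (z %% n)%Z hx hx' hy hy' hz hz' => a b c *.
have [ab|ab] := lerP a b; have [bc|bc] := lerP b c; have [ac|ac] := lerP a c.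
- by apply: P2.
- by exfalso; lia.
- by apply: (Psw23); apply: P2 => //; lia.
- by apply: (Psw23); apply: (Psw12); apply: P2 => //; lia.
- by apply: (Psw12); apply: P2 => //; lia.
- by apply: (Psw12); apply: (Psw23); apply: P2 => //; lia.
- by exfalso; lia.
- by apply: (Psw12); apply: (Psw23); apply: (Psw12); apply: P2 => //; lia.
Qed.

(* in a normal basis the trace form is a sum of squares: a rounding bound for [cub_round] *)
Lemma trsq_nc (x y z : int) :
  trsq (- z - 2 * (y - z), x - z, y - z) =
  x ^+ 2 + y ^+ 2 + z ^+ 2 + 2 * ((x - y) ^+ 2 + (y - z) ^+ 2 + (x - z) ^+ 2).
Proof. rewrite /trsq; ring. Qed.

Lemma normM (a b : O) : N (a * b) = N a * N b.
Proof. exact: cub_normM. Qed.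

(** By [norm_trsq], a remainder whose trace form is below 3 n^2 has norm below n^3 in absolute
    value. *)
Lemma cub_round (n : int) (c : O) : 0 < n -> exists q : O,
  `|N (c - ofZ n * q)| < n ^+ 3.
Proof.
move=> n0; case: c => [[c0 c1] c2].
(* The three arguments are the coordinates of [c] in the normal basis w, w^2 - 2, 1 - w - w^2; the
   next witness returns to the powers of w. *)
have [i [j [k /= H]]] := round_lem (- c0 + c1 - 2 * c2) (- c0 - c2) (- c0 - 2 * c2) n0.
exists (- k - 2 * (j - k), i - k, j - k).
set r := (_ - _ * _).
have Er : r = ((- c0 - 2 * c2 - n * k) * (- 1) - 2 * ((- c0 - c2 - n * j) - (- c0 - 2 * c2 - n * k)),
    (- c0 + c1 - 2 * c2 - n * i) - (- c0 - 2 * c2 - n * k),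
    (- c0 - c2 - n * j) - (- c0 - 2 * c2 - n * k)).
  by rewrite /r /ofZ; congr (_, _, _); rewrite /=; ring.
have {}H : trsq r < 3 * n ^+ 2 by rewrite Er mulrN1 trsq_nc.
have h := norm_trsq r.
have t0 : 0 <= trsq r.
  by rewrite -(ler_int realalg) ev_trsq !addr_ge0 ?sqr_ge0.
have h2 : trsq r ^+ 3 < (3 * n ^+ 2) ^+ 3 by rewrite ltrXn2r // ?nnegrE; nia.
have h3 : N r ^+ 2 < (n ^+ 3) ^+ 2 by lia.
have h4 : 0 < n ^+ 3 by rewrite exprn_gt0.
by move: (N r) (n ^+ 3) h3 h4 => x y h3 h4; rewrite ltr_norml; apply/andP; split; nia.
Qed.

Lemma norm_adj (a : O) : N (cub_adj a) * N a = N a ^+ 3.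
Proof.
rewrite -normM mulrC cub_adjP /cubC.
by case: a => [[x y] z]; rewrite /cub_norm /=; ring.
Qed.

Lemma norm_ofZ n : N (ofZ n) = n ^+ 3.
Proof. by rewrite /cub_norm /ofZ /=; ring. Qed.

(** Rounds the quotient a / b = a adj(b) / N b. The sign makes the denominator positive; the factor
    N(adj b) = (N b)^2 cancels at the end. *)
Lemma euclid (a b : O) : N b != 0 -> exists q : O, `|N (a - q * b)| < `|N b|.
Proof.
move=> b0.
have nb : 0 < `|N b| by rewrite normr_gt0.
have [q Hq] := cub_round (a * cub_adj b * ofZ (sgz (N b))) nb.
have Eb : b * cub_adj b * ofZ (sgz (N b)) = ofZ `|N b|.
  by rewrite cub_adjP normrEsg mulrC /cubC /ofZ; congr (_, _, _); rewrite /=; ring.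
exists q.
have E : N (a - q * b) * (N (cub_adj b) * N (ofZ (sgz (N b)))) =
    N (a * cub_adj b * ofZ (sgz (N b)) - ofZ `|N b| * q).
  by rewrite -!normM -Eb; congr N; ring.
move/(congr1 (fun x => `|x|)): E; rewrite normrM.
have -> : `|N (cub_adj b) * N (ofZ (sgz (N b)))| = `|N b| ^+ 2.
  rewrite norm_ofZ normrM normrX normr_sgz b0 expr1n mulr1.
  by apply: (mulIf (x := `|N b|)); rewrite ?normr_eq0 // -normrM norm_adj normrX exprSr.
move=> E; rewrite -E in Hq.
have : 0 < `|N b| ^+ 2 by rewrite exprn_gt0.
by move=> h; rewrite -(ltr_pM2r h) -exprS.
Qed.

(** The norm form has no nontrivial zero over F_2, by inspection of the eight triples. *)
Lemma norm_even (a : O) : (2 %| N a)%Z ->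
  [&& (2 %| a.1.1)%Z, (2 %| a.1.2)%Z & (2 %| a.2)%Z].
Proof.
have c2 : 2%N \in [pchar 'F_2] by rewrite pchar_Fp.
rewrite !(dvdz_pcharf c2); case: a => [[a0 a1] a2] /=.
have -> : (N (a0, a1, a2))%:~R = @cub_norm 'F_2 1 2 (-1) (a0%:~R, a1%:~R, a2%:~R).
  by rewrite /cub_norm /cubX /=; ring.
move: a0%:~R a1%:~R a2%:~R => x y z.
by case: x => [[|[|//]]] ?; case: y => [[|[|//]]] ?; case: z => [[|[|//]]] ?.
Qed.

(** Infinite descent: a zero of the norm form is divisible by 2, and its half is again a zero. *)
Lemma normO_eq0 (a : O) : N a = 0 -> a = 0.
Proof.
move=> H; suff S n : forall b : O, N b = 0 ->
    (`|b.1.1| + `|b.1.2| + `|b.2| < n)%N -> b = 0 by apply: (S _.+1).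
elim: n => // n IH b Hb Hn.
have := @norm_even b; rewrite Hb dvdz0 => /(_ isT).
case: b Hb Hn => [[b0 b1] b2] Hb Hn /= /and3P[/dvdzP[c0 E0] /dvdzP[c1 E1] /dvdzP[c2 E2]].
have Eb : (b0, b1, b2) = ofZ 2 * (c0, c1, c2) :> O.
  by rewrite /ofZ E0 E1 E2; congr (_, _, _); rewrite /=; ring.
have Hc : N (c0, c1, c2) = 0.
  by move: Hb; rewrite Eb normM norm_ofZ => /eqP; rewrite mulf_eq0 => /orP[/eqP|/eqP].
have [z|nz] := eqVneq ((b0, b1, b2) : O) 0; first exact: z.
have := IH _ Hc.
rewrite Eb => ->; first by rewrite mulr0.
move: Hn nz => /= Hn nz.
have : ~ (b0 = 0 /\ b1 = 0 /\ b2 = 0).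
  by move=> [z0 [z1 z2]]; case/eqP: nz; rewrite z0 z1 z2.
lia.
Qed.

Lemma O_mulf_eq0 (a b : O) : a * b = 0 -> a = 0 \/ b = 0.
Proof.
move/(congr1 N); rewrite normM [RHS]/cub_norm /= => /eqP; rewrite !(mul0r, mulr0, subr0, add0r) mulf_eq0.
by case/orP => /eqP /normO_eq0; [left | right].
Qed.

Lemma O_mulI (c a b : O) : c != 0 -> c * a = c * b -> a = b.
Proof.
move=> c0 /eqP; rewrite -subr_eq0 -mulrBr => /eqP /O_mulf_eq0[] /eqP; first by rewrite (negbTE c0).
by rewrite subr_eq0 => /eqP.
Qed.

Lemma normN0 (a : O) : a != 0 -> N a != 0.
Proof. by apply: contra => /eqP/normO_eq0->. Qed.

(** * Greatest common divisors and squares in Z[w] *)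

Lemma O_gcd (a b : O) : exists g u v s t : O, [/\ g = u * a + v * b, a = g * s & b = g * t].
Proof.
suff S n : forall a b : O, (`|N b| < n)%N ->
  exists g u v s t : O, [/\ g = u * a + v * b, a = g * s & b = g * t] by apply: (S _.+1).
elim: n => // n IH {}a {}b Hb.
have [->|b0] := eqVneq b 0.
  by exists a, 1, 0, 1, 0; split; ring.
have [q Hq] := euclid a (normN0 b0).
have [|g [u [v [s [t [E1 E2 E3]]]]]] := IH b (a - q * b); first by lia.
exists g, v, (u - v * q), (t + q * s), s; split => //; first by rewrite E1; ring.
by rewrite -[a](subrK (q * b)) E3 E2; ring.
Qed.

Definition coprimeO (a b : O) := exists u v : O, u * a + v * b = 1.

Lemma coprimeO_sym a b : coprimeO a b -> coprimeO b a.
Proof. by move=> [u [v H]]; exists v, u; rewrite addrC. Qed.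
Lemma coprimeOM a b c : coprimeO a b -> coprimeO a c -> coprimeO a (b * c).
Proof.
move=> [u [v H]] [u' [v' H']].
exists (u * (u' * a + v' * c) + v * b * u'), (v * v').
transitivity ((u * a + v * b) * (u' * a + v' * c)); first by ring.
by rewrite H H' mulr1.
Qed.

Lemma coprimeO_reduce (a b : O) : b != 0 -> exists g a' b' : O,
  [/\ a = g * a', b = g * b', g != 0 & coprimeO a' b'].
Proof.
move=> b0; have [g [u [v [s [t [E1 E2 E3]]]]]] := O_gcd a b.
have g0 : g != 0 by apply: contra b0 => /eqP g0; rewrite E3 g0 mul0r.
exists g, s, t; split => //; exists u, v.
by apply: (O_mulI g0); rewrite mulr1 [in RHS]E1 [in RHS]E2 [in RHS]E3; ring.
Qed.

Lemma O_dvd_sqr (g c p : O) : g ^+ 2 * p = c ^+ 2 -> exists k, c = g * k.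
Proof.
move=> H.
have [g0|g0] := eqVneq g 0.
  exists 0; move: H; rewrite g0 expr0n mul0r mul0r => /esym.
  by rewrite expr2 => /O_mulf_eq0[].
have [d [c' [g' [Ec Eg d0 [u [v Huv]]]]]] := coprimeO_reduce c g0.
have E : g' ^+ 2 * p = c' ^+ 2.
  apply: (@O_mulI (d ^+ 2)).
    by rewrite expr2; apply/eqP => /O_mulf_eq0[] /eqP; rewrite (negbTE d0).
  transitivity (g ^+ 2 * p); first by rewrite Eg; ring.
  by rewrite H Ec; ring.
(* [g'] divides [c' ^+ 2] and is coprime to it, so it is a unit *)
have [k Hk] : exists k, g' * k = 1.
  exists (u * u * g' * p + 2 * u * v * c' + v * v * g').
  transitivity ((u * c' + v * g') ^+ 2); last by rewrite Huv expr1n.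
  have -> : (u * c' + v * g') ^+ 2 = u ^+ 2 * c' ^+ 2 + g' * (2 * u * v * c' + v ^+ 2 * g') by ring.
  by rewrite -E; ring.
exists (k * c'); rewrite Ec Eg.
by transitivity (d * c' * (g' * k)); [rewrite Hk mulr1 | ring].
Qed.

Definition unitO (a : O) := exists k : O, a * k = 1.

Lemma unitO_norm a : unitO a -> `|N a| = 1.
Proof.
move=> [k /(congr1 N)]; rewrite normM cub_norm1 => /(congr1 absz).
by rewrite abszM => /eqP; rewrite muln_eq1 => /andP[/eqP] H _; rewrite -abszE H.
Qed.

Lemma coprimeO_unit a b e : unitO e -> coprimeO a b -> coprimeO a (e * b).
Proof.
move=> [k Hk] [u [v H]]; exists u, (v * k); rewrite -H.
by transitivity (u * a + v * b * (e * k)); [ring | rewrite Hk mulr1].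
Qed.

(** For g = gcd(a, c), the elements g^2 and a divide each other: Bezout for (a, m) makes a a
    multiple of g^2, Bezout for (a, c) makes g^2 a multiple of a. *)
Lemma sq_of_coprime (a m c : O) : a != 0 -> coprimeO a m -> a * m = c ^+ 2 ->
  exists e g, unitO e /\ a = e * g ^+ 2.
Proof.
move=> a0 [u [v H]] E.
have [g [p [q [s [t [E1 E2 E3]]]]]] := O_gcd a c.
have [k Hk] : exists k, a = g ^+ 2 * k.
  exists (u * s ^+ 2 + v * t ^+ 2).
  transitivity (a * (u * a + v * m)); first by rewrite H mulr1.
  have -> : a * (u * a + v * m) = u * a ^+ 2 + v * (a * m) by ring.
  by rewrite E E2 E3; ring.
have [l Hl] : exists l, g ^+ 2 = a * l.
  exists (p ^+ 2 * a + 2 * p * q * c + q ^+ 2 * m).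
  rewrite {1}E1; transitivity (p ^+ 2 * a ^+ 2 + 2 * p * q * a * c + q ^+ 2 * c ^+ 2); first by ring.
  by rewrite -E; ring.
exists k, g; split; last by rewrite mulrC.
exists l; apply: (O_mulI a0); rewrite mulr1.
by rewrite [in RHS]Hk Hl; ring.
Qed.

(** * Units of Z[w] modulo squares *)

(* [wO], [W2], [W3] are the conjugates of w *)
Definition uu (s i j : bool) : O := (-1) ^+ s * wO ^+ i * (1 + wO) ^+ j.
Definition W2 : O := (-2, 0, 1).
Definition W3 : O := (1, -1, -1).

Lemma uuM s i j s' i' j' : uu s i j * uu s' i' j' =
  uu (s (+) s') (i (+) i') (j (+) j') * (wO ^+ (i && i') * (1 + wO) ^+ (j && j')) ^+ 2.
Proof. by rewrite /uu; case: s s' i i' j j' => [] [] [] [] [] [] /=; ring. Qed.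

(** Here [v] is any element: a is a square up to one of the eight units [uu]. *)
Definition sqclass (a : O) := exists s i j v, a = uu s i j * v ^+ 2.

Lemma sqclassM a b : sqclass a -> sqclass b -> sqclass (a * b).
Proof.
move=> [s [i [j [v ->]]]] [s' [i' [j' [v' ->]]]].
exists (s (+) s'), (i (+) i'), (j (+) j'), (wO ^+ (i && i') * (1 + wO) ^+ (j && j') * v * v').
transitivity (uu s i j * uu s' i' j' * (v * v') ^+ 2); first by ring.
by rewrite uuM; ring.
Qed.

Lemma sqclass_wO : sqclass wO.
Proof. by exists false, true, false, 1. Qed.
(** From (1 + w) W2 = -1; the next one also uses w W2 W3 = 1. *)
Lemma sqclass_W2 : sqclass W2.
Proof. by exists true, false, true, W2. Qed.
Lemma sqclass_W3 : sqclass W3.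
Proof. by exists true, true, true, (W2 * W3). Qed.

Definition sm (n : nat) : seq int := [seq (i%:Z - n%:Z : int) | i : nat <- iota 0 (n + n).+1].
Lemma smP (n : nat) (x : int) : - n%:Z <= x <= n%:Z -> x \in sm n.
Proof.
move=> hx; apply/mapP; exists (absz (x + n%:Z)); last by lia.
by rewrite mem_iota; lia.
Qed.

(** In the normal basis the trace form is a sum of squares, so it bounds the coordinates; the
    remaining candidates are enumerated. *)
Lemma small_units (a : O) : trsq a <= 6 -> `|N a| = 1 -> sqclass a.
Proof.
case: a => [[a0 a1] a2] Ht Hn.
have E : trsq (a0, a1, a2) = (- a0 + a1 - 2 * a2) ^+ 2 + (- a0 - a2) ^+ 2 + (- a0 - 2 * a2) ^+ 2
    + 2 * ((a1 - a2) ^+ 2 + a2 ^+ 2 + a1 ^+ 2) by rewrite /trsq; ring.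
rewrite E in Ht.
have q1 := sqr_ge0 (- a0 + a1 - 2 * a2); have q2 := sqr_ge0 (- a0 - a2).
have q3 := sqr_ge0 (- a0 - 2 * a2); have q4 := sqr_ge0 (a1 - a2).
have q5 := sqr_ge0 a2; have q6 := sqr_ge0 a1.
have sm2 (x : int) : 2 * x ^+ 2 <= 6 -> -1 <= x <= 1 by move=> {E Ht Hn q1 q2 q3 q4 q5 q6}; nia.
have h2 : -1 <= a2 <= 1 by apply: sm2; lia.
have h1 : -1 <= a1 <= 1 by apply: sm2; lia.
have h3 : -2 <= - a0 - 2 * a2 <= 2.
  have : (- a0 - 2 * a2) ^+ 2 <= 6 by lia.
  by move: (- a0 - 2 * a2) => x {E Ht Hn q1 q2 q3 q4 q5 q6}; nia.
have h0 : -4 <= a0 <= 4 by lia.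
pose chk (t : O) := ((trsq t <= 6) && (`|N t| == 1)) ==>
  has (fun s => has (fun i => has (fun j => has (fun v => t == uu s i j * v ^+ 2)
    [:: 1; W2; W2 * W3]) [:: false; true]) [:: false; true]) [:: false; true].
have C : all (fun x => all (fun y => all (fun z => chk (x, y, z)) (sm 1)) (sm 1)) (sm 4).
  by vm_compute.
move/allP/(_ _ (smP (n := 4) h0))/allP/(_ _ (smP (n := 1) h1))/allP/(_ _ (smP (n := 1) h2)): C.
rewrite /chk E Ht Hn eqxx andbT implyTb => /hasP[s _ /hasP[i _ /hasP[j _ /hasP[v _ /eqP H]]]].
by exists s, i, j, v.
Qed.

Lemma w2_bnd : w2 <= - (7 / 16).
Proof. by have /andP[h1 h2] := rw_bnd; rewrite /w2; nra. Qed.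
Lemma w3_bnd : w3 <= - (7 / 4).
Proof. by have /andP[h1 h2] := rw_bnd; rewrite /w3; nra. Qed.

(** As rw w2 w3 = 1, these are the inverse squares of the conjugates of w: the weights that the
    trace form acquires under multiplication by the inverse of w or of a conjugate. *)
Definition r1 := (w2 * w3) ^+ 2.
Definition r2 := (w3 * rw) ^+ 2.
Definition r3 := (rw * w2) ^+ 2.
Lemma w_prod : rw * w2 * w3 = 1.
Proof. by rewrite /w2 /w3; ring: rwE. Qed.
Lemma r1_bnd : r1 <= 2 / 3.
Proof.
have H : r1 * rw ^+ 2 = 1 by rewrite /r1 -exprMn -[RHS](expr1n _ 2) -w_prod; ring.
have /andP[h1 _] := rw_bnd; have h0 : 0 <= r1 by apply: sqr_ge0.
have h2 : 3 / 2 <= rw ^+ 2 by nra.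
by move: r1 (rw ^+ 2) H h0 h2 => r x *; nra.
Qed.
Lemma r2_bnd : r2 <= 21 / 4.
Proof.
have H : r2 * w2 ^+ 2 = 1 by rewrite /r2 -exprMn -[RHS](expr1n _ 2) -w_prod; ring.
have h1 := w2_bnd; have h0 : 0 <= r2 by apply: sqr_ge0.
have h2 : 4 / 21 <= w2 ^+ 2 by nra.
by move: r2 (w2 ^+ 2) H h0 h2 => r x *; nra.
Qed.
Lemma r3_bnd : r3 <= 1 / 3.
Proof.
have H : r3 * w3 ^+ 2 = 1 by rewrite /r3 -exprMn -[RHS](expr1n _ 2) -w_prod; ring.
have h1 := w3_bnd; have h0 : 0 <= r3 by apply: sqr_ge0.
have h2 : 3 <= w3 ^+ 2 by nra.
by move: r3 (w3 ^+ 2) H h0 h2 => r x *; nra.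
Qed.

Lemma trsq_iW1 a : (trsq (a * (W2 * W3)))%:~R =
  r1 * ev1 a ^+ 2 + r2 * ev2 a ^+ 2 + r3 * ev3 a ^+ 2.
Proof.
rewrite ev_trsq !ev1M !ev2M !ev3M.
rewrite /r1 /r2 /r3 /ev1 /ev2 /ev3.
have -> : ev rw W2 = w2 by rewrite /ev /w2 /=; ring.
have -> : ev rw W3 = w3 by rewrite /ev /w3 /=; ring.
have -> : ev w2 W2 = w3 by rewrite /ev /w3 /w2 /=; ring: rwE.
have -> : ev w2 W3 = rw by rewrite /ev /w2 /=; ring: rwE.
have -> : ev w3 W2 = rw by rewrite /ev /w3 /=; ring: rwE.
have -> : ev w3 W3 = w2 by rewrite /ev /w3 /w2 /=; ring: rwE.
by ring.
Qed.
Lemma trsq_iW2 a : (trsq (a * (wO * W3)))%:~R =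
  r2 * ev1 a ^+ 2 + r3 * ev2 a ^+ 2 + r1 * ev3 a ^+ 2.
Proof.
rewrite ev_trsq !ev1M !ev2M !ev3M.
rewrite /r1 /r2 /r3 /ev1 /ev2 /ev3.
have E z : ev z wO = z by rewrite /ev /=; ring.
rewrite !E.
have -> : ev rw W3 = w3 by rewrite /ev /w3 /=; ring.
have -> : ev w2 W3 = rw by rewrite /ev /w2 /=; ring: rwE.
have -> : ev w3 W3 = w2 by rewrite /ev /w3 /w2 /=; ring: rwE.
by ring.
Qed.
Lemma trsq_iW3 a : (trsq (a * (wO * W2)))%:~R =
  r3 * ev1 a ^+ 2 + r1 * ev2 a ^+ 2 + r2 * ev3 a ^+ 2.
Proof.
rewrite ev_trsq !ev1M !ev2M !ev3M.
rewrite /r1 /r2 /r3 /ev1 /ev2 /ev3.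
have E z : ev z wO = z by rewrite /ev /=; ring.
rewrite !E.
have -> : ev rw W2 = w2 by rewrite /ev /w2 /=; ring.
have -> : ev w2 W2 = w3 by rewrite /ev /w3 /w2 /=; ring: rwE.
have -> : ev w3 W2 = rw by rewrite /ev /w3 /=; ring: rwE.
by ring.
Qed.

(** x, y, z stand for the squared conjugates of a unit that is not shortened by the inverse of w, W2
    or W3. Each of the last three inequalities forces one coordinate to be at least a fifteenth of
    the sum; if the sum were at least 7, the product would then be at least 13 (7/15)^3 > 1. *)
Lemma cone_bound (F : realFieldType) (x y z s1 s2 s3 : F) :
  0 <= x -> 0 <= y -> 0 <= z -> x * y * z = 1 ->
  s1 <= 2 / 3 -> s2 <= 21 / 4 -> s3 <= 1 / 3 ->
  x + y + z <= s1 * x + s2 * y + s3 * z ->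
  x + y + z <= s2 * x + s3 * y + s1 * z ->
  x + y + z <= s3 * x + s1 * y + s2 * z -> x + y + z < 7.
Proof.
have key (t a b c : F) : 7 / 15 <= t -> 0 <= a -> 0 <= b -> 0 <= c ->
    a + b + c = 12 * t -> (a + t) * (b + t) * (c + t) <> 1.
  move=> t0 a0 b0 c0 E.
  have -> : (a + t) * (b + t) * (c + t) =
      a * b * c + t * (a * b + b * c + a * c) + t ^+ 2 * (a + b + c) + t ^+ 3 by ring.
  have t1 : 0 <= t by lra.
  have : 0 <= a * b * c + t * (a * b + b * c + a * c).
    by rewrite !(addr_ge0, mulr_ge0).
  have t2 : (7 / 15) ^+ 3 <= t ^+ 3 by rewrite lerXn2r ?nnegrE //; lra.
  have -> : t ^+ 2 * (a + b + c) = 12 * t ^+ 3 by rewrite E; ring.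
  move: (_ + _ * _) (t ^+ 3) t2 => u v; lra.
have low (p q r u1 u2 u3 : F) : 0 <= p -> 0 <= q -> 0 <= r ->
    u1 <= 2 / 3 -> u2 <= 21 / 4 -> u3 <= 1 / 3 ->
    p + q + r <= u1 * p + u2 * q + u3 * r -> (p + q + r) / 15 <= q.
  move=> p0 q0 r0 v1 v2 v3 h.
  have := ler_wpM2r p0 v1; have := ler_wpM2r q0 v2; have := ler_wpM2r r0 v3.
  by move: (u1 * p) (u2 * q) (u3 * r) h => *; lra.
move=> x0 y0 z0 H h1 h2 h3 c1 c2 c3.
have d2 := low _ _ _ _ _ _ x0 y0 z0 h1 h2 h3 c1.
have d1 := low z x y s1 s2 s3 z0 x0 y0 h1 h2 h3.
have d3 := low y z x s1 s2 s3 y0 z0 x0 h1 h2 h3.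
have {}d1 : (x + y + z) / 15 <= x.
  by have e : z + x + y = x + y + z; [ring | move: d1; rewrite e; apply; lra].
have {}d3 : (x + y + z) / 15 <= z.
  by have e : y + z + x = x + y + z; [ring | move: d3; rewrite e; apply; lra].
rewrite ltNge; apply/negP => s7.
move: d1 d2 d3; set t := (x + y + z) / 15 => d1 d2 d3.
apply: (key t (x - t) (y - t) (z - t)); rewrite ?subr_ge0 ?subrK //.
  by rewrite /t; lra.
by rewrite /t; field.
Qed.

(** Descent on the trace form: multiply by the inverse of a conjugate of w as long as this shortens
    [a]. A unit that cannot be shortened has trace form at most 6. *)
Lemma unit_class (a : O) : `|N a| = 1 -> sqclass a.
Proof.
suff S n : forall a : O, `|N a| = 1 -> (`|trsq a| < n)%N -> sqclass a.
  by move=> Ha; apply: (S _.+1 a).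
elim: n => // n IH {}a Ha Hn.
have tp b : 0 <= trsq b.
  by rewrite -(ler_int realalg) ev_trsq !addr_ge0 ?sqr_ge0.
have step u v : sqclass u -> u * v = 1 -> `|N v| = 1 -> trsq (a * v) < trsq a -> sqclass a.
  move=> Hu Huv Hv Ht; have -> : a = u * (a * v).
    by rewrite -[LHS]mulr1 -Huv; ring.
  apply: sqclassM => //; apply: IH; first by rewrite normM normrM Ha Hv.
  by have := tp (a * v); lia.
have [|g1] := ltrP (trsq (a * (W2 * W3))) (trsq a).
  by apply: (step wO) => //; apply: sqclass_wO.
have [|g2] := ltrP (trsq (a * (wO * W3))) (trsq a).
  by apply: (step W2) => //; apply: sqclass_W2.
have [|g3] := ltrP (trsq (a * (wO * W2))) (trsq a).
  by apply: (step W3) => //; apply: sqclass_W3.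
apply: small_units => //.
suff : trsq a < 7 by lia.
rewrite -(ltr_int realalg) ev_trsq.
move: g1 g2 g3; rewrite -!(ler_int realalg) trsq_iW1 trsq_iW2 trsq_iW3 ev_trsq => g1 g2 g3.
apply: (cone_bound (sqr_ge0 _) (sqr_ge0 _) (sqr_ge0 _) _ r1_bnd r2_bnd r3_bnd g1 g2 g3).
rewrite -!exprMn -ev_norm -rmorphXn /=.
have -> : N a ^+ 2 = 1 by nia.
by [].
Qed.

(** * Descent on Y^2 = X (X - eps) (X - mu) *)

(* 2 is inert in Z[w], so it divides a as soon as it divides N a *)
Definition evenO (a : O) := (2 %| N a)%Z.

Lemma evenOM a b : evenO (a * b) = evenO a || evenO b.
Proof. by rewrite /evenO normM !dvdzE abszM Euclid_dvdM. Qed.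

Lemma evenOP a : reflect (exists c, a = 2 * c) (evenO a).
Proof.
apply: (iffP idP) => [/norm_even|[c ->]]; last by rewrite evenOM.
case: a => [[a0 a1] a2] /= /and3P[/dvdzP[c0 ->] /dvdzP[c1 ->] /dvdzP[c2 ->]].
by exists (c0, c1, c2); congr (_, _, _); rewrite /=; ring.
Qed.

Lemma evenO_neq0 a : ~~ evenO a -> a != 0.
Proof. by apply: contra => /eqP ->. Qed.

Definition red (n : int) (a : O) : O := let: (a0, a1, a2) := a in
  ((a0 %% n)%Z, (a1 %% n)%Z, (a2 %% n)%Z).

Lemma redP n a : exists c, a = red n a + ofZ n * c.
Proof.
case: a => [[a0 a1] a2]; exists ((a0 %/ n)%Z, (a1 %/ n)%Z, (a2 %/ n)%Z).
rewrite {1}(divz_eq a0 n) {1}(divz_eq a1 n) {1}(divz_eq a2 n).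
by rewrite /ofZ; congr (_, _, _); rewrite /=; ring.
Qed.

Lemma red_mod n a c : red n (a + ofZ n * c) = red n a.
Proof.
have e (x y : int) : ((x + n * y) %% n)%Z = (x %% n)%Z by rewrite addrC mulrC modzMDl.
case: a c => [[a0 a1] a2] [[c0 c1] c2]; rewrite [RHS]/red -(e a0 c0) -(e a1 c1) -(e a2 c2) /ofZ.
by congr (_, _, _); congr modz; rewrite /=; ring.
Qed.

Lemma red_eqP n a b : red n a = red n b <-> exists c, a = b + ofZ n * c.
Proof.
split=> [H|[c ->]]; last by rewrite red_mod.
have [c Ec] := redP n a; have [d Ed] := redP n b.
by exists (c - d); rewrite Ec H [b in RHS]Ed; ring.
Qed.

Lemma red_mul n a b : red n (red n a * b) = red n (a * b).
Proof. by apply/red_eqP; have [c {2}->] := redP n a; exists (- c * b); ring. Qed.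
Lemma red_sub n a b : red n (red n a - b) = red n (a - b).
Proof. by apply/red_eqP; have [c {2}->] := redP n a; exists (- c); ring. Qed.

Definition res (n : nat) : seq O :=
  [seq ((x.1%:Z, x.2%:Z), y%:Z) : O | x <- [seq (i, j) | i <- iota 0 n, j <- iota 0 n], y <- iota 0 n].

Lemma red_res (n : nat) a : (0 < n)%N -> red n a \in res n.
Proof.
move=> n0; case: a => [[a0 a1] a2] /=.
have e (x : int) : exists2 i : nat, i \in iota 0 n & (x %% n)%Z = i.
  exists (absz (x %% n)%Z).
    by have := ltz_pmod x (_ : 0 < n%:Z); rewrite mem_iota add0n => /(_ n0); have := modz_ge0 x (_ : n%:Z != 0); lia.
  by rewrite gez0_abs // modz_ge0 //; lia.
have [i Hi ->] := e a0; have [j Hj ->] := e a1; have [k Hk ->] := e a2.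
by apply/allpairsP; exists ((i, j), k); split => //; apply/allpairsP; exists (i, j).
Qed.

Definition sqs (n : nat) : seq O := undup [seq red n (z * z) | z <- res n & ~~ evenO z].

Lemma evenO_red (n : nat) a : (2 %| n)%N -> evenO (red n a) = evenO a.
Proof.
move=> /dvdnP[m Em]; have [c Ec] := redP n a.
have E : ofZ n * c = 2 * (ofZ m * c).
  by case: (c) => [[c0 c1] c2]; rewrite Em PoszM /ofZ; congr (_, _, _); rewrite /=; ring.
apply/evenOP/evenOP => -[d Hd].
  by exists (d + ofZ m * c); rewrite Ec E Hd; ring.
by exists (d - ofZ m * c); rewrite mulrBr -Hd -E {2}Ec; ring.
Qed.

Lemma red_sqs (n : nat) z : (0 < n)%N -> (2 %| n)%N -> ~~ evenO z -> red n (z ^+ 2) \in sqs n.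
Proof.
move=> n0 n2 Hz; rewrite mem_undup; apply/mapP; exists (red n z).
  by rewrite mem_filter evenO_red // Hz red_res.
by rewrite red_mul mulrC red_mul expr2.
Qed.

(** The cubic kap (z - 1) (z - n0) (z - n1) of [classify], shifted by 1 and rescaled, has the roots
    0, [eps], [mu]. Since [eps], [mu] and [mu - eps] are units, the four factors of [prodO] are
    pairwise coprime. *)
Definition eps : O := (4, -5, -4).
Definition mu : O := (-5, -9, 5).

Definition allb (P : bool -> bool -> bool -> bool) :=
  all (fun s => all (fun i => all (fun j => P s i j) [:: false; true]) [:: false; true]) [:: false; true].
Lemma allbP P s i j : allb P -> P s i j.
Proof. by rewrite /allb /=; case: s i j => [] [] [] /and3P[] /and3P[] /and3P[]; rewrite ?andbT => *;
  repeat match goal with H : is_true (_ && _) |- _ => case/andP: H => * end. Qed.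

Definition sq8 := Eval vm_compute in sqs 8.
Definition sq4 := Eval vm_compute in sqs 4.

(** Modulo 8, with b scaled to an odd square and divided out: a is the first unit times an odd
    square, and a - eps b has the class of the second unit. The condition at 2 forces the second
    unit to have sign -1, against [sign_eps]. *)
Definition chkE := allb (fun s1 i1 j1 => allb (fun s2 i2 j2 => all (fun t =>
  (red 8 (uu s1 i1 j1 * t - eps) \in [seq red 8 (uu s2 i2 j2 * t') | t' <- sq8]) &&
  (red 8 (uu s1 i1 j1 * t - mu) \in
     [seq red 8 (uu (s1 (+) s2) (i1 (+) i2) (j1 (+) j2) * t') | t' <- sq8]) ==> s2) sq8)).
Lemma chkE_true : chkE. Proof. by vm_compute. Qed.

(** The eight units stay distinct modulo 4 and odd squares. *)
Definition chkT := allb (fun s1 i1 j1 => allb (fun s2 i2 j2 => all (fun t =>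
  (red 4 (uu s1 i1 j1 * t) \in [seq red 4 (uu s2 i2 j2 * t') | t' <- sq4]) ==>
     [&& s1 == s2, i1 == i2 & j1 == j2]) sq4)).
Lemma chkT_true : chkT. Proof. by vm_compute. Qed.

Lemma ev_neq0 a : a != 0 -> [/\ ev1 a != 0, ev2 a != 0 & ev3 a != 0].
Proof.
move/normN0; rewrite -(intr_eq0 realalg) ev_norm !mulf_eq0 !negb_or.
by case/andP => /andP[].
Qed.

Lemma ev_uu (z : realalg) (hz : z ^+ 3 = 1 + 2 * z - z ^+ 2) s i j :
  ev z (uu s i j) = (-1) ^+ s * z ^+ i * (1 + z) ^+ j.
Proof.
have e1 : ev z 1 = 1 by rewrite /ev /=; ring.
have en : ev z (-1) = -1 by rewrite /ev /=; ring.
have ew : ev z wO = z by rewrite /ev /=; ring.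
rewrite /uu !(evM hz); congr (_ * _ * _).
- by case: s; rewrite ?expr0 ?expr1.
- by case: i; rewrite ?expr0 ?expr1.
- by case: j; rewrite ?expr0 ?expr1 // evD e1 ew.
Qed.

Lemma ev_sq (z : realalg) (hz : z ^+ 3 = 1 + 2 * z - z ^+ 2) a : ev z (a ^+ 2) = ev z a ^+ 2.
Proof. by rewrite !expr2 (evM hz). Qed.

Lemma uu_pos1 s i j : (0 < ev1 (uu s i j)) = ~~ s.
Proof.
rewrite /ev1 (ev_uu rwE); have /andP[h _] := rw_bnd.
have p : 0 < rw ^+ i * (1 + rw) ^+ j by rewrite mulr_gt0 ?exprn_gt0 //; lra.
by rewrite -mulrA; case: s; rewrite ?expr0 ?expr1 ?mul1r // mulN1r oppr_gt0 ltNge ltW.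
Qed.

(** The sign vectors of -1, w and 1 + w at the three real places are independent. *)
Lemma uu_sq_trivial s i j m c : uu s i j * m ^+ 2 = c ^+ 2 -> m != 0 ->
  [/\ s = false, i = false & j = false].
Proof.
move=> E m0; have [n1 n2 n3] := ev_neq0 m0.
have sg (z : realalg) (hz : z ^+ 3 = 1 + 2 * z - z ^+ 2) : ev z m != 0 -> 0 <= ev z (uu s i j).
  move=> mz; have : 0 < ev z m ^+ 2 by rewrite lt_neqAle sqr_ge0 eq_sym sqrf_eq0 mz.
  move=> p; rewrite -(pmulr_lge0 _ p) -(ev_sq hz) -(evM hz) E (ev_sq hz) sqr_ge0 //.
have := sg _ rwE n1; have := sg _ w2E n2; have := sg _ w3E n3.
rewrite !ev_uu ?rwE ?w2E ?w3E //.
have /andP[h1 h1'] := rw_bnd; have h2 := w2_bnd; have h3 := w3_bnd.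
have h2' : - (7 / 10) <= w2 by rewrite /w2; nra.
by case: s i j {E sg} => [] [] []; rewrite ?expr0 ?expr1 => *; split=> //; exfalso; nra.
Qed.

(** b^4 times the cubic X (X - eps) (X - mu) at X = a / b. *)
Definition prodO (a b : O) := a * b * (a - eps * b) * (a - mu * b).

Lemma unit_eps : unitO eps. Proof. by exists (-6, -9, 11). Qed.
Lemma unit_mu : unitO mu. Proof. by exists (-227, 56, 101). Qed.
Lemma unit_me : unitO (mu - eps). Proof. by exists (23, 65, 29). Qed.

Lemma coprimeO_addr a b k : coprimeO a b -> coprimeO a (b + k * a).
Proof. by move=> [u [v H]]; exists (u - v * k), v; rewrite -H; ring. Qed.
Lemma coprimeO_opp a b : coprimeO a b -> coprimeO a (- b).
Proof. by move=> [u [v H]]; exists u, (- v); rewrite -H; ring. Qed.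

Lemma coprime_lin a b (m : O) : coprimeO a b -> unitO m ->
  coprimeO a (a - m * b) /\ coprimeO b (a - m * b).
Proof.
move=> H um; split.
  have := coprimeO_addr 1 (coprimeO_opp (coprimeO_unit um H)).
  by congr coprimeO; ring.
by have := coprimeO_addr (- m) (coprimeO_sym H); congr coprimeO; ring.
Qed.

Lemma coprime_eps_mu a b : coprimeO a b -> coprimeO (a - eps * b) (a - mu * b).
Proof.
move=> H; have [_ H1] := coprime_lin H unit_eps.
have := coprimeO_addr 1 (coprimeO_opp (coprimeO_unit unit_me (coprimeO_sym H1))).
by congr coprimeO; ring.
Qed.

Lemma classes a b c : coprimeO a b -> prodO a b = c ^+ 2 -> c != 0 ->
  [/\ sqclass a, sqclass b, sqclass (a - eps * b) & sqclass (a - mu * b)].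
Proof.
move=> H E c0.
have nz x y : x * y = c ^+ 2 -> x != 0.
  move=> Exy; apply: contra c0 => /eqP x0; move: Exy; rewrite x0 mul0r => /esym.
  by rewrite expr2 => /O_mulf_eq0[] /eqP.
have [h1 h2] := coprime_lin H unit_eps; have [h3 h4] := coprime_lin H unit_mu.
have h5 := coprime_eps_mu H.
have S x m : coprimeO x m -> x * m = c ^+ 2 -> sqclass x.
  move=> Hx Ex; have [e [g [ue ->]]] := sq_of_coprime (nz _ _ Ex) Hx Ex.
  apply: sqclassM; first by apply: unit_class; apply: unitO_norm.
  by exists false, false, false, g; rewrite /uu !expr0 !mul1r.
split.
- apply: (S _ (b * (a - eps * b) * (a - mu * b))); last by rewrite -E /prodO; ring.
  by apply: coprimeOM; [apply: coprimeOM|].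
- apply: (S _ (a * (a - eps * b) * (a - mu * b))); last by rewrite -E /prodO; ring.
  by apply: coprimeOM; [apply: coprimeOM|]; first [assumption | by apply: coprimeO_sym].
- apply: (S _ (a * b * (a - mu * b))); last by rewrite -E /prodO; ring.
  by apply: coprimeOM; [apply: coprimeOM|]; first [assumption | by apply: coprimeO_sym].
- apply: (S _ (a * b * (a - eps * b))); last by rewrite -E /prodO; ring.
  by apply: coprimeOM; [apply: coprimeOM|]; first [assumption | by apply: coprimeO_sym].
Qed.

(** At this real place eps < mu < 0, so a positive value of the cubic forces X > eps. *)
Lemma sign_eps a b c : prodO a b = c ^+ 2 -> c != 0 -> 0 < ev1 ((a - eps * b) * b).
Proof.
move=> E c0.
have e1 : ev1 eps < 0 by have /andP[*] := rw_bnd; rewrite /ev1 /ev /=; nra.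
have e2 : ev1 mu < 0 by have /andP[*] := rw_bnd; rewrite /ev1 /ev /=; nra.
have e3 : 0 < ev1 mu - ev1 eps.
  (* [mu - eps] is about 0.007 here, too small for the enclosure of [rw]; writing it as w (1 + w)
     times a square gives its sign. *)
  have e : (mu - eps : O) = uu false true true * ((-4, 2, 1) : O) ^+ 2 by apply/eqP; vm_compute.
  have : 0 < ev1 (mu - eps).
    rewrite e ev1M /ev1 (ev_sq rwE) mulr_gt0 //; first by rewrite -/ev1 uu_pos1.
    rewrite lt_neqAle sqr_ge0 eq_sym sqrf_eq0 andbT.
    by have [] := @ev_neq0 (-4, 2, 1) isT.
  by rewrite /ev1 evD; congr (0 < _ + _); rewrite /ev /=; ring.
have evB m : ev1 (a - m * b) = ev1 a - ev1 m * ev1 b.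
  rewrite /ev1 evD -mulNr (evM rwE); congr (_ + _); rewrite -mulNr; congr (_ * _).
  by case: m => [[m0 m1] m2]; rewrite /ev /=; ring.
have [c1 _ _] := ev_neq0 c0.
have : 0 < ev1 (prodO a b) by rewrite E /ev1 (ev_sq rwE) lt_neqAle sqr_ge0 eq_sym sqrf_eq0 c1.
rewrite /prodO !ev1M !evB.
move: (ev1 a) (ev1 b) (ev1 eps) (ev1 mu) e1 e2 e3 => x y e m e1 e2 e3.
have [/eqP y0|y0] := boolP (y == 0); first by rewrite y0 !(mulr0, mul0r).
pose t := x / y; have -> : x = t * y by rewrite /t mulfVK.
move=> {c E c0 evB c1}.
have -> : t * y * y * (t * y - e * y) * (t * y - m * y) = (t * (t - e) * (t - m)) * (y ^+ 2) ^+ 2 by ring.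
have -> : (t * y - e * y) * y = (t - e) * y ^+ 2 by ring.
have y2 : 0 < y ^+ 2 by rewrite lt_neqAle sqr_ge0 eq_sym sqrf_eq0 y0.
rewrite (pmulr_lgt0 _ (exprn_gt0 2 y2)) (pmulr_lgt0 _ y2) => h.
rewrite ltNge; apply/negP => h'.
have h1 : t - m <= 0 by lra.
have h2 : t <= 0 by lra.
have : 0 <= (t - e) * (t - m) by rewrite mulr_le0.
by move=> h3; have := mulr_le0_ge0 h2 h3; rewrite mulrA; lra.
Qed.

(** The square of an odd integer is 1 modulo 8, so N b times the adjoint of b inverts b modulo 8. *)
Lemma inv8 (b : O) : ~~ evenO b -> exists b' k, b * b' = 1 + ofZ 8 * k /\ ~~ evenO b'.
Proof.
move=> Hb; have Hn : ~~ (2 %| N b)%Z by [].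
have [m Em] : exists m, N b ^+ 2 = 1 + 8 * m.
  have [q Eq] : exists q : int, N b = 2 * q + 1.
    exists (N b %/ 2)%Z; have := divz_eq (N b) 2.
    have {}Hn : (N b %% 2)%Z <> 0 by move/dvdz_mod0P; apply/negP.
    move: Hn.
    have := ltz_pmod (N b) (isT : (0 : int) < 2); have := modz_ge0 (N b) (isT : (2 : int) != 0).
    by move: (N b) (_ %% _)%Z (_ %/ _)%Z => *; lia.
  have [p Ep] : exists p : int, q * (q + 1) = 2 * p.
    exists (q * (q + 1) %/ 2)%Z; rewrite [2 * _]mulrC divzK //.
    have := divz_eq q 2; have := ltz_pmod q (isT : (0 : int) < 2); have := modz_ge0 q (isT : (2 : int) != 0).
    move: (q %% 2)%Z (q %/ 2)%Z => r t h1 h2 E.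
    have [r0|r1] : r = 0 \/ r = 1 by lia.
      by apply/dvdzP; exists (t * (q + 1)); rewrite E r0; ring.
    by apply/dvdzP; exists (q * (t + 1)); rewrite E r1; ring.
  by exists p; rewrite Eq; transitivity (4 * (q * (q + 1)) + 1); [ring | rewrite Ep; ring].
have E : b * (cub_adj b * ofZ (N b)) = 1 + ofZ 8 * ofZ m.
  rewrite mulrA cub_adjP; transitivity (ofZ (N b ^+ 2)).
    by rewrite /ofZ /cubC; congr (_, _, _); rewrite /=; ring.
  by rewrite Em /ofZ; congr (_, _, _); rewrite /=; ring.
exists (cub_adj b * ofZ (N b)), (ofZ m); split=> //.
apply/negP => /evenOP[k Hk]; move: E; rewrite Hk => E.
have : evenO (1 : O).
  apply/evenOP; exists (b * k - ofZ 4 * ofZ m).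
  transitivity (b * (2 * k) - ofZ 8 * ofZ m); first by rewrite E; ring.
  have -> : (ofZ 8 : O) = 2 * ofZ 4 by [].
  by ring.
by [].
Qed.

Lemma oddO_scale u i j s v x : ~~ evenO x -> x = uu s i j * v ^+ 2 * u -> ~~ evenO v.
Proof.
move=> Hx E; apply: contra Hx => /evenOP[k Ek]; apply/evenOP.
by exists (uu s i j * 2 * k ^+ 2 * u); rewrite E Ek; ring.
Qed.

(** If all four factors were odd, their classes modulo 8 ([chkE]) would make (a - eps b) b negative
    at the first real place, against [sign_eps]. *)
Lemma all_odd_absurd a b c : coprimeO a b -> prodO a b = c ^+ 2 ->
  [|| evenO a, evenO b, evenO (a - eps * b) | evenO (a - mu * b)].
Proof.
move=> H E; apply/negPn; rewrite !negb_or; apply/negP => /and4P[oa ob oc od].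
have c0 : c != 0.
  suff : ~~ evenO (c ^+ 2) by apply: contra => /eqP ->.
  by rewrite -E /prodO !evenOM !negb_or oa ob oc od.
have [[s1 [i1 [j1 [A EA]]]] [s2 [i2 [j2 [B EB]]]] [s3 [i3 [j3 [C EC]]]] [s4 [i4 [j4 [D ED]]]]] :=
  classes H E c0.
have sg := sign_eps E c0.
(* multiplying [a] and [b] by the unit of [b] reduces to the case where [b] is a square *)
have oA := oddO_scale oa (etrans EA (esym (mulr1 _))).
have oB := oddO_scale ob (etrans EB (esym (mulr1 _))).
have oC := oddO_scale oc (etrans EC (esym (mulr1 _))).
have oD := oddO_scale od (etrans ED (esym (mulr1 _))).
have oW : ~~ evenO wO by [].
have oW1 : ~~ evenO (1 + wO) by [].
have oX n x : ~~ evenO x -> ~~ evenO (x ^+ n).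
  by move=> ox; elim: n => [//|n IH]; rewrite exprS evenOM negb_or ox.
set u2 := uu s2 i2 j2 in EB.
have T s i j : uu s i j * u2 = uu (s (+) s2) (i (+) i2) (j (+) j2) *
    (wO ^+ (i && i2) * (1 + wO) ^+ (j && j2)) ^+ 2 by apply: uuM.
have T22 : u2 * u2 = (wO ^+ i2 * (1 + wO) ^+ j2) ^+ 2.
  by rewrite T !addbb !andbb /uu !expr0 !mul1r.
have odd_sq i j : ~~ evenO (wO ^+ i * (1 + wO) ^+ j) by rewrite evenOM negb_or !oX.
set Bq := wO ^+ i2 * (1 + wO) ^+ j2 * B.
have EBq : u2 * b = Bq ^+ 2 by rewrite EB mulrA T22 /Bq; ring.
have oBq : ~~ evenO Bq by rewrite evenOM negb_or odd_sq.
clearbody Bq.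
have sc x s i j X : x = uu s i j * X ^+ 2 -> ~~ evenO X -> exists2 X',
    u2 * x = uu (s (+) s2) (i (+) i2) (j (+) j2) * X' ^+ 2 & ~~ evenO X'.
  move=> -> oX'; exists (wO ^+ (i && i2) * (1 + wO) ^+ (j && j2) * X).
    by rewrite mulrA [u2 * _]mulrC T; ring.
  by rewrite evenOM negb_or odd_sq.
have [A' EA' oA'] := sc _ _ _ _ _ EA oA.
have [C' EC' oC'] := sc _ _ _ _ _ EC oC.
have [D' ED' oD'] := sc _ _ _ _ _ ED oD.
move: EA' EC' ED'.
set sa := s1 (+) s2; set ia := i1 (+) i2; set ja := j1 (+) j2.
set sc' := s3 (+) s2; set ic := i3 (+) i2; set jc := j3 (+) j2.
set sd := s4 (+) s2; set id := i4 (+) i2; set jd := j4 (+) j2 => EA' EC' ED'.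
(* The four factors multiply to a square, so the class of the last is determined by the others. *)
have [Es [Ei Ej]] : sd = sa (+) sc' /\ id = ia (+) ic /\ jd = ja (+) jc.
  have F : uu sa ia ja * uu sc' ic jc * uu sd id jd * (A' * Bq * C' * D') ^+ 2 =
      (u2 ^+ 2 * c) ^+ 2.
    transitivity ((uu sa ia ja * A' ^+ 2) * Bq ^+ 2 * (uu sc' ic jc * C' ^+ 2) * (uu sd id jd * D' ^+ 2)).
      by ring.
    rewrite -EA' -EBq -EC' -ED'; transitivity (u2 ^+ 4 * prodO a b); first by rewrite /prodO; ring.
    by rewrite E; ring.
  rewrite uuM in F.
  have G : uu (sa (+) sc') (ia (+) ic) (ja (+) jc) * uu sd id jd *
     (wO ^+ (ia && ic) * (1 + wO) ^+ (ja && jc) * (A' * Bq * C' * D')) ^+ 2 = (u2 ^+ 2 * c) ^+ 2.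
    by rewrite -F; ring.
  rewrite uuM -mulrA -exprMn in G.
  have [] := uu_sq_trivial G.
    by apply: evenO_neq0; rewrite !(evenOM, negb_or) ?oX //= oA' oBq oC' oD'.
  by case: sa sc' sd ia ic id ja jc jd {EA' EC' ED' F G} => [] [] [] [] [] [] [] [] [].
have ns : sc' = false.
  have : 0 < ev1 (uu sc' ic jc * (C' * Bq) ^+ 2).
    have -> : uu sc' ic jc * (C' * Bq) ^+ 2 = (a - eps * b) * b * u2 ^+ 2.
      transitivity ((uu sc' ic jc * C' ^+ 2) * Bq ^+ 2); first by ring.
      by rewrite -EC' -EBq; ring.
    rewrite ev1M /ev1 (ev_sq rwE) -/ev1 mulr_gt0 // lt_neqAle sqr_ge0 eq_sym sqrf_eq0 andbT.
    have [] // := @ev_neq0 u2; apply: evenO_neq0.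
    by rewrite /u2 /uu evenOM negb_or oX // andbT evenOM negb_or oX // andbT; case: (s2).
  rewrite ev1M /ev1 (ev_sq rwE) pmulr_lgt0; first by rewrite -/ev1 uu_pos1 => /negbTE.
  rewrite lt_neqAle sqr_ge0 eq_sym sqrf_eq0 andbT.
  by have [] // := @ev_neq0 (C' * Bq); apply: evenO_neq0; rewrite evenOM negb_or oC'.
have [B' [k [EBB oB']]] := inv8 oBq.
pose t := red 8 ((A' * B') ^+ 2).
have t8 : t \in sq8.
  have -> : sq8 = sqs 8 by vm_compute.
  by apply: red_sqs => //; rewrite evenOM negb_or oA'.
have fin (m : O) s i j (X : O) : u2 * (a - m * b) = uu s i j * X ^+ 2 -> ~~ evenO X ->
    red 8 (uu sa ia ja * t - m) \in [seq red 8 (uu s i j * t') | t' <- sq8].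
  move=> EX oX'; apply/mapP; exists (red 8 ((X * B') ^+ 2)).
    have -> : sq8 = sqs 8 by vm_compute.
    by apply: red_sqs => //; rewrite evenOM negb_or oX'.
  rewrite [uu s i j * _]mulrC red_mul /t -red_sub [uu sa _ _ * _]mulrC red_mul red_sub.
  apply/red_eqP; exists (m * (2 * k + ofZ 8 * k ^+ 2)).
  have E1 : (X * B') ^+ 2 * uu s i j = (uu s i j * X ^+ 2) * B' ^+ 2 by ring.
  have E2 : (A' * B') ^+ 2 * uu sa ia ja = (uu sa ia ja * A' ^+ 2) * B' ^+ 2 by ring.
  rewrite E1 -EX E2 -EA'.
  have -> : u2 * (a - m * b) * B' ^+ 2 = u2 * a * B' ^+ 2 - m * ((Bq * B') ^+ 2).
    by rewrite exprMn -EBq; ring.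
  by rewrite EBB; ring.
have := chkE_true => /allbP => /(_ sa ia ja) /allbP => /(_ sc' ic jc) /allP /(_ t t8).
by rewrite (fin eps _ _ _ _ EC' oC') -Es -Ei -Ej (fin mu _ _ _ _ ED' oD') ns.
Qed.

Lemma coprime_odd a b : coprimeO a b -> evenO b -> ~~ evenO a.
Proof.
move=> [u [v H]] /evenOP[b1 Eb]; apply/negP => /evenOP[a1 Ea].
have : evenO (1 : O) by apply/evenOP; exists (u * a1 + v * b1); rewrite -[LHS]H Ea Eb; ring.
by [].
Qed.

Lemma uu_odd s i j : ~~ evenO (uu s i j).
Proof. by case: s i j => [] [] []. Qed.

(** An even b is a unit times an even square, hence divisible by 4. So a, a - eps b and a - mu b
    agree modulo 4 and have the same class by [chkT]; the product gives that of b. Thus X, X - eps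
    and X - mu are squares, and the point is divisible by 2. *)
Lemma even_classes a b c : coprimeO a b -> prodO a b = c ^+ 2 -> c != 0 -> evenO b ->
  exists u A B C D, [/\ ~~ evenO u, a = u * A ^+ 2, b = u * B ^+ 2,
    a - eps * b = u * C ^+ 2 & a - mu * b = u * D ^+ 2].
Proof.
move=> H E c0 eb; have oa := coprime_odd H eb.
have [[s1 [i1 [j1 [A EA]]]] [s2 [i2 [j2 [B EB]]]] [s3 [i3 [j3 [C EC]]]] [s4 [i4 [j4 [D ED]]]]] :=
  classes H E c0.
have oM m : evenO (m * b) by rewrite evenOM eb orbT.
have oS m : ~~ evenO (a - m * b).
  apply: contra oa => /evenOP[k Hk]; have /evenOP[l Hl] := oM m; apply/evenOP.
  by exists (k + l); rewrite mulrDr -Hk -Hl; ring.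
have sq_odd (x : O) s i j (X : O) : x = uu s i j * X ^+ 2 -> evenO X = evenO x.
  by move=> ->; rewrite evenOM (negbTE (uu_odd _ _ _)) expr2 evenOM orbb.
have oA : ~~ evenO A by rewrite (sq_odd _ _ _ _ _ EA).
have [B1 EB1] : exists B1, B = 2 * B1 by apply/evenOP; rewrite (sq_odd _ _ _ _ _ EB).
have key (m : O) s i j (X : O) : a - m * b = uu s i j * X ^+ 2 -> [/\ s1 = s, i1 = i & j1 = j].
  move=> EX; have oX : ~~ evenO X by rewrite (sq_odd _ _ _ _ _ EX) oS.
  have M4 x : ~~ evenO x -> red 4 (x ^+ 2) \in sq4.
    by have -> : sq4 = sqs 4 by []; apply: red_sqs.
  have := chkT_true => /allbP => /(_ s1 i1 j1) /allbP => /(_ s i j) /allP /(_ _ (M4 _ oA)).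
  have -> : red 4 (uu s1 i1 j1 * red 4 (A ^+ 2)) \in [seq red 4 (uu s i j * t') | t' <- sq4].
    apply/mapP; exists (red 4 (X ^+ 2)); first exact: M4.
    rewrite mulrC red_mul [RHS]/= [_ * red _ _]mulrC red_mul; apply/red_eqP.
    exists (m * uu s2 i2 j2 * B1 ^+ 2).
    rewrite [A ^+ 2 * _]mulrC -EA [X ^+ 2 * _]mulrC -EX EB EB1.
    by have -> : (ofZ 4 : O) = 4 by []; ring.
  by rewrite implyTb => /and3P[/eqP-> /eqP-> /eqP->].
have [Es Ei Ej] := key _ _ _ _ _ EC; have [Es' Ei' Ej'] := key _ _ _ _ _ ED.
subst s3 i3 j3 s4 i4 j4.
have [Es Ei Ej] : [/\ s2 = s1, i2 = i1 & j2 = j1].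
  have F : uu s1 i1 j1 * uu s2 i2 j2 * (uu s1 i1 j1 * A * B * C * D) ^+ 2 = c ^+ 2.
    rewrite -E /prodO ED EC {1}EA {1}EB; ring.
  rewrite uuM -mulrA -exprMn in F.
  have [] := uu_sq_trivial F.
    apply: contra c0 => /eqP z; move: F; rewrite z expr0n mulr0 => /esym.
    by rewrite expr2 => /O_mulf_eq0[] ->.
  by case: s1 s2 {EA EB EC ED key F} => [] []; case: i1 i2 => [] []; case: j1 j2 => [] [].
subst s2 i2 j2.
by exists (uu s1 i1 j1), A, B, C, D; split=> //; apply: uu_odd.
Qed.

(** c1 and c2 are (A + C) / 2 and (A - C) / 2, in the order that makes c1 odd; divisibility by 2
    holds because 2 is prime. *)
Lemma halve (A C B m : O) : ~~ evenO A -> A ^+ 2 - m * (2 * B) ^+ 2 = C ^+ 2 ->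
  exists c1 c2, [/\ c1 + c2 = A, c1 * c2 = m * B ^+ 2 & ~~ evenO c1].
Proof.
move=> oA E.
have E' : (A + C) * (A - C) = 2 * (2 * m * B ^+ 2).
  by transitivity (A ^+ 2 - C ^+ 2); [ring | rewrite -E; ring].
have [c Ec] : exists c, A + C = 2 * c.
  apply/evenOP; have : evenO ((A + C) * (A - C)) by rewrite E' evenOM.
  rewrite evenOM => /orP[//|/evenOP[k Ek]]; apply/evenOP.
  by exists (k + C); rewrite mulrDr -Ek; ring.
have Ed : A - C = 2 * (A - c) by rewrite mulrBr -Ec; ring.
have two : (2 : O) != 0 by [].
have Em : c * (A - c) = m * B ^+ 2.
  by apply: (@O_mulI (2 * 2)) => //; transitivity ((2 * c) * (2 * (A - c))); [ring | rewrite -Ec -Ed E'; ring].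
have [ec|oc] := boolP (evenO c); last by exists c, (A - c); split=> //; ring.
exists (A - c), c; split; [by ring | by rewrite mulrC | ].
apply: contra oA => /evenOP[k Ek]; have /evenOP[l El] := ec; apply/evenOP.
by exists (k + l); rewrite mulrDr -Ek -El; ring.
Qed.

(* halving a point makes |N b| drop: the descent *)
Lemma no_even n : forall a b c, (`|N b| < n)%N -> coprimeO a b -> b != 0 -> evenO b ->
  prodO a b = c ^+ 2 -> False.
Proof.
elim: n => // n IH a b c Hn H b0 eb E.
have oa := coprime_odd H eb.
have c0 : c != 0.
  apply/eqP => c0; move: E; rewrite c0 expr0n /prodO.
  have odd0 x : ~~ evenO x -> x = 0 -> False by move=> o z; rewrite z in o.
  have oS m : ~~ evenO (a - m * b).
    apply: contra oa => /evenOP[k Hk]; have /evenOP[l Hl] := eb; apply/evenOP.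
    by exists (k + m * l); rewrite mulrDr -Hk mulrCA -Hl; ring.
  move/O_mulf_eq0 => [/O_mulf_eq0[/O_mulf_eq0[]|]|]; first exact: odd0.
  - by move/eqP; rewrite (negbTE b0).
  - exact: odd0.
  - exact: odd0.
have [u [A [B [C [D [ou EA EB EC ED]]]]]] := even_classes H E c0 eb.
have u0 := evenO_neq0 ou.
have oA : ~~ evenO A by apply: contra oa => eA; rewrite EA !(evenOM, expr2) eA !orbT.
have [B1 EB1] : exists B1, B = 2 * B1.
  by apply/evenOP; move: eb; rewrite EB !(evenOM, expr2) (negbTE ou) orbb.
have HC : A ^+ 2 - eps * (2 * B1) ^+ 2 = C ^+ 2.
  by apply: (O_mulI u0); rewrite -EC [in RHS]EA [in RHS]EB EB1; ring.
have HD : A ^+ 2 - mu * (2 * B1) ^+ 2 = D ^+ 2.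
  by apply: (O_mulI u0); rewrite -ED [in RHS]EA [in RHS]EB EB1; ring.
have [c1 [c2 [Ec1 Ec2 oc1]]] := halve oA HC.
have [d1 [d2 [Ed1 Ed2 od1]]] := halve oA HD.
(* c1 d1 / B1^2 is the abscissa of a half of the point; by [P1] and [P2] its differences with eps
   and mu are c1 e1 / B1^2 and d1 e1 / B1^2. *)
pose e1 := c1 + d1 - A.
have P1 : c1 * d1 - eps * B1 ^+ 2 = c1 * e1 by rewrite -Ec2 /e1 -Ec1; ring.
have P2 : c1 * d1 - mu * B1 ^+ 2 = d1 * e1 by rewrite -Ed2 /e1 -Ed1; ring.
have P3 : e1 * (c1 - d1) = (mu - eps) * B1 ^+ 2.
  transitivity (mu * B1 ^+ 2 - eps * B1 ^+ 2); last by ring.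
  rewrite -Ec2 -Ed2 /e1; have -> : d2 = A - d1 by rewrite -Ed1; ring.
  have -> : c2 = A - c1 by rewrite -Ec1; ring.
  by ring.
have B0 : B1 != 0.
  by apply: contra b0 => /eqP z; rewrite EB EB1 z; apply/eqP; ring.
have B2 : B1 ^+ 2 != 0.
  by rewrite expr2; apply/eqP => /O_mulf_eq0[] /eqP; rewrite (negbTE B0).
have [g [a' [b' [Ea' Eb' g0 H']]]] := coprimeO_reduce (c1 * d1) B2.
have Q : (g ^+ 2) ^+ 2 * prodO a' b' = (c1 * d1 * e1 * B1) ^+ 2.
  transitivity (prodO (g * a') (g * b')); first by rewrite /prodO; ring.
  by rewrite -Ea' -Eb' /prodO P1 P2; ring.
have [k Ek] := O_dvd_sqr Q.
have E' : prodO a' b' = k ^+ 2.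
  have g2 : (g ^+ 2) ^+ 2 != 0.
    by rewrite !expr2; apply/eqP => /O_mulf_eq0[] /O_mulf_eq0[] /eqP; rewrite (negbTE g0).
  by apply: (O_mulI g2); rewrite Q Ek; ring.
have b0' : b' != 0.
  by apply: contra B2 => /eqP z; rewrite Eb' z mulr0.
have ocd : ~~ evenO (c1 * d1) by rewrite evenOM negb_or oc1.
have [eb'|ob'] := boolP (evenO b').
  apply: (IH a' b' k) => //.
  have n1 : (0 < `|N b'|)%N by rewrite absz_gt0 normN0.
  have n2 : (0 < `|N g|)%N by rewrite absz_gt0 normN0.
  have n3 : (0 < `|N u|)%N by rewrite absz_gt0 normN0.
  have : (`|N b| = `|N u| * 64 * (`|N g| * `|N b'|))%N.
    rewrite -abszM -normM -Eb' EB EB1 exprMn !normM !abszM mulnA; congr (_ * _)%N.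
  move=> Eb2; move: Hn; rewrite Eb2.
  have : (`|N b'| <= `|N u| * (`|N g| * `|N b'|))%N by rewrite mulnA leq_pmull // muln_gt0 n3.
  move: (absz (N u)) (absz (N g)) (absz (N b')) n1 => x y z z0 h1 h2.
  have {}h2 : (64 * (x * (y * z)) < n.+1)%N by rewrite mulnA [(64 * x)%N]mulnC.
  by move: (x * (y * z))%N h1 h2 => t; clear -z0; lia.
(* With b' odd, all four factors of the halved point are odd, which [all_odd_absurd] excludes. *)
have oB1 : ~~ evenO B1.
  apply: contra ocd => eB1; have : evenO (B1 ^+ 2) by rewrite expr2 evenOM eB1.
  by rewrite Eb' evenOM (negbTE ob') orbF Ea' evenOM => ->.
have oe1 : ~~ evenO e1.
  have : ~~ evenO (e1 * (c1 - d1)) by rewrite P3 evenOM negb_or expr2 evenOM negb_or oB1.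
  by rewrite evenOM negb_or => /andP[].
have := all_odd_absurd H' E'; rewrite (negbTE ob') /= => /or3P[].
- by move=> ea'; move: ocd; rewrite Ea' evenOM ea' orbT.
- move=> ee; have : evenO (c1 * e1).
    rewrite -P1 Ea' Eb' (_ : _ - _ = g * (a' - eps * b')); last by ring.
    by rewrite evenOM ee orbT.
  by rewrite evenOM (negbTE oc1) (negbTE oe1).
- move=> ee; have : evenO (d1 * e1).
    rewrite -P2 Ea' Eb' (_ : _ - _ = g * (a' - mu * b')); last by ring.
    by rewrite evenOM ee orbT.
  by rewrite evenOM (negbTE od1) (negbTE oe1).
Qed.

(** The even factor is moved to the denominator by translation by a 2-torsion point: X goes to eps
    mu / X, eps (X - mu) / (X - eps) or mu (X - eps) / (X - mu). *)
Theorem points_O a b c : b != 0 -> prodO a b = c ^+ 2 ->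
  [\/ a = 0, a = eps * b | a = mu * b].
Proof.
move=> b0 E; have [g [a' [b' [Ea Eb g0 H]]]] := coprimeO_reduce a b0.
have [k Ek] : exists k, prodO a' b' = k ^+ 2.
  have Q : (g ^+ 2) ^+ 2 * prodO a' b' = c ^+ 2 by rewrite -E Ea Eb /prodO; ring.
  have [k Ek] := O_dvd_sqr Q; exists k.
  have g2 : (g ^+ 2) ^+ 2 != 0.
    by rewrite !expr2; apply/eqP => /O_mulf_eq0[] /O_mulf_eq0[] /eqP; rewrite (negbTE g0).
  by apply: (O_mulI g2); rewrite Q Ek; ring.
have b0' : b' != 0 by apply: contra b0 => /eqP z; rewrite Eb z mulr0.
have fin : [\/ a' = 0, a' = eps * b' | a' = mu * b'].
  have := all_odd_absurd H Ek => /or4P[] ev.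
  - have [->|a0] := eqVneq a' 0; first by constructor 1.
    case: (@no_even _ (eps * mu * b') a' (eps * mu * k) (ltnSn _)) => //.
      by apply: coprimeO_sym; rewrite -mulrA; apply: (coprimeO_unit unit_eps); exact: (coprimeO_unit unit_mu).
    by rewrite exprMn -Ek /prodO; ring.
  - by case: (@no_even _ a' b' k (ltnSn _)).
  - have [/eqP|a0] := eqVneq (a' - eps * b') 0; first by rewrite subr_eq0 => /eqP ->; constructor 2.
    case: (@no_even _ (eps * (a' - mu * b')) (a' - eps * b') (eps * (eps - mu) * k) (ltnSn _)) => //.
      apply: coprimeO_sym; apply: coprimeO_unit; first exact: unit_eps.
      exact: coprime_eps_mu.
    by rewrite exprMn -Ek /prodO; ring.
  - have [/eqP|a0] := eqVneq (a' - mu * b') 0; first by rewrite subr_eq0 => /eqP ->; constructor 3.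
    case: (@no_even _ (mu * (a' - eps * b')) (a' - mu * b') (mu * (mu - eps) * k) (ltnSn _)) => //.
      apply: coprimeO_sym; apply: coprimeO_unit; first exact: unit_mu.
      by apply: coprimeO_sym; apply: coprime_eps_mu.
    by rewrite exprMn -Ek /prodO; ring.
by rewrite Ea Eb; case: fin => ->; [constructor 1 | constructor 2 | constructor 3]; ring.
Qed.

(** * The field Q(w) inside [algC] *)

Lemma algw_ex : exists z : algC, z ^+ 3 == 1 + 2 * z - z ^+ 2.
Proof.
pose q : {poly algC} := Poly [:: -1; -2; 1; 1].
have e x : q.[x] = x ^+ 3 + x ^+ 2 - 2 * x - 1 by rewrite /q horner_Poly /=; ring.
have sq : size q = 4 by rewrite (PolyK (c := 0)) //= oner_neq0.
have /closed_rootP[z /rootP] : size q != 1%N by rewrite sq.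
by rewrite e => Hz; exists z; apply/eqP; rewrite -[LHS]subr0 -Hz; ring.
Qed.

Definition w : algC := sval (sigW algw_ex).
Lemma wE : w ^+ 3 = 1 + 2 * w - w ^+ 2.
Proof. by rewrite /w; case: sigW => z /= /eqP. Qed.

Lemma evw_norm o : ev w o * ev w (cub_adj o) = (N o)%:~R.
Proof.
by rewrite -(evM wE) cub_adjP /cubC /ev /=; ring.
Qed.
Lemma evw_eq0 o : ev w o = 0 -> o = 0.
Proof.
move=> H; apply: normO_eq0; apply/eqP; rewrite -(intr_eq0 algC) -evw_norm H mul0r //.
Qed.
Lemma evw_inj : injective (ev w).
Proof.
move=> a b H; apply/eqP; rewrite -subr_eq0; apply/eqP/evw_eq0.
have E : a - b = a + (ofZ (-1)) * b by rewrite /ofZ; case: (a) (b) => [[a0 a1] a2] [[b0 b1] b2]; congr (_, _, _); rewrite /=; ring.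
by rewrite E evD (evM wE) H /ofZ /ev /=; ring.
Qed.
Lemma ev_ofZ n : ev w (ofZ n) = n%:~R.
Proof. by rewrite /ev /ofZ /=; ring. Qed.

(** Integer denominators suffice, because [cub_adj] turns an inverse into a quotient by the norm. *)
Definition inF (x : algC) := exists (o : O) (n : int), n != 0 /\ x = ev w o / n%:~R.

Lemma inF_ev o : inF (ev w o).
Proof. by exists o, 1; split=> //; rewrite rmorph1 divr1. Qed.
Lemma inFD x y : inF x -> inF y -> inF (x + y).
Proof.
move=> [a [n [n0 ->]]] [b [m [m0 ->]]]; exists (a * ofZ m + b * ofZ n), (n * m).
rewrite mulf_neq0 //; split=> //; rewrite evD !(evM wE) !ev_ofZ intrM; field.
by rewrite !intr_eq0 n0 m0.
Qed.
Lemma inFM x y : inF x -> inF y -> inF (x * y).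
Proof.
move=> [a [n [n0 ->]]] [b [m [m0 ->]]]; exists (a * b), (n * m).
rewrite mulf_neq0 //; split=> //; rewrite !(evM wE) intrM; field.
by rewrite !intr_eq0 n0 m0.
Qed.
Lemma inF_int (n : int) : inF n%:~R.
Proof. by rewrite -ev_ofZ; apply: inF_ev. Qed.
Lemma inFN x : inF x -> inF (- x).
Proof. by move=> H; rewrite -mulN1r; apply: inFM => //; apply: (inF_int (-1)). Qed.
Lemma inFB x y : inF x -> inF y -> inF (x - y).
Proof. by move=> Hx Hy; apply: inFD => //; apply: inFN. Qed.
Lemma inFV x : inF x -> inF x^-1.
Proof.
have [->|x0] := eqVneq x 0; first by rewrite invr0.
move=> [a [n [n0 E]]]; have a0 : ev w a != 0 by apply: contra x0 => /eqP z; rewrite E z mul0r.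
have Na : N a != 0 by apply: contra a0 => /eqP /normO_eq0 ->; rewrite /ev /= !mul0r !addr0.
exists (ofZ n * cub_adj a), (N a); split=> //.
have Na' : (N a)%:~R != 0 :> algC by rewrite intr_eq0.
rewrite E (evM wE) ev_ofZ invf_div; apply: (mulIf Na').
rewrite mulfVK // -evw_norm; field.
by [].
Qed.
Lemma inF_rat q : inF (ratr q).
Proof.
by rewrite /ratr; apply: inFM; [apply: inF_int | apply: inFV; apply: inF_int].
Qed.
Lemma inFX x n : inF x -> inF (x ^+ n).
Proof.
move=> Hx; elim: n => [|n IH]; first exact: (inF_int 1).
by rewrite exprS; apply: inFM.
Qed.

Lemma indep (a b c : rat) : ratr a + ratr b * w + ratr c * w ^+ 2 = 0 ->
  [/\ a = 0, b = 0 & c = 0].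
Proof.
have d0 (q : rat) : (denq q)%:~R != 0 :> algC by rewrite intr_eq0 denq_neq0.
rewrite /ratr => H.
pose o : O := (numq a * denq b * denq c, numq b * denq a * denq c, numq c * denq a * denq b).
have : ev w o = 0.
  rewrite -(mulr0 ((denq a)%:~R * (denq b)%:~R * (denq c)%:~R : algC)) -H /ev /o !intrM; field.
  by rewrite !d0.
move/evw_eq0 => [] /eqP; rewrite !mulf_eq0 !(negbTE (denq_neq0 _)) !orbF numq_eq0 => /eqP ->.
move/eqP; rewrite !mulf_eq0 !(negbTE (denq_neq0 _)) !orbF numq_eq0 => /eqP ->.
by move/eqP; rewrite !mulf_eq0 !(negbTE (denq_neq0 _)) !orbF numq_eq0 => /eqP ->.
Qed.

Local Notation epsC := (4 - 5 * w - 4 * w ^+ 2).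
Local Notation muC := (-5 - 9 * w + 5 * w ^+ 2).

Lemma points_F X Y : inF X -> inF Y -> Y ^+ 2 = X * (X - epsC) * (X - muC) ->
  [\/ X = 0, X = epsC | X = muC].
Proof.
move=> [a [n [n0 EX]]] [c [m [m0 EY]]] H.
have n0' : n%:~R != 0 :> algC by rewrite intr_eq0.
have m0' : m%:~R != 0 :> algC by rewrite intr_eq0.
have evS (x y z : O) : ev w (x - y * z) = ev w x - ev w y * ev w z.
  rewrite (_ : x - y * z = x + ofZ (-1) * (y * z)); last first.
    by rewrite (_ : ofZ (-1) = -1 :> O) //; ring.
  by rewrite evD !(evM wE) ev_ofZ; ring.
have Ee : ev w eps = epsC by rewrite /ev /=; ring.
have Em : ev w mu = muC by rewrite /ev /=; ring.
have E : prodO (ofZ m * a) (ofZ m * ofZ n) = (ofZ m * ofZ n ^+ 2 * c) ^+ 2.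
  apply: evw_inj; rewrite /prodO !expr2 !(evM wE, evS) Ee Em !ev_ofZ.
  have Ea : ev w a = X * n%:~R by rewrite EX mulfVK.
  have Ec : ev w c = Y * m%:~R by rewrite EY mulfVK.
  rewrite Ea Ec; transitivity (X * (X - epsC) * (X - muC) * m%:~R ^+ 4 * n%:~R ^+ 4); first by ring.
  by rewrite -H; ring.
have b0 : ofZ m * ofZ n != 0.
  apply/eqP => /(congr1 (ev w)); rewrite (evM wE) !ev_ofZ => /eqP.
  by rewrite mulf_eq0 (negbTE n0') (negbTE m0').
have fin (k : O) : ofZ m * a = k * (ofZ m * ofZ n) -> X = ev w k.
  move/(congr1 (ev w)); rewrite !(evM wE) !ev_ofZ => Ek.
  rewrite EX; apply: (mulIf n0'); apply: (mulfI m0'); rewrite mulfVK // Ek; ring.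
have [Ek|Ek|Ek] := points_O b0 E.
- by constructor 1; rewrite (fin 0) ?Ek ?mul0r // /ev /=; ring.
- by constructor 2; rewrite (fin _ Ek).
- by constructor 3; rewrite (fin _ Ek).
Qed.

(* [p] and [p'] are the fixed points of an involution of the projective line over
   Q(w) that permutes the six branch points of y^2 = hyp x; [n0] and [n1] are the
   values of ((x - p) / (x - p'))^2 at 0 and at 1, and its value at infinity is 1. *)
Definition p := 2 - w ^+ 2.
Definition p' := 2 + 6 * w + 3 * w ^+ 2.
Definition n0 := 549 - 136 * w - 244 * w ^+ 2.
Definition n1 := - 135 - 196 * w + 244 * w ^+ 2.

(** Roots of T^3 - 8 T^2 + 5 T + 1: the involution pairs [th0] with 0, [th1] with 1, and the third
    root 2 + 3 w + w^2 with infinity. *)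
Definition th0 := -1 - w + 2 * w ^+ 2.
Definition th1 := 7 - 2 * w - 3 * w ^+ 2.
Definition rp' (S M : algC) := (31 - 2 * S + M) + (87 - 6 * S) * w + (39 - 3 * S) * w ^+ 2.

Lemma rp'E x1 x2 : (x1 - p') * (x2 - p') = rp' (x1 + x2) (x1 * x2).
Proof. by rewrite /rp' /p'; ring: wE. Qed.
Lemma facinf x : (x - p') ^+ 2 - (x - p) ^+ 2 = (p - p') * (2 * x - (4 + 6 * w + 2 * w ^+ 2)).
Proof. by rewrite /p /p'; ring. Qed.
Lemma fac0 x : n0 * (x - p') ^+ 2 - (x - p) ^+ 2 = (n0 - 1) * (x * (x - th0)).
Proof. by rewrite /n0 /p /p' /th0; ring: wE. Qed.
Lemma fac1 x : n1 * (x - p') ^+ 2 - (x - p) ^+ 2 = (n1 - 1) * ((x - 1) * (x - th1)).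
Proof. by rewrite /n1 /p /p' /th1; ring: wE. Qed.
Lemma nu0 : n0 - n1 = (n0 - 1) * (170 + 244 * w - 305 * w ^+ 2).
Proof. by rewrite /n0 /n1; ring: wE. Qed.
Lemma nu1 : n1 - n0 = (n1 - 1) * (1234 - 305 * w - 549 * w ^+ 2).
Proof. by rewrite /n0 /n1; ring: wE. Qed.

(** The hypothesis is (n0 - z1) (n0 - z2) = (n0 - 1) (n0 - n1) for z = ((x - p) / (x - p'))^2,
    cleared of denominators; the coefficients of 1, w, w^2 give three conics. The next two lemmas
    treat n1 and 1 in place of n0. *)
Lemma extract_0 (S M : rat) :
  ratr M * (ratr M - th0 * ratr S + th0 ^+ 2) =
    (170 + 244 * w - 305 * w ^+ 2) * rp' (ratr S) (ratr M) ^+ 2 ->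
  [/\ -131 - 299*M - 169*M^+2 + 272*S + 315*S*M - 146*S^+2 = 0,
      -196 - 432*M - 244*M^+2 + 394*S + 455*S*M - 211*S^+2 = 0 &
      221 + 539*M + 305*M^+2 - 488*S - 568*S*M + 263*S^+2 = 0].
Proof.
move/eqP; rewrite -subr_eq0 => /eqP H; apply: indep; rewrite -[RHS]H.
by rewrite /th0 /rp'; ring: wE.
Qed.

Lemma extract_1 (S M : rat) :
  (1 - ratr S + ratr M) * (ratr M - th1 * ratr S + th1 ^+ 2) =
    (1234 - 305 * w - 549 * w ^+ 2) * rp' (ratr S) (ratr M) ^+ 2 ->
  [/\ 57 + 39*M - 1233*M^+2 - 61*S - 196*S*M = 0,
      1 - 9*M + 305*M^+2 + 13*S + 48*S*M = 0 &
      - 17 - 17*M + 549*M^+2 + 26*S + 87*S*M = 0].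
Proof.
move/eqP; rewrite -subr_eq0 => /eqP H; apply: indep; rewrite -[RHS]H.
by rewrite /th1 /rp'; ring: wE.
Qed.

Lemma extract_inf (S M : rat) :
  (p - p') ^+ 2 * (4 * ratr M - 2 * (4 + 6 * w + 2 * w ^+ 2) * ratr S + (4 + 6 * w + 2 * w ^+ 2) ^+ 2) =
    (-352 - 96 * w + 304 * w ^+ 2) * rp' (ratr S) (ratr M) ^+ 2 ->
  [/\ 352*M^+2 - 160*S*M + 64*S^+2 + 256*M - 160*S + 96 = 0,
      96*M^+2 - 288*S*M + 48*S^+2 + 416*M - 176*S + 128 = 0 &
      - 304*M^+2 + 352*S*M - 208*S^+2 - 272*M + 352*S - 144 = 0].
Proof.
move/eqP; rewrite -subr_eq0 => /eqP H; apply: indep; rewrite -[RHS]H.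
by rewrite /p /p' /rp'; ring: wE.
Qed.
Lemma Kinf : (1 - n0) * (1 - n1) = -352 - 96 * w + 304 * w ^+ 2.
Proof. by rewrite /n0 /n1; ring: wE. Qed.

(** * Quadratic points of the genus 2 curve *)

Definition hyp (R : comNzRingType) (x : R) : R := x * (x - 1) * (x ^+ 3 - 8 * x ^+ 2 + 5 * x + 1).

Lemma solve_inf (S M : rat) :
  352*M^+2 - 160*S*M + 64*S^+2 + 256*M - 160*S + 96 = 0 ->
  96*M^+2 - 288*S*M + 48*S^+2 + 416*M - 176*S + 128 = 0 ->
  - 304*M^+2 + 352*S*M - 208*S^+2 - 272*M + 352*S - 144 = 0 ->
  S = 1 /\ M = 0 \/ S = 7 / 9 /\ M = - (1 / 9).
Proof.
move=> e1 e2 e3.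
have h1 : S = 9 * M ^+ 2 + 3 * M + 1 by lra.
have h2 : S * M = 5 / 3 * M - 4 / 9 * S + 4 / 9 by lra.
have h3 : S ^+ 2 = 7 / 9 * S + 2 * M + 2 / 9 by lra.
clear e1 e2 e3.
have : M * ((9 * M + 1) * (3 * M + 2)) = 0.
  transitivity (3 * ((9 * M ^+ 2 + 3 * M + 1) * M - 5 / 3 * M + 4 / 9 * (9 * M ^+ 2 + 3 * M + 1) - 4 / 9)).
    by field.
  by rewrite -h1 h2; field.
move/eqP; rewrite !mulf_eq0 => /or3P[/eqP m|/eqP m|/eqP m].
- left; split; [by rewrite h1 m; ring | exact: m].
- have {}m : M = - (1 / 9) by lra.
  right; split; [by rewrite h1 m; field | exact: m].
- have {}m : M = - (2 / 3) by lra.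
  have s : S = 3 by rewrite h1 m; field.
  by exfalso; move: h3; rewrite s m; lra.
Qed.

Lemma solve_0 (S M : rat) :
  -131 - 299*M - 169*M^+2 + 272*S + 315*S*M - 146*S^+2 = 0 ->
  -196 - 432*M - 244*M^+2 + 394*S + 455*S*M - 211*S^+2 = 0 ->
  221 + 539*M + 305*M^+2 - 488*S - 568*S*M + 263*S^+2 = 0 ->
  S = 11 /\ M = 9.
Proof.
move=> e1 e2 e3.
have h1 : S = 2 / 3 * M + 5 by lra.
have h2 : S * M = M ^+ 2 + 3 * M - 9 by lra.
have h3 : S ^+ 2 = M ^+ 2 + 17 / 3 * M - 11 by lra.
clear e1 e2 e3.
have : (M - 9) * (M + 3) = 0.
  transitivity (- 3 * ((2 / 3 * M + 5) * M - M ^+ 2 - 3 * M + 9)); first by field.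
  by rewrite -h1 h2; ring.
move/eqP; rewrite mulf_eq0 => /orP[/eqP m|/eqP m].
- have {}m : M = 9 by lra.
  split; [by rewrite h1 m; field | exact: m].
- have {}m : M = - 3 by lra.
  have s : S = 3 by rewrite h1 m; field.
  by exfalso; move: h3; rewrite s m; lra.
Qed.

Lemma solve_1 (S M : rat) :
  57 + 39*M - 1233*M^+2 - 61*S - 196*S*M = 0 ->
  1 - 9*M + 305*M^+2 + 13*S + 48*S*M = 0 ->
  - 17 - 17*M + 549*M^+2 + 26*S + 87*S*M = 0 ->
  S = 9 /\ M = -1.
Proof.
move=> e1 e2 e3.
have h1 : S = 17 / 2 - 1 / 2 * M by lra.
have h2 : S * M = 7 / 2 * M - 11 / 2 by lra.
have h3 : M ^+ 2 = 1 / 2 - 1 / 2 * M by lra.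
clear e1 e2 e3.
have : (2 * M - 1) * (M + 1) = 0 by transitivity (2 * M ^+ 2 + M - 1); [ring | rewrite h3; field].
move/eqP; rewrite mulf_eq0 => /orP[/eqP m|/eqP m].
- have {}m : M = 1 / 2 by lra.
  have s : S = 33 / 4 by rewrite h1 m; field.
  by exfalso; move: h2; rewrite s m; lra.
- have {}m : M = - 1 by lra.
  split; [by rewrite h1 m; field | exact: m].
Qed.

(** The constant in hyp x = kap (x - p')^6 (z - 1) (z - n0) (z - n1), where z = ((x - p) / (x -
    p'))^2. *)
Definition kap := (3 + 7 * w + 3 * w ^+ 2) / 448.

Lemma kapE x : hyp x * 448 = (3 + 7 * w + 3 * w ^+ 2) *
  (((x - p) ^+ 2 - (x - p') ^+ 2) * ((x - p) ^+ 2 - n0 * (x - p') ^+ 2) * ((x - p) ^+ 2 - n1 * (x - p') ^+ 2)).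
Proof.
have e1 : (x - p) ^+ 2 - (x - p') ^+ 2 = - ((p - p') * (2 * x - (4 + 6 * w + 2 * w ^+ 2))).
  by rewrite -facinf; ring.
have e2 : (x - p) ^+ 2 - n0 * (x - p') ^+ 2 = - ((n0 - 1) * (x * (x - th0))) by rewrite -fac0; ring.
have e3 : (x - p) ^+ 2 - n1 * (x - p') ^+ 2 = - ((n1 - 1) * ((x - 1) * (x - th1))) by rewrite -fac1; ring.
rewrite e1 e2 e3.
have c : x ^+ 3 - 8 * x ^+ 2 + 5 * x + 1 = (x - th0) * (x - th1) * (x - (2 + 3 * w + w ^+ 2)).
  by rewrite /th0 /th1; ring: wE.
have k : 448 = - 2 * ((3 + 7 * w + 3 * w ^+ 2) * (p - p') * ((n0 - 1) * (n1 - 1))).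
  have -> : (n0 - 1) * (n1 - 1) = -352 - 96 * w + 304 * w ^+ 2 by rewrite -Kinf; ring.
  by rewrite /p /p'; ring: wE.
by rewrite /hyp c k; ring.
Qed.

(** The chord construction: z3 is the third abscissa on the line h = t1 z + t0. *)
Lemma dvd_cubic (F : fieldType) (k e e' e'' t1 t0 z1 z2 z3 : F) : k != 0 -> z1 != z2 ->
  k * (z1 - e) * (z1 - e') * (z1 - e'') = (t1 * z1 + t0) ^+ 2 ->
  k * (z2 - e) * (z2 - e') * (z2 - e'') = (t1 * z2 + t0) ^+ 2 ->
  z3 = t1 ^+ 2 / k + e + e' + e'' - z1 - z2 ->
  k * (z3 - e) * (z3 - e') * (z3 - e'') = (t1 * z3 + t0) ^+ 2.
Proof.
move=> k0 z12 H1 H2 E3.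
have z120 : z1 - z2 != 0 by rewrite subr_eq0.
pose G z := k * (z - e) * (z - e') * (z - e'') - (t1 * z + t0) ^+ 2.
have G1 : G z1 = 0 by rewrite /G H1 subrr.
have G2 : G z2 = 0 by rewrite /G H2 subrr.
have G3 : G z3 = 0.
  have -> : G z3 = (G z1 * (z3 - z2) - G z2 * (z3 - z1)) / (z1 - z2).
    by rewrite /G E3; field; rewrite ?k0 ?z120.
  by rewrite G1 G2 !mul0r subrr mul0r.
by apply/eqP; rewrite -subr_eq0 -/(G z3) G3.
Qed.

(** When the third point is (e, 0), translation by it exchanges the two others up to sign, and its
    effect on abscissae is (e - z) (e - z') = (e - e') (e - e''). *)
Lemma third_two_torsion (F : fieldType) (k e e' e'' t1 t0 z1 z2 : F) : k != 0 -> z1 != z2 ->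
  k * (z1 - e) * (z1 - e') * (z1 - e'') = (t1 * z1 + t0) ^+ 2 ->
  k * (z2 - e) * (z2 - e') * (z2 - e'') = (t1 * z2 + t0) ^+ 2 ->
  t1 * e + t0 = 0 -> e = t1 ^+ 2 / k + e + e' + e'' - z1 - z2 ->
  (e - z1) * (e - z2) = (e - e') * (e - e'').
Proof.
move=> k0 z12 H1 H2 /eqP; rewrite addr_eq0 => /eqP T E.
have {}T : t0 = - (t1 * e) by rewrite T opprK.
have E1 : t1 ^+ 2 = k * (z1 + z2 - e' - e'').
  have -> : t1 ^+ 2 = k * (t1 ^+ 2 / k) by field.
  congr (_ * _); transitivity ((t1 ^+ 2 / k + e + e' + e'' - z1 - z2) - e - e' - e'' + z1 + z2); first by ring.
  by rewrite -E; ring.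
have key z z' : z != e -> z1 + z2 = z + z' ->
    k * (z - e) * (z - e') * (z - e'') = (t1 * z + t0) ^+ 2 -> (e - z) * (e - z') = (e - e') * (e - e'').
  move=> ze Ez; have ze0 : z - e != 0 by rewrite subr_eq0.
  have -> : (t1 * z + t0) ^+ 2 = t1 ^+ 2 * (z - e) ^+ 2 by rewrite T; ring.
  rewrite E1 Ez => H.
  have H' : (z - e') * (z - e'') = (z + z' - e' - e'') * (z - e).
    apply: (mulfI k0); apply: (mulfI ze0); transitivity (k * (z - e) * (z - e') * (z - e'')); first by ring.
    by rewrite H; ring.
  transitivity ((e - e') * (e - e'') + ((z + z' - e' - e'') * (z - e) - (z - e') * (z - e''))); first by ring.
  by rewrite H' subrr addr0.
(* If z1 is e itself, then z2 is not, and the argument runs with the two exchanged. *)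
have [z1e|z1e] := eqVneq z1 e; last by apply: key => //.
by rewrite mulrC; apply: key => //; [rewrite -z1e eq_sym | rewrite addrC].
Qed.

Lemma lin_absurd (S : rat) : 87 - 6 * S = 0 -> 39 - 3 * S = 0 -> False.
Proof. by move=> *; lra. Qed.
Lemma lin_one (S M : rat) : 2 * M - 4 * S + 2 = 0 -> 6 - 6 * S = 0 -> S = 1 /\ M = 1.
Proof. by move=> *; split; lra. Qed.

Section Quadratic.
Variables (S M s0 s1 : rat) (x1 x2 : algC).
Hypotheses (HS : x1 + x2 = ratr S) (HM : x1 * x2 = ratr M) (Hne : x1 != x2).
Hypotheses (H1 : (ratr s0 + ratr s1 * x1) ^+ 2 = hyp x1) (H2 : (ratr s0 + ratr s1 * x2) ^+ 2 = hyp x2).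

(** Values at x1 and x2 of one linear polynomial over Q(w), that is, an element of Q(w)(x) together
    with its conjugate. Both x1 and x2 may be rational, as in [rat_hyp]. *)
Definition inF2 (v1 v2 : algC) := exists A B, [/\ inF A, inF B, v1 = A + B * x1 & v2 = A + B * x2].

Lemma inF2_M u1 u2 v1 v2 : inF2 u1 u2 -> inF2 v1 v2 -> inF2 (u1 * v1) (u2 * v2).
Proof.
move=> [A [B [FA FB -> ->]]] [C [D [FC FD -> ->]]].
exists (A * C - B * D * ratr M), (A * D + B * C + B * D * ratr S).
split.
- by apply: inFB; [apply: inFM | apply: inFM; [apply: inFM | apply: inF_rat]].
- by apply: inFD; [apply: inFD; apply: inFM | apply: inFM; [apply: inFM | apply: inF_rat]].
- by rewrite -HS -HM; ring.
- by rewrite -HS -HM; ring.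
Qed.

Lemma inF2_lin A B : inF A -> inF B -> inF2 (A + B * x1) (A + B * x2).
Proof. by move=> FA FB; exists A, B. Qed.

Lemma inF_p : inF p.
Proof.
have -> : p = ev w (2, 0, -1) by rewrite /p /ev /=; ring.
exact: inF_ev.
Qed.
Lemma inF_p' : inF p'.
Proof.
have -> : p' = ev w (2, 6, 3) by rewrite /p' /ev /=; ring.
exact: inF_ev.
Qed.

Let R := (x1 - p') * (x2 - p').
Lemma RE : R = rp' (ratr S) (ratr M). Proof. by rewrite /R rp'E HS HM. Qed.

Lemma R_neq0 : R != 0.
Proof.
apply/eqP; rewrite RE => H.
have := @indep (31 - 2 * S + M) (87 - 6 * S) (39 - 3 * S).
have E : ratr (31 - 2 * S + M) + ratr (87 - 6 * S) * w + ratr (39 - 3 * S) * w ^+ 2 = 0 :> algC.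
  by rewrite -[RHS]H /rp'; ring.
by move=> /(_ E) [_]; apply: lin_absurd.
Qed.

Lemma inF_R : inF R.
Proof.
have -> : R = ratr M + p' ^+ 2 - p' * ratr S by rewrite /R -HM -HS; ring.
apply: inFB; last by apply: inFM; [apply: inF_p' | apply: inF_rat].
by apply: inFD; [apply: inF_rat | apply: inFX; apply: inF_p'].
Qed.

Let i1 := (x1 - p')^-1.
Let i2 := (x2 - p')^-1.
Let z1 := ((x1 - p) / (x1 - p')) ^+ 2.
Let z2 := ((x2 - p) / (x2 - p')) ^+ 2.
Let h1 := (ratr s0 + ratr s1 * x1) / (x1 - p') ^+ 3.
Let h2 := (ratr s0 + ratr s1 * x2) / (x2 - p') ^+ 3.

Lemma d_neq0 : (x1 - p' != 0) && (x2 - p' != 0).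
Proof. by have := R_neq0; rewrite mulf_eq0 negb_or. Qed.

Lemma inF2_i : inF2 i1 i2.
Proof.
exists ((ratr S - p') / R), (- R^-1); have /andP[d1 d2] := d_neq0.
split.
- apply: inFM; [apply: inFB; [exact: inF_rat | exact: inF_p'] | exact: inFV inF_R].
- exact: inFN (inFV inF_R).
- by rewrite -HS /R /i1; field; rewrite ?d1 ?d2.
- by rewrite -HS /R /i2; field; rewrite ?d1 ?d2.
Qed.

Lemma inF2_z : inF2 z1 z2.
Proof.
rewrite /z1 /z2 !expr2; suff h : inF2 ((x1 - p) / (x1 - p')) ((x2 - p) / (x2 - p')) by apply: inF2_M.
apply: inF2_M inF2_i; exists (- p), 1; split; [exact: inFN inF_p | exact: (inF_int 1) | ring | ring].
Qed.

Lemma inF2_h : inF2 h1 h2.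
Proof.
rewrite /h1 /h2 -!exprVn; apply: inF2_M; first by apply: inF2_lin; apply: inF_rat.
by rewrite !exprS !expr0 !mulr1; do 2!apply: inF2_M inF2_i _; exact: inF2_i.
Qed.

Lemma eqh (x y : algC) : x - p' != 0 -> y ^+ 2 = hyp x ->
  kap * (((x - p) / (x - p')) ^+ 2 - 1) * (((x - p) / (x - p')) ^+ 2 - n0) * (((x - p) / (x - p')) ^+ 2 - n1) =
  (y / (x - p') ^+ 3) ^+ 2.
Proof.
move=> d0 Hy.
have -> : (y / (x - p') ^+ 3) ^+ 2 = y ^+ 2 * 448 / (448 * (x - p') ^+ 6).
  by field; rewrite d0 //.
rewrite Hy kapE /kap; field.
by rewrite d0.
Qed.

(** The alternative S = M = 1 is the one where the involution exchanges x1 and x2. Otherwise the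
    line through the two images has coefficients [t1], [t0] in Q(w), and its third point is (1, 0),
    (n0, 0) or (n1, 0). *)
Lemma classify : S = 1 /\ M = 1 \/ [\/ S = 1 /\ M = 0, S = 7 / 9 /\ M = - (1 / 9), S = 11 /\ M = 9 | S = 9 /\ M = -1].
Proof.
have /andP[d1 d2] := d_neq0.
have q1 := eqh d1 H1; have q2 := eqh d2 H2.
rewrite -/z1 -/h1 in q1; rewrite -/z2 -/h2 in q2.
have [z12|z12] := eqVneq z1 z2.
  left; move: z12 => /eqP; rewrite /z1 /z2 eqf_sqr => /orP[/eqP E|/eqP E].
    case/eqP: Hne.
    have pp : p - p' != 0.
      apply/eqP => z; have : ratr 0 + ratr (-6) * w + ratr (-4) * w ^+ 2 = 0 :> algC.
        by rewrite -[RHS]z /p /p'; ring.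
      by move/indep => [_].
    have E' : (x1 - p) * (x2 - p') - (x2 - p) * (x1 - p') = 0.
      have -> : x1 - p = (x2 - p) / (x2 - p') * (x1 - p') by rewrite -E mulfVK.
      by field.
    apply: (mulfI pp); apply/eqP; rewrite -subr_eq0; apply/eqP; rewrite -[RHS]E'; ring.
  have E' : (x1 - p) * (x2 - p') + (x2 - p) * (x1 - p') = 0.
    have -> : x1 - p = - ((x2 - p) / (x2 - p')) * (x1 - p') by rewrite -E mulfVK.
    by field.
  have : ratr (2 * M - 4 * S + 2) + ratr (6 - 6 * S) * w + ratr (2 - 2 * S) * w ^+ 2 = 0 :> algC.
    rewrite -[RHS]E'.
    have -> : ratr (2 * M - 4 * S + 2) = 2 * (x1 * x2) - 4 * (x1 + x2) + 2 :> algC by rewrite HS HM; ring.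
    have -> : ratr (6 - 6 * S) = 6 - 6 * (x1 + x2) :> algC by rewrite HS; ring.
    have -> : ratr (2 - 2 * S) = 2 - 2 * (x1 + x2) :> algC by rewrite HS; ring.
    by rewrite /p /p'; ring: wE.
  by move/indep => [e1 e2 _]; apply: lin_one.
right.
have [A [B [FA FB Ez1 Ez2]]] := inF2_z; have [C [D [FC FD Eh1 Eh2]]] := inF2_h.
have B0 : B != 0 by apply: contra z12 => /eqP z; rewrite Ez1 Ez2 z !mul0r.
pose t1 := D / B; pose t0 := C - t1 * A.
have Ft1 : inF t1 by apply: inFM FD (inFV FB).
have Ft0 : inF t0 by apply: inFB FC (inFM Ft1 FA).
have Eh1' : h1 = t1 * z1 + t0 by rewrite Eh1 Ez1 /t0 /t1; field.
have Eh2' : h2 = t1 * z2 + t0 by rewrite Eh2 Ez2 /t0 /t1; field.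
rewrite Eh1' in q1; rewrite Eh2' in q2.
have k0 : kap != 0.
  apply/eqP => z; have : ratr 3 + ratr 7 * w + ratr 3 * w ^+ 2 = 0 :> algC.
    have -> : ratr 3 + ratr 7 * w + ratr 3 * w ^+ 2 = kap * 448 :> algC by rewrite /kap; field.
    by rewrite z mul0r.
  by move/indep => [].
pose z3 := t1 ^+ 2 / kap + 1 + n0 + n1 - z1 - z2.
have q3 := dvd_cubic k0 z12 q1 q2 (erefl z3).
have Fk : inF kap.
  have -> : kap = ev w (3, 7, 3) / (448 : int)%:~R by rewrite /kap /ev /=; field.
  by apply: inFM; [apply: inF_ev | apply: inFV; apply: inF_int].
have Fn0 : inF n0.
  have -> : n0 = ev w (549, -136, -244) by rewrite /n0 /ev /=; ring.
  exact: inF_ev.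
have Fn1 : inF n1.
  have -> : n1 = ev w (-135, -196, 244) by rewrite /n1 /ev /=; ring.
  exact: inF_ev.
have Fz3 : inF z3.
  have -> : z3 = t1 ^+ 2 / kap + 1 + n0 + n1 - (2 * A + B * ratr S).
    by rewrite /z3 Ez1 Ez2 -HS; ring.
  apply: inFB; last by apply: inFD; [apply: inFM FA; exact: (inF_int 2) | apply: inFM FB (inF_rat S)].
  apply: inFD Fn1; apply: inFD Fn0; apply: inFD (inF_int 1).
  by apply: inFM (inFV Fk); apply: inFX.
(* The scaling that turns kap (n0 - 1) and kap (n1 - 1) into the units eps and mu. *)
pose t := 4 * (1 + w + w ^+ 2).
have Ft : inF t.
  have -> : t = ev w (4, 4, 4) by rewrite /t /ev /=; ring.
  exact: inF_ev.
have Ke : kap * t ^+ 2 * (n0 - 1) = 4 - 5 * w - 4 * w ^+ 2.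
  have -> : kap * t ^+ 2 * (n0 - 1) = ((3 + 7 * w + 3 * w ^+ 2) * (1 + w + w ^+ 2) ^+ 2 * (n0 - 1)) / 28.
    by rewrite /kap /t; field.
  rewrite /n0; apply: (@mulIf _ 28); rewrite ?pnatr_eq0 // mulfVK ?pnatr_eq0 //; ring: wE.
have Km : kap * t ^+ 2 * (n1 - 1) = -5 - 9 * w + 5 * w ^+ 2.
  have -> : kap * t ^+ 2 * (n1 - 1) = ((3 + 7 * w + 3 * w ^+ 2) * (1 + w + w ^+ 2) ^+ 2 * (n1 - 1)) / 28.
    by rewrite /kap /t; field.
  rewrite /n1; apply: (@mulIf _ 28); rewrite ?pnatr_eq0 // mulfVK ?pnatr_eq0 //; ring: wE.
have eps0 : 4 - 5 * w - 4 * w ^+ 2 != 0 :> algC.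
  apply/eqP => z.
  have : ratr 4 + ratr (-5) * w + ratr (-4) * w ^+ 2 = 0 :> algC by rewrite -[RHS]z; ring.
  by move/indep => [].
have mu0 : -5 - 9 * w + 5 * w ^+ 2 != 0 :> algC.
  apply/eqP => z.
  have : ratr (-5) + ratr (-9) * w + ratr 5 * w ^+ 2 = 0 :> algC by rewrite -[RHS]z; ring.
  by move/indep => [].
have kt0 : kap * t ^+ 2 != 0 by apply: contra eps0 => /eqP z; rewrite -Ke z mul0r.
have := @points_F (kap * t ^+ 2 * (z3 - 1)) (kap * t ^+ 3 * (t1 * z3 + t0)) _ _ _.
move=> []; try by
 [apply: inFM; [apply: inFM => //; apply: inFX | apply: inFB => //; exact: (inF_int 1)]
 |apply: inFM; [apply: inFM => //; apply: inFX | apply: inFD => //; apply: inFM]].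
- rewrite -Ke -Km exprMn -q3; ring.
- move/eqP; rewrite mulf_eq0 (negbTE kt0) subr_eq0 => /eqP z3e.
  have T : t1 * 1 + t0 = 0.
    by apply/eqP; rewrite -sqrf_eq0 -z3e -q3 z3e subrr mulr0 !mul0r.
  have Q := third_two_torsion k0 z12 q1 q2 T (esym z3e).
  have [e1 e2 e3] : [/\ 352*M^+2 - 160*S*M + 64*S^+2 + 256*M - 160*S + 96 = 0,
      96*M^+2 - 288*S*M + 48*S^+2 + 416*M - 176*S + 128 = 0 &
      - 304*M^+2 + 352*S*M - 208*S^+2 - 272*M + 352*S - 144 = 0].
    apply: extract_inf; rewrite -Kinf -Q -RE -HM -HS.
    transitivity (((x1 - p') ^+ 2 - (x1 - p) ^+ 2) * ((x2 - p') ^+ 2 - (x2 - p) ^+ 2)).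
      by rewrite !facinf; ring.
    by rewrite /z1 /z2 /R; field; rewrite ?d1 ?d2.
  by case: (solve_inf e1 e2 e3) => H; [constructor 1 | constructor 2].
- rewrite -Ke => /(mulfI kt0) /(addIr _) z3e.
  have T : t1 * n0 + t0 = 0.
    by apply/eqP; rewrite -sqrf_eq0 -z3e -q3 z3e subrr mulr0 mul0r.
  have q1' : kap * (z1 - n0) * (z1 - 1) * (z1 - n1) = (t1 * z1 + t0) ^+ 2 by rewrite -q1; ring.
  have q2' : kap * (z2 - n0) * (z2 - 1) * (z2 - n1) = (t1 * z2 + t0) ^+ 2 by rewrite -q2; ring.
  have E0 : n0 = t1 ^+ 2 / kap + n0 + 1 + n1 - z1 - z2 by rewrite -[LHS]z3e /z3; ring.
  have Q := third_two_torsion k0 z12 q1' q2' T E0.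
  have n00 : n0 - 1 != 0 by apply: contra eps0 => /eqP z; rewrite -Ke z mulr0.
  have [e1 e2 e3] : [/\ -131 - 299*M - 169*M^+2 + 272*S + 315*S*M - 146*S^+2 = 0,
      -196 - 432*M - 244*M^+2 + 394*S + 455*S*M - 211*S^+2 = 0 &
      221 + 539*M + 305*M^+2 - 488*S - 568*S*M + 263*S^+2 = 0].
    apply: extract_0; rewrite -RE; apply: (mulfI n00); apply: (mulfI n00).
    transitivity ((n0 * (x1 - p') ^+ 2 - (x1 - p) ^+ 2) * (n0 * (x2 - p') ^+ 2 - (x2 - p) ^+ 2)).
      by rewrite !fac0 -HM -HS; ring.
    transitivity ((n0 - z1) * (n0 - z2) * R ^+ 2).
      by rewrite /z1 /z2 /R; field; rewrite ?d1 ?d2.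
    by rewrite Q nu0; ring.
  by constructor 3; apply: solve_0 e1 e2 e3.
- rewrite -Km => /(mulfI kt0) /(addIr _) z3e.
  have T : t1 * n1 + t0 = 0.
    by apply/eqP; rewrite -sqrf_eq0 -z3e -q3 z3e subrr mulr0.
  have q1' : kap * (z1 - n1) * (z1 - 1) * (z1 - n0) = (t1 * z1 + t0) ^+ 2 by rewrite -q1; ring.
  have q2' : kap * (z2 - n1) * (z2 - 1) * (z2 - n0) = (t1 * z2 + t0) ^+ 2 by rewrite -q2; ring.
  have E0 : n1 = t1 ^+ 2 / kap + n1 + 1 + n0 - z1 - z2 by rewrite -[LHS]z3e /z3; ring.
  have Q := third_two_torsion k0 z12 q1' q2' T E0.
  have n10 : n1 - 1 != 0 by apply: contra mu0 => /eqP z; rewrite -Km z mulr0.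
  have [e1 e2 e3] : [/\ 57 + 39*M - 1233*M^+2 - 61*S - 196*S*M = 0,
      1 - 9*M + 305*M^+2 + 13*S + 48*S*M = 0 &
      - 17 - 17*M + 549*M^+2 + 26*S + 87*S*M = 0].
    apply: extract_1; rewrite -RE; apply: (mulfI n10); apply: (mulfI n10).
    transitivity ((n1 * (x1 - p') ^+ 2 - (x1 - p) ^+ 2) * (n1 * (x2 - p') ^+ 2 - (x2 - p) ^+ 2)).
      by rewrite !fac1 -HM -HS; ring.
    transitivity ((n1 - z1) * (n1 - z2) * R ^+ 2).
      by rewrite /z1 /z2 /R; field; rewrite ?d1 ?d2.
    by rewrite Q nu1; ring.
  by constructor 4; apply: solve_1 e1 e2 e3.
Qed.
End Quadratic.

(** * Tate normal form *)

Section Group.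
Variable F : fieldType.
Implicit Types (E : wcoef F) (P Q : option (F * F)).

Definition wneg E P : option (F * F) :=
  if P is Some (x, y) then Some (x, - y - a1 E * x - a3 E) else None.

Definition wtr E (r s t : F) : wcoef F :=
  WCoef (a1 E + 2%:R * s) (a2 E - s * a1 E + 3%:R * r - s ^+ 2)
    (a3 E + r * a1 E + 2%:R * t)
    (a4 E - s * a3 E + 2%:R * r * a2 E - (t + r * s) * a1 E + 3%:R * r ^+ 2 - 2%:R * s * t)
    (a6 E + r * a4 E + r ^+ 2 * a2 E + r ^+ 3 - t * a3 E - t ^+ 2 - r * t * a1 E).

Definition ptr (r s t : F) P : option (F * F) :=
  if P is Some (x, y) then Some (x - r, y - s * (x - r) - t) else None.

Lemma wiso_tr E r s t : wiso E (wtr E r s t).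
Proof. by exists 1, r, s, t; rewrite oner_neq0; split=> //; split; rewrite /=; ring. Qed.

Lemma on_curve_tr E r s t P : on_curve (wtr E r s t) (ptr r s t P) = on_curve E P.
Proof.
case: P => [[x y]|//] /=.
by rewrite -subr_eq0 -[in RHS]subr_eq0; congr (_ == _); ring.
Qed.

(** The intercept of the tangent is y - lam x; in this form duplication transforms like the chord in
    [wadd_tr]. *)
Lemma tangent_nu E x y : on_curve E (Some (x, y)) ->
  - x ^+ 3 + a4 E * x + 2%:R * a6 E - a3 E * y =
  y * (2%:R * y + a1 E * x + a3 E) - x * (3%:R * x ^+ 2 + 2%:R * a2 E * x + a4 E - a1 E * y).
Proof.
move=> /eqP H.
have -> : a6 E = y ^+ 2 + a1 E * x * y + a3 E * y - (x ^+ 3 + a2 E * x ^+ 2 + a4 E * x) by rewrite H; ring.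
by ring.
Qed.

Lemma wadd_tr E r s t P Q : on_curve E P -> on_curve E Q ->
  wadd (wtr E r s t) (ptr r s t P) (ptr r s t Q) = ptr r s t (wadd E P Q).
Proof.
case: P => [[x1 y1]|] //; case: Q => [[x2 y2]|] //= /eqP HP /eqP HQ.
have -> : (x1 - r == x2 - r) = (x1 == x2) by rewrite (inj_eq (addIr _)).
have -> : (y1 - s * (x1 - r) - t + (y2 - s * (x2 - r) - t) + (a1 E + 2%:R * s) * (x2 - r)
    + (a3 E + r * a1 E + 2%:R * t) == 0) = (y1 + y2 + a1 E * x2 + a3 E - s * (x1 - x2) == 0).
  by congr (_ == _); ring.
have [Ex|nx] := eqVneq x1 x2; last first.
  have d : x2 - x1 != 0 by rewrite subr_eq0 eq_sym.
  have d' : x2 - r - (x1 - r) != 0 by rewrite (_ : _ - _ = x2 - x1) //; ring.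
  by rewrite /=; congr (Some (_, _)); field; rewrite d ?d'.
rewrite -Ex in HQ *; rewrite subrr mulr0 subr0 /=.
have [//|nz] := eqVneq (y1 + y2 + a1 E * x1 + a3 E) 0.
have Ey : y2 = y1.
  have : (y2 - y1) * (y1 + y2 + a1 E * x1 + a3 E) = 0.
    by transitivity ((y2 ^+ 2 + a1 E * x1 * y2 + a3 E * y2) - (y1 ^+ 2 + a1 E * x1 * y1 + a3 E * y1));
      [ring | rewrite HP HQ subrr].
  by move/eqP; rewrite mulf_eq0 (negbTE nz) orbF subr_eq0 => /eqP.
rewrite Ey in nz.
set D := 2%:R * y1 + a1 E * x1 + a3 E.
have D0 : D != 0 by rewrite /D (_ : _ + _ = y1 + y1 + a1 E * x1 + a3 E) //; ring.
have D1 : 2%:R * (y1 - s * (x1 - r) - t) + (a1 E + 2%:R * s) * (x1 - r) +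
  (a3 E + r * a1 E + 2%:R * t) = D by rewrite /D; ring.
have HP' : on_curve (wtr E r s t) (Some (x1 - r, y1 - s * (x1 - r) - t)).
  by have := on_curve_tr E r s t (Some (x1, y1)); rewrite /= HP eqxx => ->.
have := tangent_nu HP'; rewrite /= D1 => ->.
have -> : - x1 ^+ 3 + a4 E * x1 + 2%:R * a6 E - a3 E * y1 = _ := tangent_nu (introT eqP HP).
rewrite -/D; set M := 3%:R * x1 ^+ 2 + 2%:R * a2 E * x1 + a4 E - a1 E * y1.
have -> : 3%:R * (x1 - r) ^+ 2 + 2%:R * (a2 E - s * a1 E + 3%:R * r - s ^+ 2) * (x1 - r) +
    (a4 E - s * a3 E + 2%:R * r * a2 E - (t + r * s) * a1 E + 3%:R * r ^+ 2 - 2%:R * s * t) -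
    (a1 E + 2%:R * s) * (y1 - s * (x1 - r) - t) = M - s * D by rewrite /M /D; ring.
by move: D D0 M {D1} => D D0 M; congr (Some (_, _)); field.
Qed.

End Group.

Section Origin.
Variables (F : fieldType) (E : wcoef F).
Hypotheses (E4 : a4 E = 0) (E6 : a6 E = 0) (E3 : a3 E != 0).
Implicit Types (R T : option (F * F)).
Local Notation Q0 := (Some (0, 0) : option (F * F)).

Lemma ocE x y : on_curve E (Some (x, y)) -> y ^+ 2 = x ^+ 3 + a2 E * x ^+ 2 - a1 E * x * y - a3 E * y.
Proof. by move=> /eqP; rewrite E4 E6 mul0r !addr0 => <-; ring. Qed.

Lemma oc0 y : on_curve E (Some (0, y)) -> y = 0 \/ y = - a3 E.
Proof.
move/ocE => H; have : y * (y + a3 E) = 0 by rewrite mulrDr -expr2 H; ring.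
by move/eqP; rewrite mulf_eq0 addr_eq0 => /orP[] /eqP; [left | right].
Qed.

Lemma wadd0 x y : x != 0 -> on_curve E (Some (x, y)) ->
  wadd E Q0 (Some (x, y)) = Some (- (a3 E * y) / x ^+ 2, a3 E * (a2 E * x ^+ 2 - a3 E * y) / x ^+ 3).
Proof.
move=> x0 /ocE H; rewrite /= [0 == x]eq_sym (negbTE x0) /= !subr0 mul0r mulr0 subrr mul0r subr0.
have -> : (y / x) ^+ 2 + a1 E * (y / x) - a2 E - x = - (a3 E * y) / x ^+ 2.
  by rewrite expr_div_n H; field.
congr (Some (_, _)).
have -> : - (y / x + a1 E) * (- (a3 E * y) / x ^+ 2) = a3 E * (y ^+ 2 + a1 E * x * y) / x ^+ 3 by field.
by rewrite H; field.
Qed.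

Lemma wadd00 : wadd E Q0 Q0 = Some (- a2 E, a1 E * a2 E - a3 E).
Proof.
rewrite /= eqxx !mulr0 !addr0 /= !add0r (negbTE E3) E4 E6 !mulr0.
by congr (Some (_, _)); field.
Qed.

Lemma wadd0n : wadd E Q0 (Some (0, - a3 E)) = None.
Proof. by rewrite /= eqxx mulr0 addr0 add0r addNr eqxx. Qed.

Lemma oc_add R : on_curve E R -> on_curve E (wadd E Q0 R).
Proof.
case: R => [[x y]|] => [H|_]; last by rewrite /= E4 E6 !(mul0r, mulr0, expr0n, addr0).
have [x0|x0] := eqVneq x 0.
  move: H; rewrite x0 => /oc0[->|->]; last by rewrite wadd0n.
  by rewrite wadd00 /= E4 E6; apply/eqP; ring.
rewrite wadd0 //=; move/ocE: H => H; rewrite E4 E6; apply/eqP.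
apply/eqP; rewrite -subr_eq0; apply/eqP.
set q := a2 E * x ^+ 2 - a3 E * y.
transitivity (a3 E ^+ 2 * q * (q - a1 E * x * y + x ^+ 3 - y ^+ 2) / x ^+ 6); first by rewrite /q; field.
have -> : q - a1 E * x * y + x ^+ 3 - y ^+ 2 = 0 by rewrite H /q; ring.
by rewrite mulr0 mul0r.
Qed.

Lemma oc_neg R : on_curve E R -> on_curve E (wneg E R).
Proof.
case: R => [[x y]|//] /= /eqP H; rewrite -H; apply/eqP; ring.
Qed.
Lemma wnegK R : wneg E (wneg E R) = R.
Proof. by case: R => [[x y]|//] /=; congr (Some (_, _)); ring. Qed.

(** The instance Q0 + (-(Q0 + R)) = -R of the group axioms. The cases R = O, Q0, -Q0 and -2 Q0,
    where a formula degenerates, are treated apart. *)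
Lemma swap R T : on_curve E R -> on_curve E T -> wadd E Q0 R = wneg E T -> R = wneg E (wadd E Q0 T).
Proof.
move=> HR HT H.
have {H HT} -> : T = wneg E (wadd E Q0 R) by rewrite H wnegK.
case: R HR => [[x y]|] H; last first.
  have -> : wneg E (wadd E Q0 None) = Some (0, - a3 E) by rewrite /=; congr (Some (_, _)); ring.
  by rewrite wadd0n.
have [x0|x0] := eqVneq x 0.
  move: H; rewrite x0 => /oc0[->|->].
    have e1 : wneg E (Some (- a2 E, a1 E * a2 E - a3 E)) = Some (- a2 E, 0).
      by rewrite /wneg; congr (Some (_, _)); ring.
    rewrite wadd00 e1; have [a0|a0] := eqVneq (a2 E) 0.
      by rewrite a0 oppr0 wadd00 a0 /wneg; congr (Some (_, _)); ring.
    rewrite wadd0 ?oppr_eq0 //; last by rewrite /= E4 E6; apply/eqP; ring.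
    by rewrite /wneg; congr (Some (_, _)); field; rewrite ?oppr_eq0 ?a0.
  rewrite wadd0n; have -> : wadd E Q0 (wneg E None) = Some (0, 0) by [].
  by rewrite /wneg; congr (Some (_, _)); ring.
have := oc_neg (oc_add H); rewrite wadd0 // /wneg.
set X := - (a3 E * y) / x ^+ 2; set Y := (X in - X - _ - _).
have [y0|y0] := eqVneq y 0.
  have H' := ocE H; rewrite y0 !(mulr0, subr0, expr0n) /= in H'.
  have Ex : x = - a2 E.
    have : x ^+ 2 * (x + a2 E) = 0 by rewrite [RHS]H'; ring.
    by move/eqP; rewrite mulf_eq0 sqrf_eq0 (negbTE x0) addr_eq0 => /eqP.
  have Ea : a2 E = - x by rewrite Ex opprK.
  have EX : X = 0 by rewrite /X ?y0 mulr0 oppr0 mul0r.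
  have -> : - Y - a1 E * X - a3 E = 0 by rewrite EX /Y ?y0 Ea; field.
  by rewrite EX y0 wadd00 Ea /wneg => _; congr (Some (_, _)); ring.
have X0 : X != 0 by rewrite /X mulf_neq0 ?invr_eq0 ?expf_neq0 // oppr_eq0 mulf_neq0.
move=> HO; rewrite wadd0 // /wneg /X /Y.
(* Solving the curve equation for a1 turns the claim into an identity of rational functions. *)
have Ea1 : a1 E = (x ^+ 3 + a2 E * x ^+ 2 - a3 E * y - y ^+ 2) / (x * y).
  by rewrite (ocE H); field; rewrite ?x0 ?y0.
by rewrite Ea1; congr (Some (_, _)); field; rewrite ?oppr_eq0 ?mulf_neq0 ?x0 ?y0 ?E3.
Qed.

(** The other fragment of associativity. The conditions say that R and Q0 + R have nonzero abscissa,
    so that [wadd0] applies twice; R = 2 Q0 is a duplication. *)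
Lemma double_add x y : x != 0 -> y != 0 -> on_curve E (Some (x, y)) ->
  wadd E (wadd E Q0 Q0) (Some (x, y)) = wadd E Q0 (wadd E Q0 (Some (x, y))).
Proof.
move=> x0 y0 HR; have HR' := oc_add HR; move: HR'.
have X0 : - (a3 E * y) / x ^+ 2 != 0.
  by rewrite mulf_neq0 ?invr_eq0 ?expf_neq0 // oppr_eq0 mulf_neq0.
rewrite (wadd0 x0 HR) => HR'; rewrite (wadd0 X0 HR') wadd00.
have Ea1 : a1 E = (x ^+ 3 + a2 E * x ^+ 2 - a3 E * y - y ^+ 2) / (x * y).
  by rewrite (ocE HR); field; rewrite ?x0 ?y0.
have [Ex|nx] := eqVneq x (- a2 E).
  have Ey : y = a1 E * a2 E - a3 E.
    have : y * (y - (a1 E * a2 E - a3 E)) = 0 by rewrite mulrBr -expr2 (ocE HR) Ex; ring.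
    by move/eqP; rewrite mulf_eq0 (negbTE y0) subr_eq0 => /eqP.
  have a20 : a2 E != 0 by rewrite -oppr_eq0 -Ex.
  have e0 : a1 E * a2 E - a3 E != 0 by rewrite -Ey.
  rewrite Ex Ey /= eqxx /=.
  have -> : a1 E * a2 E - a3 E + (a1 E * a2 E - a3 E) + a1 E * - a2 E + a3 E = a1 E * a2 E - a3 E by ring.
  rewrite (negbTE e0).
  have -> : 2%:R * (a1 E * a2 E - a3 E) + a1 E * - a2 E + a3 E = a1 E * a2 E - a3 E by ring.
  rewrite E4 E6; congr (Some (_, _)); field;
    by rewrite ?oppr_eq0 ?mulf_neq0 ?e0 ?a20 ?E3.
have d0 : x + a2 E != 0 by rewrite addr_eq0.
rewrite /= eq_sym (negbTE nx) /= Ea1.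
by congr (Some (_, _)); field; rewrite ?oppr_eq0 ?mulf_neq0 ?opprK ?x0 ?y0 ?E3 ?d0.
Qed.

End Origin.

Lemma wmulS (F : fieldType) (E : wcoef F) n P : wmul E n.+1 P = wadd E P (wmul E n P).
Proof. by []. Qed.

Lemma ptr_neg (F : fieldType) (E : wcoef F) r s t P :
  ptr r s t (wneg E P) = wneg (wtr E r s t) (ptr r s t P).
Proof. by case: P => [[x y]|//] /=; congr (Some (_, _)); ring. Qed.

Section Order14.
Variables (F : fieldType) (E : wcoef F).
Hypotheses (E4 : a4 E = 0) (E6 : a6 E = 0) (E3 : a3 E != 0).
Local Notation Q0 := (Some (0, 0) : option (F * F)).
Local Notation M n := (wmul E n Q0).
Hypotheses (M14 : M 14 = None) (Mn : forall n, (0 < n < 14)%N -> M n <> None).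

Lemma oc_M n : on_curve E (M n).
Proof. by elim: n => // n IH; rewrite wmulS; apply: oc_add. Qed.

Lemma M_neg k : (k <= 14)%N -> M (14 - k) = wneg E (M k).
Proof.
elim: k => [|k IH] Hk; first by rewrite subn0 M14.
have := IH (ltnW Hk); rewrite subSn // wmulS => H.
by rewrite subSS (swap E4 E6 E3 (oc_M _) (oc_M _) H) -wmulS.
Qed.

Lemma M_opp i j : M i = wneg E (M j) -> M (i + j) = None.
Proof.
elim: i j => [|i IH] j; first by rewrite add0n; case: (M j) => [[]|].
rewrite wmulS => H; rewrite addSnnS; apply: IH.
by rewrite (swap E4 E6 E3 (oc_M _) (oc_M _) H) -wmulS.
Qed.

Lemma M_add n : M (n + 14) = M n.
Proof. by elim: n => [|n IH]; rewrite ?add0n ?M14 // addSn !wmulS IH. Qed.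

Lemma M1 : M 1 = Q0. Proof. by []. Qed.

(** A point of abscissa 0 is Q0 or -Q0; n Q0 equal to one of them would make (n - 1) Q0 or (n + 1)
    Q0 vanish. *)
Lemma M_x n : (1 < n < 13)%N -> exists x y, M n = Some (x, y) /\ x != 0.
Proof.
move=> /andP[n1 n13].
have Hn : M n <> None by apply: Mn; rewrite (ltn_trans _ n1) // (ltn_trans n13).
case EM : (M n) => [[x y]|//]; exists x, y; split=> //.
apply/eqP => x0; have := oc_M n; rewrite EM x0 => /(oc0 E4 E6)[] y0.
  have H : M n = wneg E (M 13) by rewrite -(@M_neg 13) // EM x0 y0.
  have := M_opp H; have -> : (n + 13 = n.-1 + 14)%N by lia.
  by rewrite M_add; apply: Mn; lia.
have H : M n = wneg E (M 1).
  by rewrite EM x0 y0 M1 /wneg; congr (Some (_, _)); ring.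
by have := M_opp H; apply: Mn; lia.
Qed.

Lemma M_double n : (1 < n < 12)%N -> wadd E (M 2) (M n) = M n.+2.
Proof.
move=> /andP[n1 n12].
have [x [y [EM x0]]] : exists x y, M n = Some (x, y) /\ x != 0 by apply: M_x; lia.
have [x' [y' [EM' x0']]] : exists x y, M n.+1 = Some (x, y) /\ x != 0 by apply: M_x; lia.
have oc := oc_M n; rewrite EM in oc.
have y0 : y != 0.
  apply: contra x0' => /eqP y0; move: EM'; rewrite wmulS EM wadd0 // y0 mulr0 oppr0 mul0r.
  by case=> <-.
have -> : M 2 = wadd E Q0 Q0 by [].
by rewrite EM double_add // -EM -!wmulS.
Qed.

End Order14.

(* the universal elliptic curve with a point of order 7, at (0, 0) *)
Definition tate (F : fieldType) (d : F) : wcoef F :=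
  WCoef (1 + d - d ^+ 2) (d ^+ 2 - d ^+ 3) (d ^+ 2 - d ^+ 3) 0 0.

(** Order 7 is expressed as 4 Q0 = -3 Q0. In Tate's form y^2 + (1 - c) x y - b y = x^3 - b x^2, with
    b = -B, equality of these abscissae is the nodal cubic c^3 = b^2 - b c, parametrised by d = b /
    c. *)
Lemma tate7 (F : fieldType) (E : wcoef F) : a4 E = 0 -> a6 E = 0 -> a3 E != 0 ->
  let Q0 : option (F * F) := Some (0, 0) in let P2 := wadd E Q0 Q0 in let P3 := wadd E Q0 P2 in
  P3 <> None -> wadd E Q0 P3 = wneg E P3 -> exists d, wiso E (tate d).
Proof.
move=> E4 E6 E3 Q0 P2 P3 n3 H.
have EP2 : P2 = Some (- a2 E, a1 E * a2 E - a3 E) by apply: wadd00.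
have oc2 : on_curve E P2.
  by apply: oc_add => //; rewrite /= E4 E6; apply/eqP; ring.
have a20 : a2 E != 0.
  apply/eqP => a20; apply: n3; rewrite /P3 EP2 a20 oppr0 mulr0 sub0r; exact: wadd0n.
have x20 : - a2 E != 0 by rewrite oppr_eq0.
rewrite EP2 in oc2.
have EP3 : P3 = Some (- (a3 E * (a1 E * a2 E - a3 E)) / (- a2 E) ^+ 2,
    a3 E * (a2 E * (- a2 E) ^+ 2 - a3 E * (a1 E * a2 E - a3 E)) / (- a2 E) ^+ 3).
  by rewrite /P3 EP2; apply: wadd0.
have oc3 : on_curve E P3 by rewrite /P3 EP2; apply: oc_add.
set e := a1 E * a2 E - a3 E in EP3.
have e0 : e != 0.
  apply/eqP => e0; have E3' : P3 = Some (0, - a3 E).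
    by rewrite EP3 e0; congr (Some (_, _)); field; rewrite ?oppr_eq0 ?a20.
  by apply: n3; move: H; rewrite E3' wadd0n.
have x30 : - (a3 E * e) / (- a2 E) ^+ 2 != 0.
  by rewrite mulf_neq0 ?invr_eq0 ?expf_neq0 // oppr_eq0 mulf_neq0.
move: H; rewrite EP3 /Q0 wadd0 //; last by rewrite -EP3.
move=> [Hx _]; have {Hx} R : a3 E * e ^+ 3 + a2 E ^+ 3 * (a2 E ^+ 3 - a3 E * e) = 0.
  move/eqP: Hx; rewrite -subr_eq0 => /eqP Hx.
  have : (a3 E * e ^+ 3 + a2 E ^+ 3 * (a2 E ^+ 3 - a3 E * e)) / (a2 E ^+ 2 * e ^+ 2) = 0.
    rewrite -[RHS]Hx; field; rewrite ?oppr_eq0 ?mulf_neq0 ?e0 ?a20 ?E3 //.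
  by move/eqP; rewrite mulf_eq0 invr_eq0 mulf_eq0 !expf_eq0 /= (negbTE a20) (negbTE e0) !orbF => /eqP.
pose B := a2 E ^+ 3 / a3 E ^+ 2; pose c := - e / a3 E.
have c0 : c != 0 by rewrite mulf_neq0 ?invr_eq0 ?oppr_eq0.
have Rc : c ^+ 3 = B ^+ 2 + B * c.
  apply/eqP; rewrite -subr_eq0; apply/eqP; rewrite -[RHS](mul0r (- a3 E ^- 4)) -[in RHS]R /c /B; field.
  by rewrite E3.
pose d := - B / c.
have Ec : c = d ^+ 2 - d.
  apply: (mulfI (expf_neq0 2 c0)); rewrite -exprSr Rc /d; field; by rewrite c0.
have Eb : B = d ^+ 2 - d ^+ 3.
  have -> : d ^+ 2 - d ^+ 3 = - d * (d ^+ 2 - d) by ring.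
  by rewrite -Ec /d; field; rewrite c0.
exists d, (a3 E / a2 E), 0, 0, 0; split; first by rewrite mulf_neq0 // invr_eq0.
rewrite /= E4 E6 -Eb; split.
- have -> : 1 + d - d ^+ 2 = 1 - c by rewrite Ec; ring.
  by rewrite /c /e; field; rewrite E3 a20.
- by rewrite /B; field; rewrite E3 a20.
- by rewrite /B; field; rewrite E3 a20.
- by ring.
- by ring.
Qed.

Section Reduction.
Variable F : fieldType.
Implicit Types (E : wcoef F).

Lemma wiso_trans E E' E'' : wiso E E' -> wiso E' E'' -> wiso E E''.
Proof.
move=> [u [r [s [t [u0 [h1 h2 h3 h4 h6]]]]]] [u' [r' [s' [t' [u0' [g1 g2 g3 g4 g6]]]]]].
exists (u * u'), (r + u ^+ 2 * r'), (s + u * s'), (t + u ^+ 3 * t' + u ^+ 2 * s * r').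
rewrite mulf_neq0 //; split=> //.
have k1 : a1 E = u * a1 E' - 2%:R * s by rewrite h1; ring.
have k2 : a2 E = u ^+ 2 * a2 E' + s * a1 E - 3%:R * r + s ^+ 2 by rewrite h2; ring.
have k3 : a3 E = u ^+ 3 * a3 E' - r * a1 E - 2%:R * t by rewrite h3; ring.
have k4 : a4 E = u ^+ 4 * a4 E' + s * a3 E - 2%:R * r * a2 E + (t + r * s) * a1 E
   - 3%:R * r ^+ 2 + 2%:R * s * t by rewrite h4; ring.
have k6 : a6 E = u ^+ 6 * a6 E' - (r * a4 E + r ^+ 2 * a2 E + r ^+ 3 - t * a3 E
   - t ^+ 2 - r * t * a1 E) by rewrite h6; ring.
have m (n : nat) (x : F) : (u * u') ^+ n * x = u ^+ n * (u' ^+ n * x) by rewrite exprMn; ring.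
split.
- by rewrite -mulrA g1 k1; ring.
- by rewrite m g2 k2 k1; ring.
- by rewrite m g3 k3 k1; ring.
- by rewrite m g4 k4 k3 k2 k1; ring.
- by rewrite m g6 k6 k4 k3 k2 k1; ring.
Qed.

Lemma wiso_sym E E' : wiso E E' -> wiso E' E.
Proof.
move=> [u [r [s [t [u0 [h1 h2 h3 h4 h6]]]]]].
exists u^-1, (- r / u ^+ 2), (- s / u), ((r * s - t) / u ^+ 3).
rewrite invr_eq0; split=> //.
have k1 : a1 E' = (a1 E + 2%:R * s) / u by rewrite -h1 mulrC mulKf.
have k2 : a2 E' = (a2 E - s * a1 E + 3%:R * r - s ^+ 2) / u ^+ 2 by rewrite -h2 mulrC mulKf ?expf_neq0.
have k3 : a3 E' = (a3 E + r * a1 E + 2%:R * t) / u ^+ 3 by rewrite -h3 mulrC mulKf ?expf_neq0.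
have k4 : a4 E' = (a4 E - s * a3 E + 2%:R * r * a2 E - (t + r * s) * a1 E
                     + 3%:R * r ^+ 2 - 2%:R * s * t) / u ^+ 4 by rewrite -h4 mulrC mulKf ?expf_neq0.
have k6 : a6 E' = (a6 E + r * a4 E + r ^+ 2 * a2 E + r ^+ 3 - t * a3 E
                     - t ^+ 2 - r * t * a1 E) / u ^+ 6 by rewrite -h6 mulrC mulKf ?expf_neq0.
by split; rewrite ?k6 ?k4 ?k3 ?k2 ?k1; field; rewrite u0.
Qed.

Definition psi2 E x := 4%:R * x ^+ 3 + (a1 E ^+ 2 + 4%:R * a2 E) * x ^+ 2
  + 2%:R * (2%:R * a4 E + a1 E * a3 E) * x + (a3 E ^+ 2 + 4%:R * a6 E).

Lemma psi2_root E x y : on_curve E (Some (x, y)) -> 2%:R * y + a1 E * x + a3 E = 0 -> psi2 E x = 0.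
Proof.
move=> /eqP H D; have : (2%:R * y + a1 E * x + a3 E) ^+ 2 = 0 by rewrite D expr0n.
have -> : (2%:R * y + a1 E * x + a3 E) ^+ 2 =
   4%:R * (y ^+ 2 + a1 E * x * y + a3 E * y) + (a1 E * x + a3 E) ^+ 2 by ring.
by rewrite H /psi2 => <-; ring.
Qed.

Lemma psi2_iso E E' x x' : wiso E E' -> x != x' -> psi2 E x = 0 -> psi2 E x' = 0 ->
  exists z z', [/\ z != z', psi2 E' z = 0 & psi2 E' z' = 0].
Proof.
move=> [u [r [s [t [u0 [h1 h2 h3 h4 h6]]]]]] xx' H H'.
have key z : psi2 E z = 0 -> psi2 E' ((z - r) / u ^+ 2) = 0.
  move=> Hz; have k1 : a1 E' = (a1 E + 2%:R * s) / u by rewrite -h1 mulrC mulKf.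
  have k2 : a2 E' = (a2 E - s * a1 E + 3%:R * r - s ^+ 2) / u ^+ 2 by rewrite -h2 mulrC mulKf ?expf_neq0.
  have k3 : a3 E' = (a3 E + r * a1 E + 2%:R * t) / u ^+ 3 by rewrite -h3 mulrC mulKf ?expf_neq0.
  have k4 : a4 E' = (a4 E - s * a3 E + 2%:R * r * a2 E - (t + r * s) * a1 E
                     + 3%:R * r ^+ 2 - 2%:R * s * t) / u ^+ 4 by rewrite -h4 mulrC mulKf ?expf_neq0.
  have k6 : a6 E' = (a6 E + r * a4 E + r ^+ 2 * a2 E + r ^+ 3 - t * a3 E
                     - t ^+ 2 - r * t * a1 E) / u ^+ 6 by rewrite -h6 mulrC mulKf ?expf_neq0.
  rewrite -[RHS](mul0r (u ^- 6)) -Hz /psi2 k1 k2 k3 k4 k6; field; by rewrite u0.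
exists ((x - r) / u ^+ 2), ((x' - r) / u ^+ 2); split; try exact: key.
by rewrite (inj_eq (mulIf _)) ?invr_eq0 ?expf_neq0 // (inj_eq (addIr _)).
Qed.

(** Moves the point to the origin; s is the slope of its tangent, which becomes y = 0. *)
Lemma normalize E x y : on_curve E (Some (x, y)) -> 2%:R * y + a1 E * x + a3 E != 0 ->
  exists s, [/\ a4 (wtr E x s y) = 0, a6 (wtr E x s y) = 0 & a3 (wtr E x s y) != 0].
Proof.
move=> /eqP H D; exists ((3%:R * x ^+ 2 + 2%:R * a2 E * x + a4 E - a1 E * y) / (2%:R * y + a1 E * x + a3 E)).
split=> /=.
- by field.
- transitivity (x ^+ 3 + a2 E * x ^+ 2 + a4 E * x + a6 E - (y ^+ 2 + a1 E * x * y + a3 E * y)); first by ring.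
  by rewrite H subrr.
- by rewrite (_ : _ + _ = 2%:R * y + a1 E * x + a3 E) //; ring.
Qed.

Lemma ptr_origin (x s y : F) : ptr x s y (Some (x, y)) = Some (0, 0).
Proof. by rewrite /=; congr (Some (_, _)); ring. Qed.

Lemma ptr_None (r s t : F) P : ptr r s t P = None -> P = None.
Proof. by case: P => [[]|]. Qed.

Lemma wadd_self_None E x y : wadd E (Some (x, y)) (Some (x, y)) = None ->
  2%:R * y + a1 E * x + a3 E = 0.
Proof.
rewrite /= eqxx /=; case: eqP => // H _; rewrite -[RHS]H; ring.
Qed.

Lemma wadd_self E x y : 2%:R * y + a1 E * x + a3 E = 0 ->
  wadd E (Some (x, y)) (Some (x, y)) = None.
Proof.
move=> D; rewrite /= eqxx /=.
have -> : y + y + a1 E * x + a3 E = 0 by rewrite -[RHS]D; ring.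
by rewrite eqxx.
Qed.

(** [Q] is put at the origin of [E1], then 2 Q, of order 7, at the origin of [E2]; multiples of 2 Q
    are computed on [E1] by [M_double] and transported. The two roots of [psi2] come from P and 7
    Q. *)
Theorem tate14 E : 2%:R != 0 :> F -> has_C2xC14 E ->
  exists d, wiso E (tate d) /\ exists e e', [/\ e != e', psi2 (tate d) e = 0 & psi2 (tate d) e' = 0].
Proof.
move=> two [P [Q [ocP ocQ P2 Q14 inj]]].
have nz i j : (i < 2)%N -> (j < 14)%N -> (0 < i + j)%N -> wadd E (wmul E i P) (wmul E j Q) <> None.
  by move=> hi hj hij H; case: (inj i j hi hj H) hij => -> ->.
have Qn j : (0 < j < 14)%N -> wmul E j Q <> None.
  by move=> /andP[j0 j14] H; apply: (nz 0%N j) => //; rewrite H.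
case: Q ocQ Q14 inj nz Qn => [[xq yq]|] ocQ Q14 inj nz Qn; last by case: (Qn 1%N).
set Q := Some (xq, yq) in Q14 inj nz Qn.
have D0 : 2%:R * yq + a1 E * xq + a3 E != 0.
  by apply/eqP => D; apply: (Qn 2%N) => //; apply: wadd_self.
have [s [E4 E6 E3]] := normalize ocQ D0.
set E1 := wtr E xq s yq in E4 E6 E3.
pose f := ptr xq s yq.
have M n : on_curve E (wmul E n Q) /\ f (wmul E n Q) = wmul E1 n (Some (0, 0)).
  elim: n => // n [IH1 IH2]; rewrite !wmulS.
  have E' : f (wadd E Q (wmul E n Q)) = wadd E1 (Some (0, 0)) (wmul E1 n (Some (0, 0))).
    by rewrite /f -wadd_tr // ptr_origin -/f IH2.
  split=> //; rewrite -(on_curve_tr _ xq s yq) -/E1 -/f E'.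
  by apply: oc_add => //; apply: oc_M.
have M14 : wmul E1 14 (Some (0, 0)) = None by have [_ <-] := M 14%N; rewrite Q14.
have Mn n : (0 < n < 14)%N -> wmul E1 n (Some (0, 0)) <> None.
  by move=> hn; have [_ <-] := M n; move/ptr_None; apply: Qn.
have db := M_double E4 E6 E3 M14 Mn.
have [x2 [y2 [M2 x20]]] := M_x E4 E6 E3 M14 Mn (isT : (1 < 2 < 13)%N).
have oc n := oc_M E4 E6 E3 n.
have ocD := oc 2%N; rewrite M2 in ocD.
have M4 : wadd E1 (wmul E1 2 (Some (0, 0))) (wmul E1 2 (Some (0, 0))) = wmul E1 4 (Some (0, 0)) by apply: db.
have M6 : wadd E1 (wmul E1 2 (Some (0, 0))) (wmul E1 4 (Some (0, 0))) = wmul E1 6 (Some (0, 0)) by apply: db.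
have M8 : wadd E1 (wmul E1 2 (Some (0, 0))) (wmul E1 6 (Some (0, 0))) = wneg E1 (wmul E1 6 (Some (0, 0))).
  by rewrite db // (M_neg E4 E6 E3 M14 (isT : (6 <= 14)%N)).
have D20 : 2%:R * y2 + a1 E1 * x2 + a3 E1 != 0.
  apply/eqP => D; apply: (Mn 4%N) => //; rewrite -M4 M2.
  exact: wadd_self.
have [s' [E4' E6' E3']] := normalize ocD D20.
set E2 := wtr E1 x2 s' y2 in E4' E6' E3'.
pose g := ptr x2 s' y2.
have g2 : g (wmul E1 2 (Some (0, 0))) = Some (0, 0) by rewrite M2 /g ptr_origin.
have A n : wadd E2 (g (wmul E1 2 (Some (0, 0)))) (g (wmul E1 n (Some (0, 0)))) =
    g (wadd E1 (wmul E1 2 (Some (0, 0))) (wmul E1 n (Some (0, 0)))) by apply: wadd_tr.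
have G4 : wadd E2 (Some (0, 0)) (Some (0, 0)) = g (wmul E1 4 (Some (0, 0))).
  by have := A 2%N; rewrite M4 g2.
have G6 : wadd E2 (Some (0, 0)) (g (wmul E1 4 (Some (0, 0)))) = g (wmul E1 6 (Some (0, 0))).
  by have := A 4%N; rewrite M6 g2.
have G8 : wadd E2 (Some (0, 0)) (g (wmul E1 6 (Some (0, 0)))) = wneg E2 (g (wmul E1 6 (Some (0, 0)))).
  by have := A 6%N; rewrite M8 g2 /g ptr_neg.
have [d Hd] : exists d, wiso E2 (tate d).
  apply: tate7 => //; rewrite G4 G6 //.
  by move/ptr_None; apply: Mn.
have iso : wiso E (tate d).
  by apply: wiso_trans (wiso_tr E xq s yq) _; apply: wiso_trans (wiso_tr E1 x2 s' y2) Hd.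
exists d; split=> //.
have P0 : P <> None by move=> P0; apply: (nz 1%N 0%N) => //; rewrite P0.
case: P ocP P2 P0 inj nz => [[xp yp]|] // ocP P2 _ inj nz.
have Dp := wadd_self_None (P2 : wadd E (Some (xp, yp)) (Some (xp, yp)) = None).
have T7 : wmul E 7 Q = wneg E (wmul E 7 Q).
  have H : wmul E1 7 (Some (0, 0)) = wneg E1 (wmul E1 7 (Some (0, 0))).
    exact: (M_neg E4 E6 E3 M14 (isT : (7 <= 14)%N)).
  have [_ H7] := M 7%N; rewrite -H7 /f -ptr_neg in H; move: H.
  case: (wmul E 7 Q) => [[x y]|] //= [Hy]; congr (Some (_, _)).
  by move: Hy => /addIr /addIr.
have oc7 : on_curve E (wmul E 7 Q) by have [] := M 7%N.
have n7 : wmul E 7 Q <> None by apply: Qn.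
have s7 := nz 1%N 7%N isT isT isT.
case E7 : (wmul E 7 Q) T7 oc7 n7 s7 => [[x7 y7]|] // [T7] oc7 _ s7.
have D7 : 2%:R * y7 + a1 E * x7 + a3 E = 0.
  by move/eqP: T7; rewrite -subr_eq0 => /eqP T7; rewrite -[RHS]T7; ring.
have xx : xp != x7.
  apply/eqP => xx; apply: s7.
  have yy : yp = y7.
    apply: (mulfI two); apply: (addIr (a1 E * x7 + a3 E)).
    by rewrite !addrA D7 -Dp xx.
  by rewrite yy xx; apply: wadd_self.
apply: (psi2_iso iso xx); first exact: psi2_root Dp.
exact: psi2_root D7.
Qed.

End Reduction.

(** * From full 2-torsion to y and u *)

Lemma wdisc_tate (F : fieldType) (d : F) :
  wdisc (tate d) = d ^+ 7 * (d - 1) ^+ 7 * (d ^+ 3 - 8 * d ^+ 2 + 5 * d + 1).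
Proof. by rewrite /wdisc /tate /=; ring. Qed.

Section TwoTorsion.
Variable F : fieldType.
Hypothesis no3 : forall k : F, k ^+ 2 + k + 1 != 0.

(* A pair (a, b) stands for a + b eta with eta^2 = eta - 1, up to scalars, that is
   for a / b; [Hn / Hd] is the simplest cubic of conductor 7, and [Hn_mul],
   [Hd_mul] say that it is compatible with multiplication. *)
Definition Hn (a b : F) := a ^+ 3 + a ^+ 2 * b - 2 * a * b ^+ 2 - b ^+ 3.
Definition Hd (a b : F) := a * b * (a + b).
(* [Pn], [Pd] twist the ratio of differences of the 2-torsion abscissae to a point
   over the parameter y / (d (d - 1)). *)
Definition Pn (d y : F) := -1 - 4 * d + 11 * d ^+ 2 - 3 * d ^+ 3 - 4 * d ^+ 4 + d ^+ 5
  + (-2 - d + 7 * d ^+ 2 - 3 * d ^+ 3) * y.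
Definition Pd (d y : F) := 1 + 5 * d - 12 * d ^+ 2 - 6 * d ^+ 3 + 16 * d ^+ 4 - 3 * d ^+ 5
  + (1 - d + d ^+ 2) * y.
(* c4 (tate d) = qq d * SS d and c6 (tate d) = c6t d *)
Definition qq (d : F) := d ^+ 2 - d + 1.
Definition SS (d : F) := 1 + 5 * d - 10 * d ^+ 2 - 15 * d ^+ 3 + 30 * d ^+ 4 - 11 * d ^+ 5 + d ^+ 6.
Definition c6t (d : F) := -1 - 6 * d + 15 * d ^+ 2 + 46 * d ^+ 3 - 174 * d ^+ 4 + 222 * d ^+ 5
  - 273 * d ^+ 6 + 486 * d ^+ 7 - 570 * d ^+ 8 + 354 * d ^+ 9 - 117 * d ^+ 10 + 18 * d ^+ 11 - d ^+ 12.
Definition UU (d : F) := qq d * (1 + 7 * d - 11 * d ^+ 2 - 81 * d ^+ 3 + 155 * d ^+ 4 + 124 * d ^+ 5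
  - 486 * d ^+ 6 + 393 * d ^+ 7 - 110 * d ^+ 8 + 9 * d ^+ 9).

Lemma Hn_mul (a b c e : F) : Hn (a * c - b * e) (a * e + b * c + b * e) = Hn a b * Hn c e - 7 * Hd a b * Hd c e.
Proof. by rewrite /Hn /Hd; ring. Qed.
Lemma Hd_mul (a b c e : F) : Hd (a * c - b * e) (a * e + b * c + b * e) =
  Hn a b * Hd c e + Hn c e * Hd a b + Hd a b * Hd c e.
Proof. by rewrite /Hn /Hd; ring. Qed.

Lemma quad_eq0 (a b : F) : a ^+ 2 + a * b + b ^+ 2 = 0 -> a = 0 /\ b = 0.
Proof.
have [->|b0] := eqVneq b 0.
  by rewrite mulr0 expr0n !addr0 => /eqP; rewrite sqrf_eq0 => /eqP.
move=> H; case/eqP: (no3 (a / b)); rewrite -[RHS](mul0r (b ^- 2)) -H; field; by rewrite b0.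
Qed.

Lemma Pnd_norm d y : y ^+ 2 = hyp d -> Pn d y ^+ 2 + Pn d y * Pd d y + Pd d y ^+ 2 =
  UU d + 3 * qq d * SS d * y.
Proof. by move=> H; rewrite /Pn /Pd /UU /qq /SS; rewrite /hyp in H; ring: H. Qed.

Lemma UU_norm d : UU d ^+ 2 - (3 * qq d * SS d) ^+ 2 * hyp d =
  qq d ^+ 3 * SS d ^+ 2 * (9 * d ^+ 2 - 7 * d - 1) ^+ 2.
Proof. by rewrite /UU /qq /SS /hyp; ring. Qed.

(** The relation c4^3 - c6^2 = 1728 disc, the discriminant of [tate d] being (d (d - 1))^6 hyp d. *)
Lemma c4c6 d : c6t d ^+ 2 + 1728 * (d * (d - 1)) ^+ 6 * hyp d = (qq d * SS d) ^+ 3.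
Proof. by rewrite /c6t /qq /SS /hyp; ring. Qed.

(** Expanded by [Hn_mul] and [Hd_mul] with the values of Hn and Hd assumed in [level7], this reads
    Hn d (d - 1) = y Hd on the product pair. *)
Lemma psi_law d y : y ^+ 2 = hyp d ->
  ((8 * y * (d * (d - 1)) ^+ 3 - c6t d) * Hn (Pn d y) (Pd d y)
   + 112 * y * (d * (d - 1)) ^+ 3 * Hd (Pn d y) (Pd d y)) * (d * (d - 1)) =
  y * ((8 * y * (d * (d - 1)) ^+ 3 - c6t d) * Hd (Pn d y) (Pd d y)
   - 16 * y * (d * (d - 1)) ^+ 3 * Hn (Pn d y) (Pd d y)
   - 16 * y * (d * (d - 1)) ^+ 3 * Hd (Pn d y) (Pd d y)).
Proof.
move=> H; rewrite /hyp in H; rewrite /Hn /Hd /Pn /Pd /c6t; ring: H.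
Qed.
End TwoTorsion.

Section LevelSevenPoint.
Variable F : fieldType.
Hypotheses (two : 2 != 0 :> F) (three : 3 != 0 :> F).
Hypotheses (no3 : forall k : F, k ^+ 2 + k + 1 != 0) (no85 : forall k : F, 9 * k ^+ 2 - 7 * k - 1 != 0).

(** If this norm of the pair vanished, [UU_norm] would annihilate [qq d] (excluded by [no3]), 9 d^2
    - 7 d - 1, of discriminant 85, or [SS d]. In the last case c4 = 0, so c6^2 = -3 (24 y (d (d -
    1))^3)^2 and -3 is a square. *)
Lemma Pnd_neq0 (d y : F) : y ^+ 2 = hyp d -> hyp d != 0 -> Pn d y ^+ 2 + Pn d y * Pd d y + Pd d y ^+ 2 != 0.
Proof.
move=> Hy H0; apply/eqP; rewrite Pnd_norm // => HU.
have y0 : y != 0 by apply: contraNneq H0 => y0; rewrite -Hy y0 expr0n.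
have X0 : d * (d - 1) != 0 by apply: contraNneq H0 => X0; rewrite /hyp X0 mul0r.
have := UU_norm d; rewrite -Hy.
have -> : UU d = - (3 * qq d * SS d * y) by rewrite -[LHS](addrK (3 * qq d * SS d * y)) HU sub0r.
have -> : (- (3 * qq d * SS d * y)) ^+ 2 - (3 * qq d * SS d) ^+ 2 * y ^+ 2 = 0 by ring.
move/esym/eqP; rewrite 2!mulf_eq0 !expf_eq0 /= (negbTE (no85 d)) orbF.
have -> /= : (qq d == 0) = false.
  by apply: negbTE; have := no3 (- d); congr (_ != 0); rewrite /qq; ring.
move/eqP=> S0; have := c4c6 d; rewrite S0 mulr0 expr0n /= -Hy => H6.
have n24 : 24 * y * (d * (d - 1)) ^+ 3 != 0.
  have -> : 24 = 2 * 2 * 2 * 3 :> F by ring.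
  by rewrite mulf_neq0 ?expf_neq0 // mulf_neq0 // !mulf_neq0.
case/eqP: (no3 ((c6t d / (24 * y * (d * (d - 1)) ^+ 3) - 1) / 2)).
have : (c6t d / (24 * y * (d * (d - 1)) ^+ 3)) ^+ 2 = -3.
  rewrite expr_div_n -[c6t d ^+ 2](addrK (1728 * (d * (d - 1)) ^+ 6 * y ^+ 2)) H6 sub0r.
  apply: (canLR (mulfK _)); first by rewrite expf_neq0.
  by ring.
move: (c6t d / _) => k Hk; have -> : 1 = 4 / 4 :> F by rewrite divff // (_ : 4 = 2 * 2) ?mulf_neq0 //; ring.
rewrite -[RHS](mul0r (4^-1)) -[0 in RHS](addrN (-3)) -{1}Hk; field.
by rewrite (_ : 4 = 2 * 2) ?mulf_neq0 //; ring.
Qed.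

(** u is the ratio of the product of the pair of differences with ([Pn], [Pd]). A zero denominator
    would force a zero numerator, but the norm a^2 + a b + b^2 is multiplicative and nonzero on both
    pairs. *)
Lemma level7 (d y e1 e2 e3 : F) : hyp d != 0 -> y ^+ 2 = hyp d -> e1 != e2 ->
  64 * Hn (e3 - e1) (e2 - e3) = 8 * y * (d * (d - 1)) ^+ 3 - c6t d ->
  64 * Hd (e3 - e1) (e2 - e3) = - 16 * y * (d * (d - 1)) ^+ 3 ->
  exists u, (u ^+ 3 + u ^+ 2 - 2 * u - 1) * (d * (d - 1)) = y * (u * (u + 1)).
Proof.
set a := e3 - e1; set b := e2 - e3 => H0 Hy ne HN HD.
have nab : a ^+ 2 + a * b + b ^+ 2 != 0.
  apply: contraNneq ne => /quad_eq0 - /(_ no3) [a0 b0].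
  have E12 : - (e1 - e2) = a + b by rewrite /a /b; ring.
  by rewrite -subr_eq0 -oppr_eq0 E12 a0 b0 addr0.
have nP := Pnd_neq0 Hy H0.
pose a' := a * Pn d y - b * Pd d y; pose b' := a * Pd d y + b * Pn d y + b * Pd d y.
have X0 : d * (d - 1) != 0 by apply: contraNneq H0 => X0; rewrite /hyp X0 mul0r.
have n64 : 64 != 0 :> F by rewrite (_ : 64 = 2 ^+ 6) ?expf_neq0 //; ring.
have L : Hn a' b' * (d * (d - 1)) = y * Hd a' b'.
  apply: (mulfI n64); rewrite /a' /b' Hn_mul Hd_mul.
  transitivity ((64 * Hn a b * Hn (Pn d y) (Pd d y) - 7 * (64 * Hd a b) * Hd (Pn d y) (Pd d y)) * (d * (d - 1))); first by ring.
  transitivity (y * (64 * Hn a b * Hd (Pn d y) (Pd d y) + Hn (Pn d y) (Pd d y) * (64 * Hd a b) + (64 * Hd a b) * Hd (Pn d y) (Pd d y))); last by ring.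
  rewrite HN HD; refine (etrans (etrans _ (psi_law Hy)) _); by ring.
have nab' : a' ^+ 2 + a' * b' + b' ^+ 2 != 0.
  rewrite (_ : _ + _ = (a ^+ 2 + a * b + b ^+ 2) * (Pn d y ^+ 2 + Pn d y * Pd d y + Pd d y ^+ 2)).
    by rewrite mulf_neq0.
  by rewrite /a' /b'; ring.
move: a' b' L nab' => a' b' L nab'.
have b0 : b' != 0.
  apply: contraNneq nab' => b0; move: L; rewrite /Hn /Hd b0 !(mulr0, mul0r, expr0n, addr0, subr0) /=.
  by move/eqP; rewrite mulf_eq0 (negbTE X0) orbF expf_eq0 /= => /eqP ->; rewrite expr0n.
exists (a' / b').
transitivity (Hn a' b' * (d * (d - 1)) / b' ^+ 3); first by rewrite /Hn; field; rewrite b0.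
by rewrite L /Hd; field; rewrite b0.
Qed.

(** y is 4 Pi / (d (d - 1))^3, where Pi is the product of the differences of the three 2-torsion
    abscissae and 16 Pi^2 the discriminant. Exchanging e and e' changes the sign of y, whence the
    second u. *)
Lemma tate_level7 (d e e' : F) : elliptic (tate d) -> e != e' -> psi2 (tate d) e = 0 -> psi2 (tate d) e' = 0 ->
  exists y, [/\ y ^+ 2 = hyp d, y != 0,
    exists u, (u ^+ 3 + u ^+ 2 - 2 * u - 1) * (d * (d - 1)) = y * (u * (u + 1)) &
    exists u, (u ^+ 3 + u ^+ 2 - 2 * u - 1) * (d * (d - 1)) = - y * (u * (u + 1))].
Proof.
move=> El ne r r'.
have [d0 d1 c0] : [/\ d != 0, d - 1 != 0 & d ^+ 3 - 8 * d ^+ 2 + 5 * d + 1 != 0].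
  move: El; rewrite /elliptic wdisc_tate 2!mulf_eq0 !expf_eq0 /= !negb_or.
  by case/andP=> /andP[].
have H0 : hyp d != 0 by rewrite /hyp !mulf_neq0.
have n4 : 4 != 0 :> F by rewrite (_ : 4 = 2 * 2) ?mulf_neq0 //; ring.
have X0 : d * (d - 1) != 0 by rewrite mulf_neq0.
pose b2 := (1 + d - d ^+ 2) ^+ 2 + 4 * (d ^+ 2 - d ^+ 3).
pose b4 := (1 + d - d ^+ 2) * (d ^+ 2 - d ^+ 3).
pose b6 := (d ^+ 2 - d ^+ 3) ^+ 2.
have P2 x : psi2 (tate d) x = 4 * x ^+ 3 + b2 * x ^+ 2 + 2 * b4 * x + b6 by rewrite /psi2 /b2 /b4 /b6 /=; ring.
rewrite !P2 in r r'.
pose f := - b2 / 4 - e - e'.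
have s1 : e + e' + f = - b2 / 4 by rewrite /f; ring.
have s2 : e * e' + e' * f + f * e = b4 / 2.
  have : (e - e') * (4 * (e ^+ 2 + e * e' + e' ^+ 2) + b2 * (e + e') + 2 * b4) = 0.
    by rewrite -[RHS](subrr 0) -{1}r -r'; ring.
  move/eqP; rewrite mulf_eq0 subr_eq0 (negbTE ne) /= => /eqP h.
  apply/eqP; rewrite -subr_eq0 -oppr_eq0; apply/eqP.
  rewrite -[RHS](mul0r 4^-1) -h /f; field; by rewrite two n4.
have s3 : e * e' * f = - b6 / 4.
  have -> : e * e' * f = e * (b4 / 2 - e * f) - e ^+ 2 * e' by rewrite -s2; ring.
  have -> : e' = - b2 / 4 - e - f by rewrite -s1; ring.
  apply/eqP; rewrite -subr_eq0; apply/eqP.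
  rewrite -[RHS](mul0r 4^-1) -r; field; by rewrite two n4.
pose Pi := (e - e') * (e' - f) * (f - e).
have PE : 16 * Pi ^+ 2 = (d * (d - 1)) ^+ 6 * hyp d.
  have -> : Pi ^+ 2 = (e + e' + f) ^+ 2 * (e * e' + e' * f + f * e) ^+ 2 - 4 * (e * e' + e' * f + f * e) ^+ 3
    - 4 * (e + e' + f) ^+ 3 * (e * e' * f) + 18 * (e + e' + f) * (e * e' + e' * f + f * e) * (e * e' * f)
    - 27 * (e * e' * f) ^+ 2 by rewrite /Pi; ring.
  by rewrite s1 s2 s3 /b2 /b4 /b6 /hyp; field; rewrite two n4.
have V6 : 32 * (2 * (e + e' + f) ^+ 3 - 9 * (e + e' + f) * (e * e' + e' * f + f * e) + 27 * (e * e' * f)) = c6t d.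
  by rewrite s1 s2 s3 /b2 /b4 /b6 /c6t; field; rewrite two n4.
have V6' : 32 * (2 * (e' + e + f) ^+ 3 - 9 * (e' + e + f) * (e' * e + e * f + f * e') + 27 * (e' * e * f)) = c6t d.
  by rewrite -V6; ring.
pose y := 4 * Pi / (d * (d - 1)) ^+ 3.
have yX : y * (d * (d - 1)) ^+ 3 = 4 * Pi by rewrite mulfVK ?expf_neq0.
clearbody y f.
have Hy : y ^+ 2 = hyp d.
  apply: (mulfI (expf_neq0 6 X0)); rewrite -PE.
  by transitivity ((y * (d * (d - 1)) ^+ 3) ^+ 2); [ring | rewrite yX; ring].
exists y; split=> //.
- by apply: contraNneq H0 => y0; rewrite -Hy y0 expr0n.
- apply: (@level7 d y e e' f) => //.
    by rewrite -!mulrA yX -V6 /Hn /Pi; ring.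
  by rewrite -!mulrA yX /Hd /Pi; ring.
- apply: (@level7 d (- y) e' e f) => //; first by rewrite sqrrN.
  - by rewrite eq_sym.
  - by rewrite -!mulrA !mulNr yX -V6' /Hn /Pi; ring.
  by rewrite -!mulrA !mulNr yX /Hd /Pi; ring.
Qed.
End LevelSevenPoint.

(** * The cubic field K *)

(** The exponent of 5 is even on one side and odd on the other. *)
Lemma nat_sq85 (m d : nat) : (0 < d -> m ^ 2 <> 5 * 17 * d ^ 2)%N.
Proof.
move=> d0 /(congr1 (logn 5)); rewrite lognM ?expn_gt0 ?d0 // lognM // !lognX.
by rewrite (_ : logn 5 5 = 1%N) // (_ : logn 5 17 = 0%N) //; lia.
Qed.

Lemma rat_sq85 (r : rat) : r ^+ 2 <> 85.
Proof.
move=> H.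
have E : numq r ^+ 2 = 5 * 17 * denq r ^+ 2.
  apply: (@intr_inj rat); transitivity ((numq r)%:~R ^+ 2 : rat); first by ring.
  by rewrite numqE exprMn H; ring.
apply: (@nat_sq85 `|numq r| `|denq r|); first by rewrite absz_gt0 denq_neq0.
by have := congr1 absz E; rewrite !expr2 !abszM -!mulnn.
Qed.

Section CubicField.
Variable K : fieldExtType rat.
Hypothesis dimK : \dim (fullv : {vspace K}) = 3%N.
Local Notation iota := (in_alg K).

Lemma in_alg_ratr (q : rat) : iota q = ratr q.
Proof. exact: fmorph_eq_rat. Qed.

Lemma charK (n : nat) : n.+1%:R != 0 :> K.
Proof. by rewrite -(rmorph_nat iota) fmorph_eq0 pnatr_eq0. Qed.

Lemma degree3 (x : K) : x \notin 1%VS -> adjoin_degree 1%AS x = 3%N.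
Proof.
move=> xn; have : (adjoin_degree 1%AS x %| 3)%N.
  by rewrite adjoin_degreeE dimv1 divn1 -dimK field_dimS ?subvf.
have := adjoin_deg_eq1 1%AS x; rewrite (negbTE xn).
by case: (adjoin_degree _ _) => [|[|[|[|?]]]] // _ /dvdn_leq.
Qed.

Lemma poly3 (a b c : rat) (x : K) : (map_poly iota (Poly [:: a; b; c])).[x] = iota a + iota b * x + iota c * x ^+ 2.
Proof.
rewrite map_Poly_id0 ?rmorph0 // horner_Poly /=; ring.
Qed.

Lemma lin_indep (x : K) (a b c : rat) : x \notin 1%VS ->
  iota a + iota b * x + iota c * x ^+ 2 = 0 -> [/\ a = 0, b = 0 & c = 0].
Proof.
move=> xn H; pose p : {poly rat} := Poly [:: a; b; c].
have Hd : minPoly 1%AS x %| map_poly iota p.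
  apply: minPoly_dvdp; first by apply/polyOver1P; exists p.
  by rewrite /root poly3 H.
suff p0 : p = 0.
  have E i : [:: a; b; c]`_i = 0 by rewrite -coef_Poly -/p p0 coef0.
  by split; [exact: (E 0%N)|exact: (E 1%N)|exact: (E 2%N)].
apply/eqP; rewrite -(map_poly_eq0 iota); apply: contraTT Hd => p0.
apply: contraL (size_Poly [:: a; b; c]) => /dvdp_leq - /(_ p0).
by rewrite size_minPoly degree3 // size_map_poly -ltnNge.
Qed.

Lemma span3 (x y : K) : x \notin 1%VS -> exists a b c : rat, y = iota a + iota b * x + iota c * x ^+ 2.
Proof.
move=> xn; have : y \in <<1; x>>%VS.
  suff -> : <<1; x>>%VS = fullv :> {vspace K} by rewrite memvf.
  by apply/eqP; rewrite eqEdim subvf dimK dim_Fadjoin dimv1 degree3.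
move/Fadjoin_poly_eq <-; have := Fadjoin_polyOver 1%AS x y; have := size_Fadjoin_poly 1%AS x y.
rewrite degree3 //; move: (Fadjoin_poly _ _ _) => q sz /polyOver1P[p Ep].
exists p`_0, p`_1, p`_2; rewrite -poly3 Ep; congr (map_poly _ _).[_].
move: sz; rewrite Ep size_map_poly => sz.
apply/polyP => i; rewrite coef_Poly; case: i => [|[|[|i]]] //=.
by rewrite nth_nil nth_default // (leq_trans sz).
Qed.

(** A field of degree 3 has no quadratic subfield. *)
Lemma sqrt_rat (x : K) (q : rat) : x ^+ 2 = iota q -> exists r, x = iota r.
Proof.
move=> H; have [/vlineP[r ->]|xn] := boolP (x \in 1%VS); first by exists r.
have [|_ _ /eqP] := @lin_indep x (- q) 0 1 xn; last by rewrite oner_eq0.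
by rewrite H rmorphN rmorph0 rmorph1 mul0r mul1r addr0 addNr.
Qed.

Lemma sqrt_rat2 (x : K) (q : rat) : x ^+ 2 = iota q -> exists r, x = iota r /\ r ^+ 2 = q.
Proof.
move=> H; have [r Hr] := sqrt_rat H; exists r; split=> //.
by apply: (fmorph_inj iota); rewrite rmorphXn; move: H; rewrite Hr.
Qed.

Lemma no3K (k : K) : k ^+ 2 + k + 1 != 0.
Proof.
apply/eqP => H; have : (2 * k + 1) ^+ 2 = iota (-3).
  have -> : iota (-3) = -3 by rewrite rmorphN rmorph_nat.
  rewrite -[RHS]addr0 -[0 in RHS](mulr0 4) -H; ring.
case/sqrt_rat2 => r [_ h]; have := sqr_ge0 r; rewrite h; lra.
Qed.

Lemma no85K (k : K) : 9 * k ^+ 2 - 7 * k - 1 != 0.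
Proof.
apply/eqP => H; have : (18 * k - 7) ^+ 2 = iota 85.
  rewrite rmorph_nat -[RHS]addr0 -[0 in RHS](mulr0 36) -H; ring.
by case/sqrt_rat2 => r [_ /rat_sq85].
Qed.
End CubicField.

(** * Norms to Q(om) and the cube test *)

Lemma quad_rat (a b : rat) : a ^+ 2 - a * b + b ^+ 2 = 0 -> a = 0 /\ b = 0.
Proof.
move=> H; have a0 : a = 0.
  apply/eqP; rewrite -sqrf_eq0 eq_le sqr_ge0 andbT.
  have := sqr_ge0 (2 * b - a); have -> : (2 * b - a) ^+ 2 = - (3 * a ^+ 2) by rewrite -[LHS]subr0 -(mulr0 4) -H; ring.
  lra.
by split=> //; move: H; rewrite a0 expr0n mul0r !sub0r oppr0 add0r => /eqP; rewrite sqrf_eq0 => /eqP.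
Qed.

Section LevelMap.
Variables c0 c1 c2 : rat.
Local Notation TQ := (cub c0 c1 c2).
Local Notation TC := (cub (ratr c0 : algC) (ratr c1) (ratr c2)).

(** Extension of scalars from Q to [algC]; on coordinates in Q(om), [cub_norm] is the norm from
    K(om) to Q(om). *)
Definition lift (a : TQ) : TC := let: (a0, a1, a2) := a in (ratr a0, ratr a1, ratr a2).

Fact lift_is_zmod : zmod_morphism lift.
Proof. by case=> [[x0 x1] x2] [[y0 y1] y2]; congr (_, _, _); rewrite /= rmorphB. Qed.
Fact lift_is_monoid : monoid_morphism lift.
Proof.
split; first by congr (_, _, _); rewrite ?rmorph1 ?rmorph0.
by case=> [[x0 x1] x2] [[y0 y1] y2]; congr (_, _, _); rewrite /=; ring.
Qed.
HB.instance Definition _ := GRing.isZmodMorphism.Build TQ TC lift lift_is_zmod.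
HB.instance Definition _ := GRing.isMonoidMorphism.Build TQ TC lift lift_is_monoid.

Lemma lift_norm a : cub_norm (lift a) = ratr (cub_norm a).
Proof. by case: a => [[a0 a1] a2]; rewrite /cub_norm /=; ring. Qed.

Variable om : algC.
Hypothesis Hom : om ^+ 2 = - om - 1.

Definition inW (x : algC) := exists a b : rat, x = ratr a + ratr b * om.

Lemma inW_rat q : inW (ratr q).
Proof. by exists q, 0; rewrite rmorph0 mul0r addr0. Qed.
Lemma inW_0 : inW 0.
Proof. by exists 0, 0; rewrite rmorph0 mul0r addr0. Qed.
Lemma inWD x y : inW x -> inW y -> inW (x + y).
Proof. by move=> [a [b ->]] [c [e ->]]; exists (a + c), (b + e); ring. Qed.
Lemma inWM x y : inW x -> inW y -> inW (x * y).
Proof. by move=> [a [b ->]] [c [e ->]]; exists (a * c - b * e), (a * e + b * c - b * e); ring: Hom. Qed.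
Lemma inWN x : inW x -> inW (- x).
Proof. by move=> [a [b ->]]; exists (- a), (- b); ring. Qed.
Lemma inW_om : inW om.
Proof. by exists 0, 1; rewrite rmorph0 rmorph1 add0r mul1r. Qed.
Lemma omNrat (a b : rat) : ratr a + ratr b * om = 0 -> a = 0 /\ b = 0.
Proof.
move=> H; have h : a ^+ 2 - a * b + b ^+ 2 = 0.
  apply: (fmorph_inj (ratr : rat -> algC)); rewrite rmorph0.
  transitivity ((ratr a + ratr b * om) * (ratr a - ratr b - ratr b * om)); last by rewrite H mul0r.
  by ring: Hom.
exact: quad_rat.
Qed.
Lemma inWV x : inW x -> inW x^-1.
Proof.
move=> [a [b ->]]; have [/eqP ab|ab] := boolP (a ^+ 2 - a * b + b ^+ 2 == 0).
  have [-> ->] : a = 0 /\ b = 0 by apply: quad_rat.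
  by rewrite rmorph0 mul0r addr0 invr0; exists 0, 0; rewrite rmorph0 mul0r addr0.
exists ((a - b) / (a ^+ 2 - a * b + b ^+ 2)), (- b / (a ^+ 2 - a * b + b ^+ 2)).
have n : ratr a + ratr b * om != 0.
  by apply: contra ab => /eqP/omNrat [-> ->]; apply/eqP; ring.
have n' : ratr (a ^+ 2 - a * b + b ^+ 2) != 0 :> algC by rewrite fmorph_eq0.
apply: (mulfI n); rewrite divff // !fmorph_div /=.
apply: (mulfI n'); rewrite mulr1.
transitivity ((ratr a + ratr b * om) * (ratr (a - b) + ratr (- b) * om)).
  by ring: Hom.
by move: (ratr (a ^+ 2 - _ + _)) n' => D n'; field.
Qed.

(* 1 + 3 om is not a rational number times a cube *)
Lemma inW_cube (x : algC) (q : rat) : inW x -> (1 + 3 * om) * x ^+ 3 = ratr q -> x = 0.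
Proof.
move=> [a [b ->]] H.
(* Three times this form is the om-coefficient of (1 + 3 om) (a + b om)^3. It is also the norm of (a
   - b) - b w from Q(w), so its only rational zero is trivial. *)
have h : a ^+ 3 - 2 * a ^+ 2 * b - a * b ^+ 2 + b ^+ 3 = 0.
  have : ratr (a^+3 - 9*a^+2*b + 6*a*b^+2 + b^+3 - q) + ratr (3*(a ^+ 3 - 2 * a ^+ 2 * b - a * b ^+ 2 + b ^+ 3)) * om = 0.
    apply/eqP; rewrite -subr_eq0; apply/eqP.
    rewrite -[RHS](subrr (ratr q)) -{1}H; ring: Hom.
  by move/omNrat => -[_] /eqP; rewrite mulf_eq0 => /orP[//|/eqP].
pose n := denq a * denq b; have n0 : n != 0 by rewrite mulf_neq0 ?denq_neq0.
have nq : n%:~R != 0 :> rat by rewrite intr_eq0.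
pose A := numq a * denq b; pose B := numq b * denq a.
have AE : A%:~R = a * n%:~R by rewrite /A /n !rmorphM /= numqE; ring.
have BE : B%:~R = b * n%:~R by rewrite /B /n !rmorphM /= numqE; ring.
have : N (A - B, - B, 0) = 0.
  apply: (@intr_inj rat); rewrite -[RHS](mul0r (n%:~R ^+ 3)) -h.
  transitivity ((A%:~R : rat) ^+ 3 - 2 * A%:~R ^+ 2 * B%:~R - A%:~R * B%:~R ^+ 2 + B%:~R ^+ 3).
    by rewrite /cub_norm /=; ring.
  by rewrite AE BE; ring.
move/normO_eq0 => -[/eqP]; rewrite subr_eq0 => /eqP AB /eqP; rewrite oppr_eq0 => /eqP B0.
have b0 : b = 0 by apply: (mulIf nq); rewrite -BE B0 mul0r.
have a0 : a = 0 by apply: (mulIf nq); rewrite -AE AB B0 mul0r.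
by rewrite a0 b0 rmorph0 mul0r addr0.
Qed.

Let al := 1 + 3 * om.

(* norms to Q(om) in (u - om)^3 X = u (u + 1) (y - al X), X = d (d - 1) *)
Lemma no_level7 (u y : TQ) (kp rho : rat) (e B : algC) :
  (u ^+ 3 + u ^+ 2 - 2 * u - 1) * (0, -1, 1) = y * (u * (u + 1)) ->
  cub_norm (u ^+ 2 + u + 1) != 0 -> cub_norm ((0, -1, 1) : TQ) != 0 -> kp != 0 -> inW e -> e != 0 -> inW B ->
  cub_norm (lift y - (0, - al, al) : TC) * ratr kp * al * e ^+ 3 = ratr rho * B ^+ 3 -> False.
Proof.
move=> Hu N1 NX k0 We e0 WB H.
pose v := lift u; pose w1 : TC := (om, 0, 0).
have w12 : w1 ^+ 2 = - w1 - 1.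
  by congr (_, _, _) => /=; rewrite ?(mulr0, mul0r, addr0, oppr0, subr0) //; rewrite -?expr2 ?Hom; ring.
pose X : TC := (0, -1, 1).
have lX : lift (0, -1, 1) = X by congr (_, _, _); rewrite ?rmorphN ?rmorph0 ?rmorph1.
have EX : (0, - al, al) = (1 + 3 * w1) * X.
  by congr (_, _, _) => /=; rewrite ?(mulr0, mul0r, addr0, oppr0, subr0) /al; ring.
rewrite EX in H.
have Hv : (v - w1) ^+ 3 * X = v * (v + 1) * (lift y - (1 + 3 * w1) * X).
  have Hl : (v ^+ 3 + v ^+ 2 - 2 * v - 1) * X = lift y * (v * (v + 1)).
    by transitivity (lift ((u ^+ 3 + u ^+ 2 - 2 * u - 1) * (0, -1, 1))); [rewrite rmorphM; congr (_ * _); last exact: esym lX|rewrite Hu]; rewrite /v; ring.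
  rewrite mulrBr [v * (v + 1) * lift y]mulrC -Hl; ring: w12.
pose A := cub_norm (v - w1).
have WA : inW A.
  rewrite /A /v /w1; case: (u) => [[u0 u1] u2]; rewrite /cub_norm /=.
  by do ![exact: inW_rat | exact: inW_om | exact: inW_0 | apply: inWD | apply: inWN | apply: inWM].
(* (u - om) (u + 1 + om) = u^2 + u + 1. *)
have A0 : A != 0.
  have : A * cub_norm (v + 1 + w1) = ratr (cub_norm (u ^+ 2 + u + 1)).
    rewrite -lift_norm -cub_normM; congr cub_norm.
    transitivity (v ^+ 2 + v + 1); last by rewrite /v; ring.
    by ring: w12.
  move=> E; apply: contraNneq N1 => A0; by move/esym/eqP: E; rewrite A0 mul0r fmorph_eq0.
have HN : A ^+ 3 * ratr (cub_norm ((0, -1, 1) : TQ)) = ratr (cub_norm (u * (u + 1))) * cub_norm (lift y - (1 + 3 * w1) * X).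
  rewrite -!lift_norm lX -cub_normM; have := congr1 (@cub_norm _ _ _ _) Hv.
  rewrite cub_normM (_ : (v - w1) ^+ 3 = (v - w1) * (v - w1) * (v - w1)) //; last by ring.
  rewrite !cub_normM => E; rewrite -/A in E.
  transitivity (A * A * A * cub_norm X); first by ring.
  by rewrite E -cub_normM; congr (cub_norm _ * _); rewrite rmorphM rmorphD rmorph1.
move: (cub_norm (lift y - _)) H HN => n2 H HN.
have NX' : ratr (cub_norm ((0, -1, 1) : TQ)) != 0 :> algC by rewrite fmorph_eq0.
have n20 : n2 != 0.
  by apply: contraTneq (mulf_neq0 (expf_neq0 3 A0) NX') => n0; rewrite HN n0 mulr0 eqxx.
have al0 : al != 0.
  apply/eqP => al0; have [|/eqP] := @omNrat 1 3; last by rewrite oner_eq0.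
  by rewrite rmorph1 rmorph_nat.
have k0' : ratr kp != 0 :> algC by rewrite fmorph_eq0.
have B0 : B != 0.
  apply: contraTneq (mulf_neq0 (mulf_neq0 (mulf_neq0 n20 k0') al0) (expf_neq0 3 e0)) => B0.
  by rewrite H B0 expr0n mulr0 eqxx.
(* The two norm relations make al (e A / B)^3 rational, against [inW_cube]. *)
have z0 : e * A / B != 0 by rewrite !mulf_neq0 ?invr_eq0.
have WZ : inW (e * A / B) by apply: inWM (inWV WB); apply: inWM.
case/eqP: z0.
apply: (@inW_cube _ (cub_norm (u * (u + 1)) * rho / (cub_norm ((0, -1, 1) : TQ) * kp)) WZ).
move: (cub_norm (u * (u + 1))) HN => rU HN.
move: (cub_norm _) NX' HN {NX} => rX NX' HN.
rewrite fmorph_div !rmorphM /= -/al.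
apply: (mulIf (mulf_neq0 NX' k0')); rewrite divfK; last exact: mulf_neq0 NX' k0'.
apply: (mulIf (expf_neq0 3 B0)).
transitivity (A ^+ 3 * ratr rX * (ratr kp * al * e ^+ 3)).
  by field.
rewrite HN; transitivity (ratr rU * (n2 * ratr kp * al * e ^+ 3)); first by ring.
by rewrite H; ring.
Qed.
End LevelMap.

(* [sg1], [sg2], [sg3] are the elementary symmetric functions of the roots of the
   minimal polynomial of d, read off hyp - g^2 = m (T^2 - S T + M) with
   g = z (T^2 - S T + M) + s1 T + s0. *)
Section Resultant.
Variables (z om : algC).
Hypothesis Hom : om ^+ 2 = - om - 1.
Definition sg1 (R : comNzRingType) (S z : R) := 9 - S + z ^+ 2.
Definition sg2 (R : comNzRingType) (S M s1 z : R) := 13 - 2 * (s1 - z * S) * z - M - S * sg1 S z.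
Definition sg3 (R : comNzRingType) (S M s0 s1 z : R) := 4 + 2 * (s0 + z * M) * z + (s1 - z * S) ^+ 2 - S * sg2 S M s1 z - M * sg1 S z.
(** Write al = 1 + 3 om, X = T (T - 1), f = g - al X. Modulo f, m r = hyp - g^2 is hyp - al^2 X^2 =
    X (T + om)^3, so Res(m, f) Res(r, f) = f(0) f(1) f(-om)^3. The factor kp al e^3 is Res(r, f); it
    only involves r and g modulo r, not z. *)
Definition resid (S M s0 s1 kp e : algC) :=
  @cub_norm algC (sg3 S M s0 s1 z) (- sg2 S M s1 z) (sg1 S z)
    (s0 + z * M, s1 - z * S + (1 + 3 * om), z - (1 + 3 * om)) * kp * (1 + 3 * om) * e ^+ 3 =
  (s0 + z * M) * (s0 + z * M + (s1 - z * S) + z) * (s0 + z * M - (s1 - z * S) * om + z * om ^+ 2 + (1 + 3 * om)) ^+ 3.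
Lemma resid1 : resid 1 1 1 (-3) (-2) 1.
Proof. rewrite /resid /cub_norm /= /sg3 /sg2 /sg1; ring: Hom. Qed.
Lemma resid3 : resid 11 9 15 (-17) 6 (1 + 2 * om).
Proof. rewrite /resid /cub_norm /= /sg3 /sg2 /sg1; ring: Hom. Qed.
Lemma resid4 : resid 9 (-1) 1 11 (-6) (1 + 2 * om).
Proof. rewrite /resid /cub_norm /= /sg3 /sg2 /sg1; ring: Hom. Qed.
Lemma resid2 : resid (7 / 9) (- (1 / 9)) (5 / 27) (- (1 / 27)) (2 / 243) (1 + 2 * om).
Proof. rewrite /resid /cub_norm /= /sg3 /sg2 /sg1; by field: Hom; rewrite ?pnatr_eq0. Qed.
End Resultant.

(** [classify] applied to x and the branch point 0, joined by the line of slope y / x: here M = 0,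
    which leaves S = x = 1, another branch point. *)
Lemma rat_hyp (x y : rat) : y ^+ 2 = hyp x -> y = 0.
Proof.
move=> H; apply/eqP; apply/contraT => y0.
have x0 : x != 0 by apply: contraNneq y0 => x0; rewrite -sqrf_eq0 H x0 /hyp; apply/eqP; ring.
have HS : 0 + ratr x = ratr x :> algC by rewrite add0r.
have HM : 0 * ratr x = ratr 0 :> algC by rewrite mul0r rmorph0.
have Hne : 0 != ratr x :> algC by rewrite eq_sym fmorph_eq0.
have H1 : (ratr 0 + ratr (y / x) * 0) ^+ 2 = hyp (0 : algC) by rewrite /hyp rmorph0; ring.
have H2 : (ratr 0 + ratr (y / x) * ratr x) ^+ 2 = hyp (ratr x : algC).
  by rewrite rmorph0 add0r -rmorphM /= divfK // -rmorphXn /= H /hyp; ring.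
case: (classify HS HM Hne H1 H2) => [[_ /eqP]|[[x1 _]|[_ h]|[_ h]|[_ h]]].
- by rewrite eq_sym oner_eq0.
- by move: H y0; rewrite x1 /hyp subrr mulr0 mul0r => /eqP; rewrite sqrf_eq0 => ->.
- by move: h; clear; lra.
- by move: h; clear; lra.
- by move: h; clear; lra.
Qed.

(** * Square roots of [hyp] modulo the five quadratics *)

Lemma sqr_pm (x y : rat) : x ^+ 2 = y ^+ 2 -> x = y \/ x = - y.
Proof. by move/eqP; rewrite eqf_sqr => /orP[/eqP|/eqP]; [left|right]. Qed.

Lemma residue_eq (S M A B s0 s1 : rat) : s0 ^+ 2 - M * s1 ^+ 2 = A -> 2 * s0 * s1 + S * s1 ^+ 2 = B ->
  (S ^+ 2 - 4 * M) * (s1 ^+ 2) ^+ 2 - (2 * B * S + 4 * A) * s1 ^+ 2 + B ^+ 2 = 0.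
Proof. by move=> <- <-; ring. Qed.

(** [residue_eq] is quadratic in s1^2 and has the known root t1^2. The last hypothesis excludes the
    other root; it is obtained below from a discriminant S^2 - 4 M that is not a square. *)
Lemma residue_sol (S M s0 s1 t0 t1 : rat) : t1 != 0 ->
  s0 ^+ 2 - M * s1 ^+ 2 = t0 ^+ 2 - M * t1 ^+ 2 -> 2 * s0 * s1 + S * s1 ^+ 2 = 2 * t0 * t1 + S * t1 ^+ 2 ->
  (forall x : rat, (S ^+ 2 - 4 * M) * x ^+ 2 <> (2 * t0 + S * t1) ^+ 2) ->
  (s0 = t0 /\ s1 = t1) \/ (s0 = - t0 /\ s1 = - t1).
Proof.
move=> t10 HA HB Hx; have := residue_eq HA HB.
have -> : (S ^+ 2 - 4 * M) * (s1 ^+ 2) ^+ 2 - (2 * (2 * t0 * t1 + S * t1 ^+ 2) * S + 4 * (t0 ^+ 2 - M * t1 ^+ 2)) * s1 ^+ 2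
    + (2 * t0 * t1 + S * t1 ^+ 2) ^+ 2 = (s1 ^+ 2 - t1 ^+ 2) * ((S ^+ 2 - 4 * M) * s1 ^+ 2 - (2 * t0 + S * t1) ^+ 2) by ring.
move/eqP; rewrite mulf_eq0 !subr_eq0 => /orP[/eqP|/eqP/Hx//].
case/sqr_pm => E; move: HB; rewrite E; [move=> H; left|move=> H; right]; split=> //.
  by apply: (mulfI t10); apply: (mulfI (_ : 2 != 0 :> rat)) => //; move: H; clear; lra.
by apply: (mulfI t10); apply: (mulfI (_ : 2 != 0 :> rat)) => //; move: H; clear; lra.
Qed.

Lemma no_sq85 (a b x : rat) : b != 0 -> 85 * a ^+ 2 * x ^+ 2 <> b ^+ 2.
Proof.
move=> b0 H; apply: (@rat_sq85 (85 * a * x / b)).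
transitivity (85 * (85 * a ^+ 2 * x ^+ 2) / b ^+ 2); first by field.
by rewrite H mulfK; [reflexivity | exact: expf_neq0].
Qed.

Lemma hyp_squarefree (x : rat) : hyp x = 0 -> 5 * x ^+ 4 - 36 * x ^+ 3 + 39 * x ^+ 2 - 8 * x - 1 = 0 -> False.
Proof.
move=> Hf Hf'.
have : x * (x - 1) * (x ^+ 3 - 8 * x ^+ 2 + 5 * x + 1) == 0 by rewrite -/(hyp x) Hf.
rewrite mulf_eq0 mulf_eq0 => /orP[/orP[/eqP x0|]|/eqP c_0].
- by move: Hf'; rewrite x0; clear; lra.
- by rewrite subr_eq0 => /eqP x1; move: Hf'; rewrite x1; clear; lra.
have c'0 : x * (x - 1) * (3 * x ^+ 2 - 16 * x + 5) = 0.
  by rewrite -[RHS]Hf' -[RHS]subr0 -(mulr0 (2 * x - 1)) -c_0; ring.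
have : x * (x - 1) * 49 = 0.
  transitivity (x * (x - 1) * (29 - 6 * x) * (x ^+ 3 - 8 * x ^+ 2 + 5 * x + 1) + (4 - 15 * x + 2 * x ^+ 2) * (x * (x - 1) * (3 * x ^+ 2 - 16 * x + 5))).
    by ring.
  by rewrite c_0 c'0 !mulr0 addr0.
move/eqP; rewrite !mulf_eq0 orbF => /orP[/eqP x0|]; first by move: c_0; rewrite x0; clear; lra.
by rewrite subr_eq0 => /eqP x1; move: c_0; rewrite x1; clear; lra.
Qed.

Lemma quarter (a b : rat) : a - 4 * b = 0 -> b = a / 4.
Proof. lra. Qed.

(** [hyp] is congruent to resB T + resA modulo T^2 - S T + M. *)
Definition resA (S M : rat) := - (S ^+ 3 * M - 2 * S * M ^+ 2) + 9 * (S ^+ 2 * M - M ^+ 2) - 13 * S * M + 4 * M.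
Definition resB (S M : rat) :=
  (S ^+ 4 - 3 * S ^+ 2 * M + M ^+ 2) - 9 * (S ^+ 3 - 2 * S * M) + 13 * (S ^+ 2 - M) - 4 * S - 1.

Definition residue_of (S M t0 t1 : rat) := forall s0 s1,
  s0 ^+ 2 - M * s1 ^+ 2 = resA S M -> 2 * s0 * s1 + S * s1 ^+ 2 = resB S M ->
  (s0 = t0 /\ s1 = t1) \/ (s0 = - t0 /\ s1 = - t1).

Lemma residue_ofI (S M t0 t1 : rat) : t1 != 0 -> t0 ^+ 2 - M * t1 ^+ 2 = resA S M ->
  2 * t0 * t1 + S * t1 ^+ 2 = resB S M ->
  (forall x : rat, (S ^+ 2 - 4 * M) * x ^+ 2 <> (2 * t0 + S * t1) ^+ 2) -> residue_of S M t0 t1.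
Proof. by move=> t10 EA EB Hx s0 s1; rewrite -EA -EB => HA HB; apply: residue_sol Hx. Qed.

Lemma natdiv_neq0 (m n : nat) : m != 0%N -> n != 0%N -> m%:R / n%:R != 0 :> rat.
Proof. by move=> m0 n0; rewrite mulf_neq0 // ?invr_eq0 pnatr_eq0. Qed.

Lemma residue_of85 (S M t0 t1 a b : rat) : t1 != 0 -> t0 ^+ 2 - M * t1 ^+ 2 = resA S M ->
  2 * t0 * t1 + S * t1 ^+ 2 = resB S M -> S ^+ 2 - 4 * M = 85 * a ^+ 2 -> 2 * t0 + S * t1 = b -> b != 0 ->
  residue_of S M t0 t1.
Proof. by move=> t10 EA EB Ea Eb b0; apply: residue_ofI t10 EA EB _ => x; rewrite Ea Eb; exact: no_sq85. Qed.

Lemma residue1 : residue_of 1 1 1 (-3).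
Proof.
apply: residue_ofI; [by []|by rewrite /resA; ring|by rewrite /resB; ring|move=> x].
have -> : (1 ^+ 2 - 4 * 1) * x ^+ 2 = - (3 * x ^+ 2) by ring.
have -> : (2 * 1 + 1 * -3) ^+ 2 = 1 :> rat by ring.
by have := sqr_ge0 x; lra.
Qed.

Lemma residue2 : residue_of (7 / 9) (- (1 / 9)) (5 / 27) (- (1 / 27)).
Proof.
apply: (@residue_of85 (7 / 9) (- (1 / 9)) (5 / 27) (- (1 / 27)) (1 / 9) (83 / 243)).
- by rewrite oppr_eq0 mul1r invr_eq0 pnatr_eq0.
- by rewrite /resA; field; rewrite ?pnatr_eq0.
- by rewrite /resB; field; rewrite ?pnatr_eq0.
- by field; rewrite ?pnatr_eq0.
- by field; rewrite ?pnatr_eq0.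
- exact: (@natdiv_neq0 83 243).
Qed.

Lemma residue3 : residue_of 11 9 15 (-17).
Proof.
apply: (@residue_of85 11 9 15 (-17) 1 (-157)).
- by rewrite oppr_eq0 pnatr_eq0.
- by rewrite /resA; ring.
- by rewrite /resB; ring.
- by ring.
- by ring.
- by rewrite oppr_eq0 pnatr_eq0.
Qed.

Lemma residue4 : residue_of 9 (-1) 1 11.
Proof.
apply: (@residue_of85 9 (-1) 1 11 1 101).
- by rewrite pnatr_eq0.
- by rewrite /resA; ring.
- by rewrite /resB; ring.
- by ring.
- by ring.
- by rewrite pnatr_eq0.
Qed.

(** T (T - 1) divides [hyp], so the remainder is 0 and g is a multiple of r. *)
Lemma residue5 (s0 s1 : rat) : s0 ^+ 2 - 0 * s1 ^+ 2 = resA 1 0 -> 2 * s0 * s1 + 1 * s1 ^+ 2 = resB 1 0 -> s0 = 0 /\ s1 = 0.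
Proof.
have -> : resA 1 0 = 0 by rewrite /resA; ring.
have -> : resB 1 0 = 0 by rewrite /resB; ring.
rewrite mul0r subr0 => /eqP; rewrite sqrf_eq0 => /eqP ->.
by rewrite mulr0 mul0r mul1r add0r => /eqP; rewrite sqrf_eq0 => /eqP ->.
Qed.

(** * Coordinates of y in the powers of d *)

Section Main.
Variable K : fieldExtType rat.
Hypothesis dimK : \dim (fullv : {vspace K}) = 3%N.
Local Notation iota := (in_alg K).

Section Coordinates.
Variables (c0 c1 c2 : rat) (d : K).
Hypotheses (dn : d \notin 1%VS) (d3 : d ^+ 3 = iota c0 + iota c1 * d + iota c2 * d ^+ 2).
Local Notation TQ := (cub c0 c1 c2).
Local Arguments GRing.in_alg : simpl never.
Definition coord (a : TQ) : K := let: (a0, a1, a2) := a in iota a0 + iota a1 * d + iota a2 * d ^+ 2.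
Fact coord_is_zmod : zmod_morphism coord.
Proof. by case=> [[x0 x1] x2] [[y0 y1] y2]; rewrite /coord /=; ring. Qed.
Fact coord_is_monoid : monoid_morphism coord.
Proof.
split; first by rewrite /coord /= !(rmorph0, rmorph1) !mul0r !addr0.
by case=> [[x0 x1] x2] [[y0 y1] y2]; rewrite /coord /=; ring: d3.
Qed.
HB.instance Definition _ := GRing.isZmodMorphism.Build TQ K coord coord_is_zmod.
HB.instance Definition _ := GRing.isMonoidMorphism.Build TQ K coord coord_is_monoid.

Lemma coord_inj : injective coord.
Proof.
move=> a b /eqP; rewrite -subr_eq0 -rmorphB => /eqP H; apply/eqP; rewrite -subr_eq0.
by case: (a - b) H => [[x0 x1] x2] /(lin_indep dimK dn) [-> -> ->].
Qed.
Lemma coord_surj x : exists a, coord a = x.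
Proof. by have [a0 [a1 [a2 ->]]] := span3 dimK x dn; exists (a0, a1, a2). Qed.
Lemma cub_norm_neq0 (a : TQ) : coord a != 0 -> cub_norm a != 0.
Proof.
move=> a0; have [b Hb] := coord_surj (coord a)^-1.
have ab : a * b = 1.
  apply: coord_inj; transitivity (coord a * coord b); first exact: (rmorphM coord).
  by rewrite Hb divff //; symmetry; exact: (rmorph1 coord).
apply/eqP => N0; have := cub_normM a b; rewrite ab cub_norm1 N0 mul0r => /eqP.
by rewrite oner_eq0.
Qed.

Section Equations.
Variables g0 g1 z : rat.
Hypothesis Hg : coord (g0, g1, z) ^+ 2 = hyp d.
Let S := 9 + z ^+ 2 - c2.
Let M := 13 - 2 * g1 * z + c1 - S * c2.
Let s0 := g0 - z * M.
Let s1 := g1 + z * S.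

Lemma hyp_coord : ((g0, g1, z) : TQ) ^+ 2 = hyp ((0, 1, 0) : TQ).
Proof.
apply: coord_inj.
transitivity (coord (g0, g1, z) ^+ 2); first exact: (rmorphXn coord).
rewrite Hg.
have E : coord (0, 1, 0) = d by rewrite /coord rmorph0 rmorph1 mul0r add0r mul1r addr0.
transitivity (hyp (coord (0, 1, 0))); first by rewrite E.
rewrite /hyp; move: ((0, 1, 0) : TQ) => t; ring.
Qed.

(** Coefficients of T^2, T and 1 in hyp - g^2 = m (T^2 - S T + M); those of T^4 and T^3 define [S]
    and [M]. *)
Lemma coef_eqs : [/\ c0 = 4 + 2 * g0 * z + g1 ^+ 2 + S * c1 - M * c2,
   - (1 + 2 * g0 * g1) = - M * c1 + S * c0 & g0 ^+ 2 = M * c0].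
Proof.
have := hyp_coord; rewrite /hyp => -[H0 H1 H2].
split.
- move/eqP: H2; rewrite eq_sym -subr_eq0 => /eqP H2.
  by rewrite -[RHS]addr0 -H2 /M /S; ring.
- move/eqP: H1; rewrite eq_sym -subr_eq0 => /eqP H1.
  by rewrite -[RHS]addr0 -H1 /M /S; ring.
- move/eqP: H0; rewrite eq_sym -subr_eq0 => /eqP H0.
  by rewrite -[LHS]addr0 -H0 /M /S; ring.
Qed.

Lemma coef_eq2 : 4 + 2 * g0 * z + g1 ^+ 2 = c0 - S * c1 + M * c2.
Proof. by have [E2 _ _] := coef_eqs; rewrite [in RHS]E2; move: (S) (M) => S' M'; ring. Qed.

(** A double root x of r is rational, so g(x) = 0 by [rat_hyp]. Then hyp = m r + g^2 has a double
    zero at x, but [hyp] is squarefree. *)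
Lemma discr_neq0 : S ^+ 2 - 4 * M != 0.
Proof.
apply/eqP => HD; have [_ E1 E0] := coef_eqs; have E2 := coef_eq2.
pose x := S / 2.
have r0 : x ^+ 2 - S * x + M = 0.
  have -> : M = S ^+ 2 / 4 by exact: quarter.
  by rewrite /x; move: (S) => a; field.
have r1 : 2 * x - S = 0 by rewrite /x; move: (S) => a; field.
pose g := g0 + g1 * x + z * x ^+ 2.
have Hf : hyp x - g ^+ 2 = 0.
  transitivity ((x ^+ 3 - c2 * x ^+ 2 - c1 * x - c0) * (x ^+ 2 - S * x + M)); last by rewrite r0 mulr0.
  transitivity (x ^+ 5 - (9 + z ^+ 2) * x ^+ 4 + (13 - 2 * g1 * z) * x ^+ 3 - (4 + 2 * g0 * z + g1 ^+ 2) * x ^+ 2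
     + (- (1 + 2 * g0 * g1)) * x - g0 ^+ 2); first by rewrite /hyp /g; move: (x) => x'; ring.
  by rewrite E2 E1 E0 /M /S; move: (x) => x'; ring.
have g_0 : g = 0 by apply: (@rat_hyp x); apply/esym/eqP; rewrite -subr_eq0 Hf.
have Hf' : 5 * x ^+ 4 - 36 * x ^+ 3 + 39 * x ^+ 2 - 8 * x - 1 = 0.
  transitivity (2 * g * (g1 + 2 * z * x) + (3 * x ^+ 2 - 2 * c2 * x - c1) * (x ^+ 2 - S * x + M) +
     (x ^+ 3 - c2 * x ^+ 2 - c1 * x - c0) * (2 * x - S)); last by rewrite r0 r1 g_0 !mulr0 mul0r !addr0.
  transitivity (2 * g * (g1 + 2 * z * x) + (5 * x ^+ 4 - 4 * (9 + z ^+ 2) * x ^+ 3 + 3 * (13 - 2 * g1 * z) * x ^+ 2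
     - 2 * (4 + 2 * g0 * z + g1 ^+ 2) * x + (- (1 + 2 * g0 * g1)))); first by rewrite /g; move: (x) => x'; ring.
  by rewrite E2 E1 /g /M /S; move: (x) => x'; ring.
move: Hf; rewrite g_0 expr0n subr0 => {r0 r1 g g_0 E1 E0 E2 HD}.
move: (x) Hf' => {x} x Hf' Hf.
exact: hyp_squarefree Hf Hf'.
Qed.

Lemma residue_class : (S = 1 /\ M = 1) \/ [\/ S = 1 /\ M = 0, S = 7 / 9 /\ M = - (1 / 9), S = 11 /\ M = 9 | S = 9 /\ M = -1].
Proof.
have [_ E1 E0] := coef_eqs; have E2 := coef_eq2; have D0 := discr_neq0.
have Hyp (x : algC) : x ^+ 2 - ratr S * x + ratr M = 0 -> (ratr (g0 - z * M) + ratr (g1 + z * S) * x) ^+ 2 = hyp x.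
  move=> r0; transitivity ((ratr g0 + ratr g1 * x + ratr z * x ^+ 2) ^+ 2).
    congr (_ ^+ 2); rewrite -[RHS]subr0 -(mulr0 (ratr z)) -r0; move: (S) (M) => S' M'; ring.
  apply/esym/eqP; rewrite -subr_eq0; apply/eqP.
  transitivity ((x ^+ 3 - ratr c2 * x ^+ 2 - ratr c1 * x - ratr c0) * (x ^+ 2 - ratr S * x + ratr M)); last by rewrite r0 mulr0.
  transitivity (x ^+ 5 - (9 + ratr z ^+ 2) * x ^+ 4 + (13 - 2 * ratr g1 * ratr z) * x ^+ 3 - ratr (4 + 2 * g0 * z + g1 ^+ 2) * x ^+ 2
     + ratr (- (1 + 2 * g0 * g1)) * x - ratr (g0 ^+ 2)); first by rewrite /hyp; ring.
  by rewrite E2 E1 E0 /M /S; ring.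
have [D HDD] : exists D : algC, D ^+ 2 = ratr (S ^+ 2 - 4 * M) by exists (sqrtC (ratr (S ^+ 2 - 4 * M))); rewrite sqrtCK.
have Dn : D != 0 by apply: contraNneq D0 => Dz; move/esym/eqP: HDD; rewrite Dz expr0n fmorph_eq0.
move: (S) (M) Hyp HDD => S' M' Hyp HDD.
have HDE : D ^+ 2 = ratr S' ^+ 2 - 4 * ratr M' by rewrite HDD; ring.
apply: (@classify S' M' (g0 - z * M') (g1 + z * S') ((ratr S' + D) / 2) ((ratr S' - D) / 2)).
- by field.
- by transitivity ((ratr S' ^+ 2 - D ^+ 2) / 4); [field | rewrite HDE; field].
- apply: contraNneq Dn => E; apply/eqP.
  have -> : D = (ratr S' + D) / 2 - (ratr S' - D) / 2 by field.
  by rewrite E subrr.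
- by apply: Hyp; transitivity ((D ^+ 2 - (ratr S' ^+ 2 - 4 * ratr M')) / 4); [field | rewrite HDE subrr mul0r].
- by apply: Hyp; transitivity ((D ^+ 2 - (ratr S' ^+ 2 - 4 * ratr M')) / 4); [field | rewrite HDE subrr mul0r].
Qed.

Lemma residue_vals :
  s0 ^+ 2 - M * s1 ^+ 2 = resA S M /\ 2 * s0 * s1 + S * s1 ^+ 2 = resB S M.
Proof.
have [E2 E1 E0] := coef_eqs; rewrite E2 in E1 E0; split; apply/eqP; rewrite -subr_eq0; apply/eqP.
  by move/eqP: E0; rewrite -subr_eq0 => /eqP <-; rewrite /resA /resB /s0 /s1 /M /S; ring.
by move/eqP: E1; rewrite eq_sym -subr_eq0 => /eqP <-; rewrite /resA /resB /s0 /s1 /M /S; ring.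
Qed.
End Equations.

Lemma d_neq : d * (d - 1) != 0.
Proof.
rewrite mulf_neq0 //; first by apply: contraNneq dn => ->; exact: mem0v.
by rewrite subr_eq0; apply: contraNneq dn => ->; exact: rpred1.
Qed.

Lemma contra_case (om e : algC) (S M t0 t1 z kp : rat) (u : K) : om ^+ 2 = - om - 1 ->
  c2 = sg1 S z -> c1 = - sg2 S M t1 z -> c0 = sg3 S M t0 t1 z -> kp != 0 -> inW om e -> e != 0 ->
  resid (ratr z) om (ratr S) (ratr M) (ratr t0) (ratr t1) (ratr kp) e ->
  (u ^+ 3 + u ^+ 2 - 2 * u - 1) * (d * (d - 1)) = coord (t0 + z * M, t1 - z * S, z) * (u * (u + 1)) -> False.
Proof.
move=> Hom h2 h1 h0 k0 We e0 R.
have [v <-] := coord_surj u => Hu.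
have cX : coord (0, -1, 1) = d * (d - 1).
  by rewrite /coord rmorph0 rmorphN rmorph1; ring.
have Hv : (v ^+ 3 + v ^+ 2 - 2 * v - 1) * (0, -1, 1) = ((t0 + z * M, t1 - z * S, z) : TQ) * (v * (v + 1)).
  apply: coord_inj; move: Hu; rewrite -cX; move: ((0, -1, 1) : TQ) ((t0 + z * M, t1 - z * S, z) : TQ) => a b Hu.
  transitivity ((coord v ^+ 3 + coord v ^+ 2 - 2 * coord v - 1) * coord a); first by ring.
  by rewrite Hu; ring.
have N1 : cub_norm (v ^+ 2 + v + 1) != 0.
  apply: cub_norm_neq0; have := no3K dimK (coord v); congr (_ != 0).
  by ring.
have NX : cub_norm ((0, -1, 1) : TQ) != 0 by apply: cub_norm_neq0; rewrite cX; exact: d_neq.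
set g0 := t0 + z * M in Hv; set g1 := t1 - z * S in Hv.
(* In the notation explained at [resid], the rational factor is f(0) f(1) = g(0) g(1) and the cubed
   factor is f(-om). *)
apply: (@no_level7 c0 c1 c2 om Hom v _ kp (g0 * (g0 + g1 + z)) e
  (ratr g0 - ratr g1 * om + ratr z * om ^+ 2 + (1 + 3 * om)) Hv N1 NX k0 We e0).
  rewrite Hom.
  have W3 : inW om (1 + 3 * om) by exists 1, 3; rewrite rmorph1 rmorph_nat.
  have Wo := inW_om om; have Wr := inW_rat om; have W1 := Wr 1; rewrite rmorph1 in W1.
  apply: inWD W3; apply: inWD; last by apply: (inWM Hom) => //; apply: inWD; apply: inWN.
  by apply: inWD => //; apply: inWN; apply: (inWM Hom).
have -> : cub_norm (lift ((g0, g1, z) : TQ) - (0, - (1 + 3 * om), 1 + 3 * om)) =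
  @cub_norm algC (sg3 (ratr S) (ratr M) (ratr t0) (ratr t1) (ratr z)) (- sg2 (ratr S) (ratr M) (ratr t1) (ratr z)) (sg1 (ratr S) (ratr z))
    (ratr t0 + ratr z * ratr M, ratr t1 - ratr z * ratr S + (1 + 3 * om), ratr z - (1 + 3 * om)).
  have -> : sg1 (ratr S) (ratr z) = ratr c2 :> algC by rewrite h2 /sg1; ring.
  have -> : - sg2 (ratr S) (ratr M) (ratr t1) (ratr z) = ratr c1 :> algC by rewrite h1 /sg2 /sg1; ring.
  have -> : sg3 (ratr S) (ratr M) (ratr t0) (ratr t1) (ratr z) = ratr c0 :> algC by rewrite h0 /sg3 /sg2 /sg1; ring.
  apply: (congr1 (@cub_norm algC (ratr c0) (ratr c1) (ratr c2))); congr (_, _, _); rewrite /= /g0 /g1; ring.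
by rewrite [LHS]R /g0 /g1; ring.
Qed.

(** The residue of g modulo r is known up to sign; for the opposite sign, -g replaces g and the
    equation of u' for -y is the one used. *)
Lemma contra_pm (om e : algC) (S M t0 t1 g0 g1 z kp : rat) (u u' : K) : om ^+ 2 = - om - 1 ->
  coord (g0, g1, z) ^+ 2 = hyp d -> S = 9 + z ^+ 2 - c2 -> M = 13 - 2 * g1 * z + c1 - S * c2 ->
  (g0 - z * M = t0 /\ g1 + z * S = t1) \/ (g0 - z * M = - t0 /\ g1 + z * S = - t1) ->
  kp != 0 -> inW om e -> e != 0 ->
  (forall x : algC, resid x om (ratr S) (ratr M) (ratr t0) (ratr t1) (ratr kp) e) ->
  (u ^+ 3 + u ^+ 2 - 2 * u - 1) * (d * (d - 1)) = coord (g0, g1, z) * (u * (u + 1)) ->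
  (u' ^+ 3 + u' ^+ 2 - 2 * u' - 1) * (d * (d - 1)) = - coord (g0, g1, z) * (u' * (u' + 1)) -> False.
Proof.
move=> Hom Hg HS HM Ht k0 We e0 R Hu Hu'.
have [E2 _ _] := coef_eqs Hg; rewrite -HS -HM in E2.
have h2 : c2 = 9 + z ^+ 2 - S by rewrite HS; ring.
have h1 : c1 = M - 13 + 2 * g1 * z + S * c2 by rewrite HM; ring.
case: Ht => -[h0' h1'].
  have G0 : g0 = t0 + z * M by rewrite -h0'; ring.
  have G1 : g1 = t1 - z * S by rewrite -h1'; ring.
  move: Hu; rewrite G0 G1; apply: contra_case Hom _ _ _ k0 We e0 (R _).
  - by rewrite h2 /sg1; ring.
  - by rewrite h1 h2 G1 /sg2 /sg1; ring.
  - by rewrite E2 h1 h2 G1 G0 /sg3 /sg2 /sg1; ring.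
have G0 : - g0 = t0 + (- z) * M by rewrite -[t0]opprK -h0'; ring.
have G1 : - g1 = t1 - (- z) * S by rewrite -[t1]opprK -h1'; ring.
have N : - coord (g0, g1, z) = coord (- g0, - g1, - z) by rewrite /coord; ring.
move: Hu'; rewrite N G0 G1; apply: contra_case Hom _ _ _ k0 We e0 (R _).
- by rewrite h2 /sg1; ring.
- by rewrite h1 h2 -[g1]opprK G1 /sg2 /sg1; ring.
- by rewrite E2 h1 h2 -[g1]opprK G1 -[g0]opprK G0 /sg3 /sg2 /sg1; ring.
Qed.

Lemma coord_rigid (g0 g1 z : rat) (u u' : K) :
  coord (g0, g1, z) ^+ 2 = hyp d ->
  (u ^+ 3 + u ^+ 2 - 2 * u - 1) * (d * (d - 1)) = coord (g0, g1, z) * (u * (u + 1)) ->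
  (u' ^+ 3 + u' ^+ 2 - 2 * u' - 1) * (d * (d - 1)) = - coord (g0, g1, z) * (u' * (u' + 1)) ->
  coord (g0, g1, z) = iota z * (d * (d - 1)).
Proof.
move=> Hg Hu Hu'.
have [om Hom] : exists om : algC, om ^+ 2 = - om - 1.
  exists ((-1 + sqrtC (-3)) / 2); have H3 : sqrtC (-3 : algC) ^+ 2 = -3 by rewrite sqrtCK.
  by field: H3.
have om0 : 1 + 2 * om != 0.
  apply/eqP => H; have : (1 + 2 * om) ^+ 2 = -3 by ring: Hom.
  by rewrite H expr0n => /esym/eqP; rewrite oppr_eq0 pnatr_eq0.
have Wo : inW om (1 + 2 * om) by exists 1, 2; rewrite rmorph1 rmorph_nat.
have W1 : inW om 1 by exists 1, 0; rewrite rmorph1 rmorph0 mul0r addr0.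
have C := residue_class Hg; have [VA VB] := residue_vals Hg.
pose S := 9 + z ^+ 2 - c2; pose M := 13 - 2 * g1 * z + c1 - S * c2.
have HS : S = 9 + z ^+ 2 - c2 by []. have HM : M = 13 - 2 * g1 * z + c1 - S * c2 by [].
rewrite -!HS -!HM in C VA VB; clearbody S M.
have contra := fun e t0 t1 kp p => @contra_pm om e S M t0 t1 g0 g1 z kp u u' Hom Hg HS HM p.
case: C => [|[]] -[S1 M1]; rewrite S1 M1 in contra VA VB HS HM.
- case: (contra 1 1 (-3) (-2) (residue1 VA VB)); [by []|exact: W1|exact: oner_neq0| |exact: Hu|exact: Hu'].
  by move=> x; have := resid1 x Hom; rewrite (rmorph1 ratr) !(rmorphN ratr) !(rmorph_nat ratr).
- have [h0 h1] := residue5 VA VB.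
  have -> : g0 = 0 by rewrite -h0 mulr0 subr0.
  have -> : g1 = - z by rewrite -[LHS](addrK (z * 1)) h1; ring.
  by rewrite /coord; ring.
- exfalso; have Ht := residue2 VA VB.
  have k0 := @natdiv_neq0 2 243 isT isT.
  apply: (contra (1 + 2 * om) (5 / 27) (- (1 / 27)) (2 / 243) Ht k0 Wo om0 _ Hu Hu') => x.
  have := resid2 x Hom.
  rewrite 2!(rmorphN ratr) 5!(fmorph_div ratr).
  rewrite !(rmorph1 ratr) !(rmorph_nat ratr).
  exact.
- case: (contra (1 + 2 * om) 15 (-17) 6 (residue3 VA VB)); [by []|exact: Wo|exact: om0| |exact: Hu|exact: Hu'].
  by move=> x; have := resid3 x Hom; rewrite !(rmorphN ratr) !(rmorph_nat ratr).
- case: (contra (1 + 2 * om) 1 11 (-6) (residue4 VA VB)); [by []|exact: Wo|exact: om0| |exact: Hu|exact: Hu'].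
  by move=> x; have := resid4 x Hom; rewrite !(rmorphN ratr) !(rmorph1 ratr) !(rmorph_nat ratr).
Qed.
End Coordinates.
End Main.

(** N2 N4^3 / t is the j-invariant as a function on X_0(7) with Hauptmodul t. *)
Definition N2 (R : comNzRingType) (t : R) := t ^+ 2 + 13 * t + 49.
Definition N4 (R : comNzRingType) (t : R) := t ^+ 2 + 5 * t + 1.
Definition N6 (R : comNzRingType) (t : R) := - (t ^+ 4 + 14 * t ^+ 3 + 63 * t ^+ 2 + 70 * t - 7).

(* [N2 t], [N4 t], [N6 t] are qq^3 / X^2, c4 / (qq X^2), c6 / X^4 on [tate d], where
   X = d (d - 1) and t = (d^3 - 8 d^2 + 5 d + 1) / X. *)
Definition model (F : fieldType) (t : F) : wcoef F :=
  WCoef 0 0 0 (- (27 * (N2 t ^+ 3 * N4 t))) (- (54 * (N2 t ^+ 4 * N6 t))).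

(** * The model over Q *)

Lemma wiso_disc (F : fieldType) (E E' : wcoef F) : wiso E E' -> exists2 u, u != 0 & wdisc E = u ^+ 12 * wdisc E'.
Proof.
move=> [u [r [s [t [u0 [h1 h2 h3 h4 h6]]]]]]; exists u => //.
have k1 : a1 E = u * a1 E' - 2%:R * s by rewrite h1; ring.
have k2 : a2 E = u ^+ 2 * a2 E' + s * a1 E - 3%:R * r + s ^+ 2 by rewrite h2; ring.
have k3 : a3 E = u ^+ 3 * a3 E' - r * a1 E - 2%:R * t by rewrite h3; ring.
have k4 : a4 E = u ^+ 4 * a4 E' + s * a3 E - 2%:R * r * a2 E + (t + r * s) * a1 E
   - 3%:R * r ^+ 2 + 2%:R * s * t by rewrite h4; ring.
have k6 : a6 E = u ^+ 6 * a6 E' - (r * a4 E + r ^+ 2 * a2 E + r ^+ 3 - t * a3 E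
   - t ^+ 2 - r * t * a1 E) by rewrite h6; ring.
rewrite /wdisc k6 k4 k3 k2 k1; ring.
Qed.

Lemma wiso_elliptic (F : fieldType) (E E' : wcoef F) : wiso E E' -> elliptic E = elliptic E'.
Proof. by case/wiso_disc => u u0; rewrite /elliptic => ->; rewrite mulf_eq0 expf_eq0 (negbTE u0). Qed.

Definition c4 (F : fieldType) (E : wcoef F) : F :=
  (a1 E ^+ 2 + 4 * a2 E) ^+ 2 - 24 * (2 * a4 E + a1 E * a3 E).
Definition c6 (F : fieldType) (E : wcoef F) : F :=
  - (a1 E ^+ 2 + 4 * a2 E) ^+ 3 + 36 * (a1 E ^+ 2 + 4 * a2 E) * (2 * a4 E + a1 E * a3 E) - 216 * (a3 E ^+ 2 + 4 * a6 E).

(** Completing the square and the cube gives the short form with -27 c4 and -54 c6; v rescales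
    it. *)
Lemma wiso_short (F : fieldType) (E : wcoef F) (v : F) : 6 * v != 0 ->
  wiso (WCoef 0 0 0 (- (27 * (v ^+ 4 * c4 E))) (- (54 * (v ^+ 6 * c6 E)))) E.
Proof.
move=> v0; exists (6 * v), (12 * v ^+ 2 * a2 E + 3 * v ^+ 2 * a1 E ^+ 2), (3 * v * a1 E), (108 * v ^+ 3 * a3 E).
by split=> //; rewrite /c4 /c6 /=; split; ring.
Qed.

Section Model.
Variables (F : fieldType) (d t : F).
Hypotheses (two : 2 != 0 :> F) (three : 3 != 0 :> F) (d0 : d != 0) (d1 : d - 1 != 0) (q0 : qq d != 0).
Hypothesis ht : d ^+ 3 - 8 * d ^+ 2 + 5 * d + 1 = t * (d * (d - 1)).

Lemma wiso_model : wiso (model t) (tate d).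
Proof.
have -> : t = (d ^+ 3 - 8 * d ^+ 2 + 5 * d + 1) / (d * (d - 1)) by rewrite ht mulfK ?mulf_neq0.
have EN : N2 ((d ^+ 3 - 8 * d ^+ 2 + 5 * d + 1) / (d * (d - 1))) = qq d ^+ 3 / (d * (d - 1)) ^+ 2.
  by rewrite /N2 /qq; field; rewrite d0 d1.
have E4 : N4 ((d ^+ 3 - 8 * d ^+ 2 + 5 * d + 1) / (d * (d - 1))) = SS d / (d * (d - 1)) ^+ 2.
  by rewrite /N4 /SS; field; rewrite d0 d1.
have E6 : N6 ((d ^+ 3 - 8 * d ^+ 2 + 5 * d + 1) / (d * (d - 1))) = c6t d / (d * (d - 1)) ^+ 4.
  by rewrite /N6 /c6t; field; rewrite d0 d1.
have X0 : d * (d - 1) != 0 by rewrite mulf_neq0.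
(* The powers of [N2] in [model] make N2^3 N4 = v^4 c4 and N2^4 N6 = v^6 c6 with the same v, so that
   no quadratic twist remains. *)
pose v := qq d ^+ 2 / (d * (d - 1)) ^+ 2.
have v0 : 6 * v != 0.
  by rewrite (_ : 6 = 2 * 3) ?mulf_neq0 ?invr_eq0 ?expf_neq0 //; ring.
have -> : model ((d ^+ 3 - 8 * d ^+ 2 + 5 * d + 1) / (d * (d - 1))) =
  WCoef 0 0 0 (- (27 * (v ^+ 4 * c4 (tate d)))) (- (54 * (v ^+ 6 * c6 (tate d)))).
  rewrite /model EN E4 E6 /v.
  have -> : c4 (tate d) = qq d * SS d by rewrite /c4 /tate /qq /SS /=; ring.
  have -> : c6 (tate d) = c6t d by rewrite /c6 /tate /c6t /=; ring.
  congr (WCoef _ _ _ (- (27 * _)) (- (54 * _))).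
    by move: (qq d) (SS d) (d * (d - 1)) X0 => q S X X0; field; rewrite X0.
  by move: (qq d) (c6t d) (d * (d - 1)) X0 => q S X X0; field; rewrite X0.
exact: wiso_short.
Qed.
End Model.

(** * Normality of K *)

Section Normal.
Variable K : fieldExtType rat.
Hypothesis dimK : \dim (fullv : {vspace K}) = 3%N.
Local Notation iota := (in_alg K).
Variables (d : K) (t : rat).
Hypotheses (dn : d \notin 1%VS) (ht : d ^+ 3 - 8 * d ^+ 2 + 5 * d + 1 = iota t * (d * (d - 1))).

(** The map d -> 1 / (1 - d) has order 3 and fixes the rational number t, so it permutes the roots
    of the cubic of d. *)
Lemma splitting_cubic : splitting_field_axiom K.
Proof.
have [d0 d1] : d != 0 /\ 1 - d != 0.
  split; first by apply: contraNneq dn => ->; exact: mem0v.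
  by rewrite subr_eq0; apply: contraNneq dn => <-; exact: rpred1.
pose p : {poly rat} := 'X^3 - (8 + t)%:P * 'X^2 + (5 + t)%:P * 'X - (-1)%:P.
exists (map_poly iota p); first by apply/polyOver1P; exists p.
exists [:: d; 1 / (1 - d); 1 - 1 / d].
  rewrite big_cons big_cons big_seq1.
  have -> : map_poly iota p = 'X^3 - (iota (8 + t))%:P * 'X^2 + (iota (5 + t))%:P * 'X - (iota (-1))%:P.
    by rewrite /p rmorphB rmorphD rmorphB /= map_polyXn map_polyC; congr (_ - _ + _ - _); rewrite rmorphM /= map_polyC ?map_polyXn ?map_polyX.
  have Ht : iota t = (d ^+ 3 - 8 * d ^+ 2 + 5 * d + 1) / (d * (d - 1)).
    by rewrite ht mulfK // mulf_neq0 // -oppr_eq0 opprB.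
  have d1' : d - 1 != 0 by rewrite -oppr_eq0 opprB.
  have R1 : iota (8 + t) = d + 1 / (1 - d) + (1 - 1 / d).
    by transitivity (8 + iota t); [ring | rewrite Ht; field; rewrite ?d0 ?d1 ?d1'].
  have R2 : iota (5 + t) = d * (1 / (1 - d)) + 1 / (1 - d) * (1 - 1 / d) + (1 - 1 / d) * d.
    by transitivity (5 + iota t); [ring | rewrite Ht; field; rewrite ?d0 ?d1 ?d1'].
  have R3 : iota (-1) = d * (1 / (1 - d)) * (1 - 1 / d).
    by transitivity (-1 : K); [ring | field; rewrite ?d0 ?d1 ?d1'].
  rewrite R1 R2 R3; move: (1 / (1 - d)) (1 - 1 / d) => x y.
  set q := (X in X %= _); set q' := (X in _ %= X); suff -> : q = q' by exact: eqpxx.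
  by rewrite /q /q'; ring.
apply/eqP; rewrite eqEdim subvf /= dimK.
have sub : (<<1; d>> <= <<1 & [:: d; 1 / (1 - d); 1 - 1 / d]>>)%VS.
  apply/FadjoinP; split; first exact: subv_adjoin_seq.
  by apply: seqv_sub_adjoin; rewrite mem_head.
by apply: leq_trans (dimvS sub); rewrite dim_Fadjoin dimv1 degree3.
Qed.

Lemma cubic_normal : normal_over_Q K.
Proof.
pose L : splittingFieldType rat := HB.pack K (FieldExt_isSplittingField.Build rat K splitting_cubic).
move=> x; have [rs /eqP H] := @splitting_field_normal rat L 1%AS x.
by exists rs.
Qed.
End Normal.

Lemma wdisc_map (F F' : fieldType) (f : {rmorphism F -> F'}) (E : wcoef F) : wdisc (wmap f E) = f (wdisc E).
Proof. by rewrite /wdisc /wmap /=; ring. Qed.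

Lemma model_map (F F' : fieldType) (f : {rmorphism F -> F'}) (t : F) : wmap f (model t) = model (f t).
Proof. by rewrite /wmap /model /N2 /N4 /N6 /=; congr WCoef; ring. Qed.

Lemma cubic_parameter (K : fieldExtType rat) (E : wcoef K) : \dim (fullv : {vspace K}) = 3%N ->
  elliptic E -> has_C2xC14 E ->
  exists (d : K) (t : rat), [/\ wiso E (tate d), d \notin 1%VS &
    d ^+ 3 - 8 * d ^+ 2 + 5 * d + 1 = in_alg K t * (d * (d - 1))].
Proof.
move=> dimK El /(tate14 (charK K 1)) [d [W [e [e' [ne r r']]]]].
rewrite (wiso_elliptic W) in El.
have [y [Hy y0 [u Hu] [u' Hu']]] := tate_level7 (charK K 1) (charK K 2) (no3K dimK) (no85K dimK) El ne r r'.
have dn : d \notin 1%VS.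
  apply/negP => /vlineP[q Hq]; have [s [ys hs]] : exists s, y = in_alg K s /\ s ^+ 2 = hyp q.
    apply: (sqrt_rat2 dimK); rewrite Hy Hq /hyp -[q%:A]/(in_alg K q); ring.
  by case/eqP: y0; rewrite ys (rat_hyp hs) rmorph0.
have [c0 [c1 [c2 d3]]] := span3 dimK (d ^+ 3) dn.
have [g0 [g1 [z Ey]]] := span3 dimK y dn.
have yc : y = coord d ((g0, g1, z) : cub c0 c1 c2) by [].
have Ez : y = in_alg K z * (d * (d - 1)).
  by rewrite yc in Hy Hu Hu' *; apply: (coord_rigid dimK dn d3 Hy Hu Hu').
have X0 : d * (d - 1) != 0.
  by move: El; rewrite /elliptic wdisc_tate => /eqP El; apply/eqP => X0; apply: El; rewrite -exprMn X0 expr0n mul0r.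
exists d, (z ^+ 2); split=> //.
apply: (mulfI X0); rewrite -[LHS]/(hyp d) -Hy Ez; ring.
Qed.

Theorem theorem2 (K : fieldExtType rat) (E : wcoef K) :
  \dim (fullv : {vspace K}) = 3%N ->
  elliptic E ->
  has_C2xC14 E ->
  normal_over_Q K /\
  exists E0 : wcoef rat, elliptic E0 /\ wiso (wmap (fun q : rat => ratr q : K) E0) E.
Proof.
move=> dimK El /(cubic_parameter dimK El) [d [t [W dn ht]]].
split; first exact: cubic_normal ht.
have [d0 d1] : d != 0 /\ d - 1 != 0.
  split; first by apply: contraNneq dn => ->; exact: mem0v.
  by rewrite subr_eq0; apply: contraNneq dn => ->; exact: rpred1.
have q0 : qq d != 0.
  by have := no3K dimK (- d); congr (_ != 0); rewrite /qq; ring.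
have WM := wiso_model (charK K 1) (charK K 2) d0 d1 q0 ht.
have WE := wiso_trans WM (wiso_sym W).
have EM : wmap (fun q : rat => ratr q : K) (model t) = wmap (in_alg K) (model t).
  by rewrite /wmap -!in_alg_ratr.
exists (model t); rewrite EM model_map; split=> //.
have : elliptic (wmap (in_alg K) (model t)) by rewrite model_map (wiso_elliptic WE).
by rewrite /elliptic wdisc_map fmorph_eq0.
Qed.
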